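(* Let $\alpha\in(0,2)$. (Symmetric case) There exists $C>0$ such that $$\left|\int (|D|^\alpha u)\,u\,|\phi'_{j,A}|-\int\left(|D|^{\frac{\alpha}{2}}\left(u\sqrt{|\phi'_{j,A}|}\right)\right)^2\right|\le \frac{C}{A^\alpha}\int u^2|\phi'_{j,A}|$$ and $$\left|\int (|D|^\alpha u)\,\partial_xu\,\phi_{j,A}+\frac{\alpha-1}{2}\int\left(|D|^{\frac{\alpha}{2}}\left(u\sqrt{|\phi'_{j,A}|}\right)\right)^2\right|\le\frac{C}{A^\alpha}\int u^2|\phi'_{j,A}|$$ for any $u\in\mathcal{S}(\mathbb{R})$, $A>1$ and $j\in\{1,\dots,N\}$. (Non-symmetric case) There exists $C>0$ such that, for any $u,v\in\mathcal{S}(\mathbb{R})$, $A>1$ and $j\in\{1,\dots,N\}$, $$\left|\int\left((|D|^\alpha u)v-(|D|^\alpha v)u\right)|\phi'_{j,A}|\right|\le B_A(u,v)$$ and $$\left|\int\left((|D|^\alpha u)\partial_xv+(|D|^\alpha v)\partial_xu\right)\phi_{j,A}+(\alpha-1)\int|D|^{\frac{\alpha}{2}}\left(u\sqrt{|\phi'_{j,A}|}\right)|D|^{\frac{\alpha}{2}}\left(v\sqrt{|\phi'_{j,A}|}\right)\right|\le B_A(u,v),$$ where $$B_A(u,v)=\begin{cases}\dfrac{C}{A^\alpha}\displaystyle\int(u^2+v^2)|\phi'_{j,A}|, & \alpha\in(0,1],\\[2mm] \dfrac{C}{A^{\frac{\alpha}{2}}}\displaystyle\int\left(u^2+v^2+(|D|^{\frac{\alpha}{2}}u)^2\right)|\phi'_{j,A}|,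 & \alpha\in(1,2).\end{cases}$$
   Context: All functions are real-valued, all integrals are over $\mathbb{R}$ in $x$, $|D|^s$ is the Fourier multiplier with symbol $|\xi|^s$, $\langle y\rangle=\sqrt{1+y^2}$, and $\mathcal{S}(\mathbb{R})$ is the Schwartz space. Let $$\phi(x)=1-C_\phi\int_{-\infty}^x\frac{dy}{\langle y\rangle^{1+\alpha}},\qquad C_\phi=\left(\int_{-\infty}^{+\infty}\frac{dy}{\langle y\rangle^{1+\alpha}}\right)^{-1}.$$ Given real numbers $\rho_1<\cdots<\rho_N$ (in the paper, functions $\rho_j(t)$ of time; time is a fixed parameter here), set $m_j=\frac{\rho_j+\rho_{j+1}}{2}$, $\phi_{j,A}(x)=\phi\left(\frac{x-m_j}{A}\right)$ for $j\in\{1,\dots,N-1\}$, and $\phi_{N,A}:=1$. $\phi'_{j,A}$ is the derivative of $\phi_{j,A}$ with respect to $x$. The constants $C$ do not depend on $u,v,A,j$ nor on the $\rho_j$. *)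

(* Defs.v *)
From mathcomp Require Import all_boot all_order all_algebra.
From mathcomp Require Import all_classical all_reals all_analysis.
From mathcomp Require Import complex.
Import Order.TTheory GRing.Theory Num.Theory.
Import numFieldNormedType.Exports.

Set Implicit Arguments.
Unset Strict Implicit.
Unset Printing Implicit Defensive.

Local Open Scope classical_set_scope.
Local Open Scope complex_scope.
Local Open Scope ring_scope.

Definition japanese {R : realType} (y : R) : R := Num.sqrt (1 + y ^+ 2).

Definition schwartz {R : realType} (u : R -> R) : Prop :=
  (forall (n : nat) (x : R), derivable (derive1n n u) x 1) /\
  (forall m n : nat, exists M : R, forall x : R, `|x ^+ m * derive1n n u x| <= M).

Definition expi {R : realType} (t : R) : R[i] := cos t +i* sin t.

Definition cintegral {R : realType} (f : R -> R[i]) : R[i] :=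
  (\int[lebesgue_measure]_x complex.Re (f x))
  +i* (\int[lebesgue_measure]_x complex.Im (f x)).

(* Convention: (F f)(xi) = \int e^{- i x xi} f(x) dx, with the factor 1 / (2 pi)
   on the inverse transform, so that |D|^2 = - d^2/dx^2. *)
Definition fourier {R : realType} (f : R -> R[i]) (xi : R) : R[i] :=
  cintegral (fun x => expi (- (x * xi)) * f x).

Definition inv_fourier {R : realType} (g : R -> R[i]) (x : R) : R[i] :=
  ((2 * pi)^-1)%:C * cintegral (fun xi => expi (x * xi) * g xi).

(* For real-valued u the symbol |xi|^s is real and even, hence the inverse
   transform below is real-valued and Re only changes the codomain. *)
Definition absD {R : realType} (s : R) (u : R -> R) (x : R) : R :=
  complex.Re (inv_fourier
    (fun xi => (`|xi| `^ s)%:C * fourier (fun y => (u y)%:C) xi) x).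

Definition C_phi {R : realType} (alpha : R) : R :=
  (\int[lebesgue_measure]_y (japanese y `^ (1 + alpha))^-1)^-1.

Definition phi {R : realType} (alpha x : R) : R :=
  1 - C_phi alpha * \int[lebesgue_measure]_(y in `]-oo, x]) (japanese y `^ (1 + alpha))^-1.

(* The points rho_1 < ... < rho_N are the values at 1, ..., N of rho : nat -> R;
   the other values of rho are irrelevant. *)
Definition increasing_points {R : realType} (N : nat) (rho : nat -> R) : Prop :=
  forall i : nat, (1 <= i < N)%N -> rho i < rho i.+1.

Definition midpoint {R : realType} (rho : nat -> R) (j : nat) : R :=
  (rho j + rho j.+1) / 2.

Definition phiA {R : realType} (alpha : R) (N : nat) (rho : nat -> R) (A : R)
    (j : nat) (x : R) : R :=
  if (j < N)%N then phi alpha ((x - midpoint rho j) / A) else 1.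

Definition abs_dphiA {R : realType} (alpha : R) (N : nat) (rho : nat -> R)
    (A : R) (j : nat) (x : R) : R :=
  `| derive1 (phiA alpha N rho A j) x |.

Definition sqrt_weighted {R : realType} (w u : R -> R) (x : R) : R :=
  u x * Num.sqrt (w x).

Definition B_A {R : realType} (alpha C A : R) (w u v : R -> R) : R :=
  if alpha <= 1 then
    C / A `^ alpha * \int[lebesgue_measure]_x ((u x ^+ 2 + v x ^+ 2) * w x)
  else
    C / A `^ (alpha / 2) *
    \int[lebesgue_measure]_x
      ((u x ^+ 2 + v x ^+ 2 + absD (alpha / 2) u x ^+ 2) * w x).

(* Main.v *)
(* Write the weight |phi'_{j,A}| as w = c A^alpha rho^(-1-alpha), where rho(x)^2 = A^2 + (x-m)^2,
   and K(h) = h^(-1-alpha) for h > 0.  Up to a constant, the form (u,v) |-> int (|D|^alpha u) v is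
   the double integral of K(h) (u(x+h)-u(x)) (v(x+h)-v(x)); hence each left-hand side of the
   theorem is a double integral of K times an explicit combination of values of u, v, w at x and
   x+h.  For the flow terms one integrates by parts in x and in h, which replaces the derivatives
   of u and v by the mean slope of phi over [x, x+h].  Second order differences of w and squares
   of differences of sqrt w are O(w(x) (h/rho(x))^2) for h <= rho(x)/2, and K is integrable for
   larger h; this gives the gain A^(-alpha).

   In the commutator (|D|^alpha u) v - (|D|^alpha v) u only a first order difference of w appears.
   It is integrable against K if alpha < 1.  If alpha = 1, the weight is exactly c A / rho^2 and
   the kernel factors into two Hilbert transforms.  If 1 < alpha < 2, Cauchy-Schwarz reduces the
   estimate to the boundedness of || |D|^s (u sqrt w) ||_2, s = alpha/2, by the weighted norms of u
   and |D|^s u.  The commutator of |D|^s with sqrt w has an integrable kernel plus the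
   rank one term sqrt w(x) T, where T = int u rho^(-1-s), and T itself is controlled by testing
   |D|^s u against w, because |D|^s w is close to a multiple of rho^(-1-s) (w has mass one). *)
Require Import Defs.
From mathcomp Require Import all_boot all_order all_algebra.
From mathcomp Require Import all_classical all_reals all_analysis.
From mathcomp Require Import measurable_realfun.
From mathcomp Require Import complex ring lra.
Import Order.TTheory GRing.Theory Num.Theory.
Import numFieldNormedType.Exports.

Set Implicit Arguments.
Unset Strict Implicit.
Unset Printing Implicit Defensive.

Local Open Scope classical_set_scope.
Local Open Scope ring_scope.

(** * Real-valued integrals *)

Section real_integral.
Context d (T : measurableType d) (R : realType)
  (mu : {measure set T -> \bar R}).
Implicit Types f g : T -> R.

(** The gain rests on the identity [rho^(-1-alpha) = A^(-alpha) w / C_phi]: what the kernel leaves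
    at distances of order [rho(x)] is already a multiple of [A^(-alpha) w(x)]. Since [w] has mass
    one, the far terms are uniform in [A] and in the midpoint.

    The obstacle is the commutator for [alpha > 1]. The functional [T] escapes the weighted norm of
    [u] alone: Cauchy-Schwarz would need the integral of [rho^(-2-2s) / w], which behaves like that
    of [1 / rho] and diverges logarithmically. This is where [|D|^s u] is needed on the right-hand
    side. The energy of [u sqrt w] carries no power of [A], while the term with [v] carries
    [A^(-alpha)]; Young's inequality with weight [A^(-alpha/2)] balances the two, which explains the
    exponent in [B_A].

    Only real integrals occur: the Hartley transform replaces the complex one, with Parseval and
    inversion obtained by Abel summation, and the bilinear forms are absolutely convergent double
    integrals, so that no principal value is taken. *)

Definition itg f := mu.-integrable setT (EFin \o f).

Lemma itg_measurable f : itg f -> measurable_fun setT f.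
Proof. by move=> /measurable_int /measurable_EFinP. Qed.

Lemma itg_dom g f : itg g -> measurable_fun setT f ->
  (forall x, `|f x| <= g x) -> itg f.
Proof.
move=> hg mf fg; move: hg; apply: le_integrable => //; first exact/measurable_EFinP.
by move=> x _ /=; rewrite lee_fin (le_trans (fg x))// ler_norm.
Qed.

Lemma eq_itg g f : f =1 g -> itg g -> itg f.
Proof. by move=> /funext ->. Qed.

Lemma itgD f g : itg f -> itg g -> itg (fun x => f x + g x).
Proof. by move=> hf hg; exact: (integrableD _ hf hg). Qed.

Lemma itgB f g : itg f -> itg g -> itg (fun x => f x - g x).
Proof. by move=> hf hg; exact: (integrableB _ hf hg). Qed.

Lemma itgZ r f : itg f -> itg (fun x => r * f x).
Proof. by move=> hf; exact: (integrableZl _ r hf). Qed.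

Lemma itgZr r f : itg f -> itg (fun x => f x * r).
Proof. by move=> /(itgZ r); apply: eq_itg => x; rewrite mulrC. Qed.

Lemma itgN f : itg f -> itg (fun x => - f x).
Proof. by move=> /(itgZ (-1)); apply: eq_itg => x; rewrite mulN1r. Qed.

Lemma itg_abs f : itg f -> itg (fun x => `|f x|).
Proof. by move=> hf; exact: integrable_norm. Qed.

Lemma itgMb r f g : itg f -> measurable_fun setT g ->
  (forall x, `|g x| <= r) -> itg (fun x => f x * g x).
Proof.
move=> hf mg gr; apply: (@itg_dom (fun x => `|f x| * r)).
- exact/itgZr/itg_abs.
- by apply: measurable_funM => //; exact: itg_measurable.
- by move=> x; rewrite normrM ler_wpM2l.
Qed.

Lemma eqI g f : f =1 g -> \int[mu]_x f x = \int[mu]_x g x.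
Proof. by move=> /funext ->. Qed.

Lemma ID f g : itg f -> itg g ->
  \int[mu]_x (f x + g x) = \int[mu]_x f x + \int[mu]_x g x.
Proof. by move=> hf hg; exact: RintegralD. Qed.

Lemma IB f g : itg f -> itg g ->
  \int[mu]_x (f x - g x) = \int[mu]_x f x - \int[mu]_x g x.
Proof. by move=> hf hg; exact: RintegralB. Qed.

Lemma IZ r f : itg f -> \int[mu]_x (r * f x) = r * \int[mu]_x f x.
Proof. by move=> hf; exact: RintegralZl. Qed.

Lemma IZr r f : itg f -> \int[mu]_x (f x * r) = \int[mu]_x f x * r.
Proof. by move=> hf; exact: RintegralZr. Qed.

Lemma IN f : itg f -> \int[mu]_x (- f x) = - \int[mu]_x f x.
Proof.
by move=> /(IZ (-1)); rewrite mulN1r => <-; apply: eqI => x; rewrite mulN1r.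
Qed.

Lemma I0 : \int[mu]_x (0 : R) = 0.
Proof. by rewrite Rintegral_cst// mul0r. Qed.

Lemma le_I f g : itg f -> itg g -> (forall x, f x <= g x) ->
  \int[mu]_x f x <= \int[mu]_x g x.
Proof. by move=> hf hg fg; apply: le_Rintegral. Qed.

Lemma I_ge0 f : (forall x, 0 <= f x) -> 0 <= \int[mu]_x f x.
Proof. by move=> f0; apply: Rintegral_ge0. Qed.

Lemma le_abs_I f : itg f -> `|\int[mu]_x f x| <= \int[mu]_x `|f x|.
Proof. by move=> hf; apply: le_normr_Rintegral. Qed.

Lemma le_abs_Idom g f : itg g -> measurable_fun setT f ->
  (forall x, `|f x| <= g x) -> `|\int[mu]_x f x| <= \int[mu]_x g x.
Proof.
move=> hg mf fg; have hf := itg_dom hg mf fg.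
by apply: (le_trans (le_abs_I hf)); apply: le_I => //; exact: itg_abs.
Qed.

Lemma EFinI f : itg f -> (\int[mu]_x f x)%:E = (\int[mu]_x (f x)%:E)%E.
Proof. by move=> hf; rewrite fineK//; exact: integrable_fin_num. Qed.

Lemma ge0_itgP f r : measurable_fun setT f -> (forall x, 0 <= f x) ->
  (\int[mu]_x (f x)%:E <= r%:E)%E -> itg f /\ \int[mu]_x f x <= r.
Proof.
move=> mf f0 fr; have hf : itg f.
  apply/integrableP; split; first exact/measurable_EFinP.
  under eq_integral do rewrite /= ger0_norm//.
  by apply: (le_lt_trans fr); rewrite ltry.
by split => //; rewrite -lee_fin EFinI.
Qed.

Lemma dct (f_ : nat -> T -> R) f g : itg g ->
  (forall n, measurable_fun setT (f_ n)) ->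
  (forall x, f_ ^~ x @ \oo --> f x) ->
  (forall n x, `|f_ n x| <= g x) ->
  itg f /\ (fun n => \int[mu]_x f_ n x) @ \oo --> \int[mu]_x f x.
Proof.
move=> hg mf_ f_f f_g.
have [] := @dominated_convergence _ _ _ mu setT measurableT
  (fun n x => (f_ n x)%:E) (fun x => (f x)%:E) (EFin \o g).
- by move=> n; exact/measurable_EFinP.
- by apply/measurable_EFinP; apply: measurable_fun_cvg => // x _; exact: f_f.
- by apply: aeW => x _; apply: cvg_EFin; [exact: nearW|exact: f_f].
- exact: hg.
- by apply: aeW => x n _ /=; rewrite lee_fin.
move=> hf _ cf; split => //; apply: fine_cvg.
by rewrite -/(Rintegral _ _ _) EFinI.
Qed.

(** Fatou's lemma supplies the integrability of the limit along with the bound; improper integrals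
    of nonnegative functions and the square integrability of transforms are obtained this way. *)
Lemma fatou_itg (f_ : nat -> T -> R) f r : (forall n x, 0 <= f_ n x) ->
  (forall n, itg (f_ n)) -> (forall n, \int[mu]_x f_ n x <= r) ->
  (forall x, f_ ^~ x @ \oo --> f x) -> itg f /\ \int[mu]_x f x <= r.
Proof.
move=> f_0 if_ f_r f_f.
have cf x : (f_ n x)%:E @[n --> \oo] --> (f x)%:E.
  by apply: cvg_EFin; [exact: nearW|exact: f_f].
apply: ge0_itgP.
- by apply: (@measurable_fun_cvg _ _ _ _ f_) => [n|x _]; [exact: itg_measurable|exact: f_f].
- move=> x; rewrite -(cvg_lim _ (f_f x))//; apply: limr_ge; [exact: cvgP (f_f x)|exact: nearW].
- have := @fatou _ _ _ mu setT measurableT (fun n x => (f_ n x)%:E) _ _.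
  have -> : (\int[mu]_x (f x)%:E = \int[mu]_x limn_einf (fun n => (f_ n x)%:E))%E.
    apply: eq_integral => x _; by rewrite (cvg_limn_einf_sup (cf x)).1.
  move=> h; apply: le_trans (h _ _) _.
  + by move=> n; exact/measurable_EFinP/itg_measurable.
  + by move=> n x _; rewrite lee_fin.
  + rewrite limn_einf_lim; apply: lime_le; first exact: is_cvg_einfs.
    apply: nearW => n; apply: le_trans (_ : (\int[mu]_x (f_ n x)%:E <= _)%E).
      by apply: ereal_inf_lbound; exists n => //=.
    by rewrite -EFinI// lee_fin.
Qed.

End real_integral.

(** * Affine changes of variable *)

Section affine_change.
Context (R : realType).
Notation mu := (@lebesgue_measure R).
Implicit Types f g : R -> R.

Definition affine (r c x : R) : R := r * x + c.

Lemma measurable_affine r c : measurable_fun setT (affine r c).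
Proof. by apply: measurable_funD => //; apply: measurable_funM. Qed.

(** The image measure under [affine r c], scaled by [|r|], gives half-open intervals their length,
    and this characterises Lebesgue measure. *)
Lemma lebesgue_measure_affine (r c : R) (A : set R) : r != 0 -> measurable A ->
  mu A = (`|r|%:E * mu (affine r c @^-1` A))%E.
Proof.
move=> r0 mA.
pose k := NngNum (normr_ge0 r).
have ma : measurable_fun [set: measurableTypeR R] (affine r c : measurableTypeR R -> measurableTypeR R) by exact: measurable_affine.
pose m0 : {measure set (measurableTypeR R) -> \bar R} :=
  measure_function_pushforward__canonical__measure_function_Measure mu ma.
pose m : {measure set (measurableTypeR R) -> \bar R} := mscale k m0.
apply: (@lebesgue_measure_unique _ m) => // _ [[a b]] _ <-.
rewrite -[RHS]/(`|r|%:E * mu (affine r c @^-1` [set` `]a, b]]))%E /=.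
have [rp|rn] : 0 < r \/ r < 0 by move: r0; rewrite neq_lt => /orP[]; [right|left].
  have -> : affine r c @^-1` `]a, b] = `](a - c) / r, (b - c) / r]%classic.
    apply/seteqP; split => x; rewrite /affine /= !in_itv/= => /andP[h1 h2].
      by rewrite ltr_pdivrMr// ler_pdivlMr// mulrC; lra.
    by move: h1 h2; rewrite ltr_pdivrMr// ler_pdivlMr// mulrC => *; lra.
  rewrite !lebesgue_measure_itv/= !lte_fin ltr_pM2r ?invr_gt0// ltrD2r.
  case: ifPn => _; last by rewrite mule0.
  rewrite -!EFinB -EFinM; congr EFin; rewrite gtr0_norm//; field.
  by rewrite gt_eqF.
(* A negative slope exchanges the open and the closed end; the length is unchanged. *)
have -> : affine r c @^-1` `]a, b] = `[(b - c) / r, (a - c) / r[%classic.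
  apply/seteqP; split => x; rewrite /affine /= !in_itv/= => /andP[h1 h2].
    by rewrite ltr_ndivlMr// ler_ndivrMr// mulrC; lra.
  by move: h1 h2; rewrite ltr_ndivlMr// ler_ndivrMr// mulrC => *; lra.
rewrite !lebesgue_measure_itv/= !lte_fin ltr_nM2r ?invr_lt0// ltrD2r.
case: ifPn => _; last by rewrite mule0.
rewrite -!EFinB -EFinM; congr EFin; rewrite ltr0_norm//; field.
by rewrite lt_eqF.
Qed.

Lemma ge0_integral_affine (r c : R) (f : R -> \bar R) : r != 0 ->
  measurable_fun setT f -> (forall x, 0 <= f x)%E ->
  (\int[mu]_x f x = `|r|%:E * \int[mu]_x f (r * x + c)%R)%E.
Proof.
move=> r0 mf f0.
pose k := NngNum (normr_ge0 r).
have ma : measurable_fun [set: measurableTypeR R] (affine r c : measurableTypeR R -> measurableTypeR R) by exact: measurable_affine.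
pose m0 : {measure set (measurableTypeR R) -> \bar R} :=
  measure_function_pushforward__canonical__measure_function_Measure mu ma.
pose m : {measure set (measurableTypeR R) -> \bar R} := mscale k m0.
rewrite (@eq_measure_integral _ (measurableTypeR R) R setT m mu)//; last first.
  by move=> A mA _; exact: (lebesgue_measure_affine c r0 mA).
rewrite ge0_integral_mscale//; congr *%E.
by rewrite ge0_integral_pushforward.
Qed.

Lemma itg_affine r c f : r != 0 -> itg mu f -> itg mu (fun x => f (r * x + c)).
Proof.
move=> r0 hf; have mf := itg_measurable hf.
have mfa : measurable_fun setT (fun x => f (r * x + c)).
  by apply: measurableT_comp => //; exact: measurable_affine.
move: hf => /integrableP[_ hf]; apply/integrableP; split.
  exact/measurable_EFinP.
move: hf; rewrite (ge0_integral_affine c r0)//; last first.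
  by apply: measurableT_comp => //; exact/measurable_EFinP.
set J := (\int[mu]_x _)%E.
have : (0 <= J)%E by apply: integral_ge0.
case: J => [s| |] //; rewrite ?ltry//.
by rewrite gt0_muley// lte_fin normr_gt0.
Qed.

Lemma I_affine r c f : r != 0 -> itg mu f ->
  \int[mu]_x f x = `|r| * \int[mu]_x f (r * x + c).
Proof.
move=> r0 hf; have ha := itg_affine c r0 hf.
have mf := itg_measurable hf.
suff h g : measurable_fun setT g -> (forall x, 0 <= g x) ->
    itg mu (fun x => g (r * x + c)) -> itg mu g ->
    \int[mu]_x g x = `|r| * \int[mu]_x g (r * x + c).
  have e : f =1 (fun x => (Num.max (f x) 0) - (Num.max (- f x) 0)).
    by move=> x; rewrite !maxEle; case: ifPn; case: ifPn; lra.
  have mp : measurable_fun setT (fun x => Num.max (f x) 0) by exact: measurable_maxr.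
  have mn : measurable_fun setT (fun x => Num.max (- f x) 0).
    by apply: measurable_maxr => //; exact: measurable_funN.
  have bp x : `|Num.max (f x) 0| <= `|f x|.
    by rewrite maxEle; case: ifPn; rewrite ?normr0.
  have bn x : `|Num.max (- f x) 0| <= `|f x|.
    by rewrite maxEle; case: ifPn; rewrite ?normr0 ?normrN.
  have ip := itg_dom (itg_abs hf) mp bp.
  have i_n := itg_dom (itg_abs hf) mn bn.
  have iap : itg mu (fun x => Num.max (f (r * x + c)) 0) by exact: (itg_affine c r0 ip).
  have ian : itg mu (fun x => Num.max (- f (r * x + c)) 0) by exact: (itg_affine c r0 i_n).
  rewrite (eqI mu e) (eqI mu (fun x => e (r * x + c))).
  rewrite IB// [in RHS]IB// mulrBr; congr (_ - _); apply: h => //.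
  - by move=> x; rewrite le_max lexx orbT.
  - by move=> x; rewrite le_max lexx orbT.
move=> mg g0 iga ig; apply: EFin_inj; rewrite EFinM !EFinI//.
by rewrite (ge0_integral_affine c r0)//; exact/measurable_EFinP.
Qed.

Lemma itg_shift c f : itg mu f -> itg mu (fun x => f (x + c)).
Proof. by move=> /(itg_affine c (oner_neq0 _)); apply: eq_itg => x; rewrite mul1r. Qed.

Lemma I_shift c f : itg mu f -> \int[mu]_x f (x + c) = \int[mu]_x f x.
Proof.
move=> /(I_affine c (oner_neq0 _)) ->; rewrite normr1 mul1r.
by apply: eqI => x; rewrite mul1r.
Qed.

Lemma itg_opp f : itg mu f -> itg mu (fun x => f (- x)).
Proof.
have h : (-1 : R) != 0 by rewrite oppr_eq0 oner_neq0.
by move=> /(itg_affine 0 h); apply: eq_itg => x; rewrite mulN1r addr0.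
Qed.

Lemma I_opp f : itg mu f -> \int[mu]_x f (- x) = \int[mu]_x f x.
Proof.
have h : (-1 : R) != 0 by rewrite oppr_eq0 oner_neq0.
move=> /(I_affine 0 h) ->; rewrite normrN1 mul1r.
by apply: eqI => x; rewrite mulN1r addr0.
Qed.

Lemma I_odd f : itg mu f -> (forall x, f (- x) = - f x) -> \int[mu]_x f x = 0.
Proof.
move=> hf of_; have := I_opp hf; rewrite (eqI mu of_) IN// => /eqP.
by rewrite -subr_eq0 -opprD oppr_eq0 -mulr2n mulrn_eq0 /= => /eqP.
Qed.

Lemma itgZ_scale (r : R) f : r != 0 -> itg mu f -> itg mu (fun x => f (r * x)).
Proof. by move=> r0 /(itg_affine 0 r0); apply: eq_itg => x; rewrite addr0. Qed.

Lemma I_scale r f : r != 0 -> itg mu f ->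
  \int[mu]_x f (r * x) = `|r|^-1 * \int[mu]_x f x.
Proof.
move=> r0 /(I_affine 0 r0) ->; rewrite mulrA mulVf ?normr_eq0// mul1r.
by apply: eqI => x; rewrite addr0.
Qed.

End affine_change.

(** * Double integrals *)

Section product_integral.
Context (R : realType).
Notation mu := (@lebesgue_measure R).
Notation mu2 := (mu \x mu)%E.
Implicit Types F G : R -> R -> R.

Definition m2 F := measurable_fun setT (fun z : R * R => F z.1 z.2).
Definition it2 F := itg mu2 (fun z => F z.1 z.2).
Definition J F : R := \int[mu2]_z F z.1 z.2.

Lemma it2_m2 F : it2 F -> m2 F.
Proof. by move=> hF; exact: itg_measurable hF. Qed.

Lemma m2_fst F y : m2 F -> measurable_fun setT (F ^~ y).
Proof. by move=> mF; exact: (measurableT_comp mF (pair2_measurable y)). Qed.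

Lemma m2_snd F x : m2 F -> measurable_fun setT (F x).
Proof. by move=> mF; exact: (measurableT_comp mF (pair1_measurable x)). Qed.

Lemma m2_comp F (f g : R * R -> R) : m2 F ->
  measurable_fun setT f -> measurable_fun setT g ->
  measurable_fun setT (fun z => F (f z) (g z)).
Proof.
move=> mF mf mg.
exact: (measurableT_comp mF (measurable_fun_pair mf mg)).
Qed.

Lemma it2_crit g F : itg mu g -> m2 F -> (forall x, itg mu (F x)) ->
  (forall x, \int[mu]_y `|F x y| <= g x) -> it2 F.
Proof.
move=> hg mF iF Fg; apply/integrable12ltyP; first exact/measurable_EFinP.
move: hg => /integrableP[mg]; apply: le_lt_trans.
apply: ge0_le_integral => //.
- by move=> x _; apply: integral_ge0.
- apply: (@measurable_fun_fubini_tonelli_F _ _ _ _ _ mu (fun z => `|F z.1 z.2|%:E)) => //.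
  by apply/measurable_EFinP; apply: measurableT_comp.
- by apply: measurableT_comp.
move=> x _ /=; rewrite -(EFinI (itg_abs (iF x))) lee_fin.
by rewrite (le_trans (Fg x))// ler_norm.
Qed.

(** The inner integral of an integrable function may be infinite on a null set, where the
    real-valued integral takes a default value; the outer integral does not see it. *)
Lemma fine_fubini (f : R -> \bar R) : mu.-integrable setT f ->
  itg mu (fine \o f) /\ \int[mu]_x fine (f x) = fine (\int[mu]_x f x)%E.
Proof.
move=> hf; have mf := measurable_int _ hf.
have mff : measurable_fun setT (fun x => (fine (f x))%:E).
  by apply/measurable_EFinP; apply: measurableT_comp.
have ae : {ae mu, forall x, setT x -> (fine (f x))%:E = f x}.
  have := integrable_ae measurableT hf; apply: filterS => x /= h _.
  by rewrite fineK// h.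
have iff_ : itg mu (fine \o f).
  apply/integrableP; split => //.
  move/integrableP : (hf) => [_]; apply: le_lt_trans.
  apply: ge0_le_integral => //; do ? by apply: measurableT_comp.
  move=> x _ /=; case: (f x) => [r| |] //=; rewrite normr0; exact: leey.
split => //; congr fine.
by apply: ae_eq_integral => //; exact: ae.
Qed.

Lemma it2_itg1 F : it2 F -> itg mu (fun x => \int[mu]_y F x y).
Proof. by move=> hF; exact: (fine_fubini (integrable_fubini_F hF)).1. Qed.

Lemma m2_swap F : m2 F -> m2 (fun x y => F y x).
Proof. by move=> mF; apply: (m2_comp mF); [exact: measurable_snd|exact: measurable_fst]. Qed.

Lemma it2_swap F : it2 F -> it2 (fun x y => F y x).
Proof.
move=> hF; have mF := it2_m2 hF.
apply/integrable21ltyP; first by apply/measurable_EFinP; exact: m2_swap.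
by move/integrable12ltyP: hF; apply; exact/measurable_EFinP.
Qed.

Lemma it2_itg2 F : it2 F -> itg mu (fun y => \int[mu]_x F x y).
Proof. by move=> /it2_swap/it2_itg1. Qed.

Lemma J12 F : it2 F -> J F = \int[mu]_x \int[mu]_y F x y.
Proof.
move=> hF; rewrite (fine_fubini (integrable_fubini_F hF)).2.
by rewrite integral12_prod_meas1.
Qed.

Lemma J21 F : it2 F -> J F = \int[mu]_y \int[mu]_x F x y.
Proof.
move=> hF.
rewrite [RHS](fine_fubini (integrable_fubini_F (it2_swap hF))).2.
by congr fine; rewrite -(integral21_prod_meas1 hF).
Qed.

Lemma J_swap F : it2 F -> J (fun x y => F y x) = J F.
Proof. by move=> hF; rewrite (J12 (it2_swap hF)) J21. Qed.

(** For fixed [h] this is a translation in [x], so Tonelli with the [x]-integral inside applies. *)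
Lemma it2_shear c F : it2 F -> it2 (fun x h => F (x + c * h) h).
Proof.
move=> hF; have mF := it2_m2 hF.
have mS : m2 (fun x h => F (x + c * h) h).
  by apply: (m2_comp mF) => //; apply: measurable_funD => //; apply: measurable_funM.
apply/integrable21ltyP; first by apply/measurable_EFinP.
have /integrable21ltyP : it2 F by []; move=> /(_ _)/= h.
have {}h := h (proj2 (measurable_EFinP _ _) mF).
apply: le_lt_trans h; rewrite le_eqVlt; apply/orP; left; apply/eqP.
apply: eq_integral => y _.
rewrite (@ge0_integral_affine R 1 (c * y) (fun x => `|F x y|%:E))//.
- rewrite normr1 mul1e; apply: eq_integral => x _; by rewrite mul1r.
- by apply/measurable_EFinP; apply: measurableT_comp => //; exact: m2_fst.
Qed.

Lemma J_shear c F : it2 F -> J (fun x h => F (x + c * h) h) = J F.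
Proof.
move=> hF; have mF := it2_m2 hF.
rewrite (J21 hF) (J21 (it2_shear c hF)).
have [Z Z0] := ae_integrable2 hF.
congr fine; apply: ae_eq_integral => //.
- exact/measurable_EFinP/itg_measurable/(it2_itg2 (it2_shear c hF)).
- exact/measurable_EFinP/itg_measurable/(it2_itg2 hF).
(* The section at [y] is integrable, hence translatable, only for almost every [y]. *)
have := ae_integrable2 hF; apply: filterS => y /= hy _.
by rewrite (I_shift (c * y) (f := F ^~ y)).
Qed.

Lemma it2_tensor (f g : R -> R) : itg mu f -> itg mu g ->
  it2 (fun x y => f x * g y).
Proof.
move=> hf hg.
apply: (@it2_crit (fun x => `|f x| * \int[mu]_y `|g y|)).
- by apply: itgZr; exact: itg_abs.
- apply: measurable_funM.
    by apply: (measurableT_comp (itg_measurable hf)).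
  by apply: (measurableT_comp (itg_measurable hg)).
- by move=> x; exact: itgZ.
- by move=> x; under eq_Rintegral do rewrite normrM; rewrite IZ//; exact: itg_abs.
Qed.

Lemma J_tensor (f g : R -> R) : itg mu f -> itg mu g ->
  J (fun x y => f x * g y) = (\int[mu]_x f x) * \int[mu]_y g y.
Proof.
move=> hf hg; rewrite J12; last exact: it2_tensor.
by under eq_Rintegral do rewrite IZ//; rewrite IZr.
Qed.

Lemma it2_dom G F : it2 G -> m2 F -> (forall x y, `|F x y| <= G x y) -> it2 F.
Proof. by move=> hG mF FG; apply: (itg_dom hG). Qed.

Lemma it2D F G : it2 F -> it2 G -> it2 (fun x y => F x y + G x y).
Proof. by move=> hF hG; exact: (itgD hF hG). Qed.

Lemma it2B F G : it2 F -> it2 G -> it2 (fun x y => F x y - G x y).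
Proof. by move=> hF hG; exact: (itgB hF hG). Qed.

Lemma it2Z r F : it2 F -> it2 (fun x y => r * F x y).
Proof. by move=> hF; exact: (itgZ r hF). Qed.

Lemma JD F G : it2 F -> it2 G -> J (fun x y => F x y + G x y) = J F + J G.
Proof. by move=> hF hG; exact: (ID hF hG). Qed.

Lemma JB F G : it2 F -> it2 G -> J (fun x y => F x y - G x y) = J F - J G.
Proof. by move=> hF hG; exact: (IB hF hG). Qed.

Lemma JZ r F : it2 F -> J (fun x y => r * F x y) = r * J F.
Proof. by move=> hF; exact: (IZ r hF). Qed.

Lemma eqJ G F : (forall x y, F x y = G x y) -> J F = J G.
Proof. by move=> h; apply: eqI => z; exact: h. Qed.

Lemma eq_it2 G F : (forall x y, F x y = G x y) -> it2 G -> it2 F.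
Proof. by move=> h; apply: eq_itg => z; exact: h. Qed.

Lemma le_abs_J G F : it2 G -> m2 F -> (forall x y, `|F x y| <= G x y) ->
  `|J F| <= J G.
Proof. by move=> hG mF FG; apply: (le_abs_Idom hG mF) => z; exact: FG. Qed.

Lemma le_J F G : it2 F -> it2 G -> (forall x y, F x y <= G x y) -> J F <= J G.
Proof. by move=> hF hG FG; apply: (le_I hF hG) => z; exact: FG. Qed.

Lemma it2_abs F : it2 F -> it2 (fun x y => `|F x y|).
Proof. by move=> hF; exact: (itg_abs hF). Qed.

Definition pos (h : R) : R := if 0 < h then 1 else 0.

Lemma measurable_pos : measurable_fun setT pos.
Proof.
rewrite (_ : pos = \1_(`]0, +oo[%classic : set R)).
  exact: measurable_indic.
apply/funext => x; rewrite /pos indicE.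
by case: ifPn => h; [rewrite mem_set//= in_itv/= h|rewrite memNset//= in_itv/= (negbTE h)].
Qed.

Lemma pos_le1 h : `|pos h| <= 1.
Proof. by rewrite /pos; case: ifP => _; rewrite ?normr1 ?normr0. Qed.

Lemma pos_ge0 h : 0 <= pos h.
Proof. by rewrite /pos; case: ifP. Qed.

Lemma itg_pos f : itg mu f -> itg mu (fun h => pos h * f h).
Proof.
move=> hf; apply: eq_itg (itgMb hf measurable_pos pos_le1) => x.
by rewrite mulrC.
Qed.

Lemma I_half f : itg mu f ->
  \int[mu]_h f h = \int[mu]_h (pos h * (f h + f (- h))).
Proof.
move=> hf; have hfo := itg_opp hf.
have h1 := itg_pos hf; have h2 := itg_pos hfo.
under [RHS]eq_Rintegral do rewrite mulrDr; rewrite ID//.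
have <- : \int[mu]_h (pos (- h) * f h) = \int[mu]_h (pos h * f (- h)).
  rewrite -[RHS](I_opp h2); apply: eqI => x; by rewrite opprK.
have h3 : itg mu (fun h => pos (- h) * f h).
  by apply: eq_itg (itg_opp h2) => x; rewrite opprK.
rewrite -ID//.
(* The two integrands agree off the null set [h = 0]. *)
congr fine; apply: ae_eq_integral => //.
- exact/measurable_EFinP/itg_measurable/hf.
- exact/measurable_EFinP/itg_measurable/(itgD h1 h3).
exists [set 0]; split => //; first exact: lebesgue_measure_set1.
move=> x /= h; apply/eqP; apply: contra_notT h => x0 _.
congr EFin; rewrite /pos oppr_gt0.
by case: ltgtP x0 => // _ _; rewrite ?mul1r ?mul0r ?addr0 ?add0r.
Qed.

End product_integral.

(** * Differential calculus *)

Section derivatives.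
Context (R : realType).
Implicit Types (f g : R -> R) (x a b : R).

Lemma derD f g x a b : is_derive x 1 f a -> is_derive x 1 g b ->
  is_derive x 1 (fun y => f y + g y) (a + b).
Proof. by move=> hf hg; exact: is_deriveD. Qed.

Lemma derB f g x a b : is_derive x 1 f a -> is_derive x 1 g b ->
  is_derive x 1 (fun y => f y - g y) (a - b).
Proof. by move=> hf hg; exact: is_deriveB. Qed.

Lemma derN f x a : is_derive x 1 f a -> is_derive x 1 (fun y => - f y) (- a).
Proof. by move=> hf; exact: is_deriveN. Qed.

Lemma derM f g x a b : is_derive x 1 f a -> is_derive x 1 g b ->
  is_derive x 1 (fun y => f y * g y) (a * g x + f x * b).
Proof.
move=> hf hg; apply: (is_derive_eq (is_deriveM hf hg)).
by rewrite addrC [in RHS]mulrC.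
Qed.

Lemma derC x a : is_derive x 1 (fun=> a) 0.
Proof. exact: is_derive_cst. Qed.

Lemma derid x : is_derive x 1 (fun y : R => y) 1.
Proof. exact: is_derive_id. Qed.

Lemma der_comp f g x a b : is_derive x 1 f a -> is_derive (f x) 1 g b ->
  is_derive x 1 (fun y => g (f y)) (b * a).
Proof. by move=> hf hg; exact: (is_derive1_comp (f := g)). Qed.

Lemma der_eq f x a b : is_derive x 1 f a -> a = b -> is_derive x 1 f b.
Proof. by move=> h <-. Qed.

Lemma der_sqr f x a : is_derive x 1 f a ->
  is_derive x 1 (fun y => f y ^+ 2) (2 * f x * a).
Proof.
move=> hf; rewrite (_ : (fun y => f y ^+ 2) = (fun y => f y * f y)).
  by apply: der_eq (derM hf hf) _; ring.
by apply/funext => y; rewrite expr2.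
Qed.

Lemma der_cont f x a : is_derive x 1 f a -> {for x, continuous f}.
Proof.
by move=> [/derivable1_diffP h _]; exact: differentiable_continuous.
Qed.

Lemma der1E f x a : is_derive x 1 f a -> derive1 f x = a.
Proof. by move=> [_ <-]; rewrite derive1E. Qed.

Lemma mvt f f' x y : (forall z : R, is_derive z 1 f (f' z)) -> x <= y ->
  exists2 z, x <= z <= y & f y - f x = f' z * (y - x).
Proof.
move=> h xy.
have [z zi e] : exists2 c, c \in `[x, y]%R & f y - f x = f' c * (y - x).
  apply: MVT_segment => // ; apply: derivable_within_continuous => z _.
  by have [] := h z.
by exists z => //; move: zi; rewrite in_itv.
Qed.

Lemma mvt_abs f f' r x h : 0 <= h ->
  (forall z : R, is_derive z 1 f (f' z)) ->
  (forall z, x <= z <= x + h -> `|f' z| <= r) -> `|f (x + h) - f x| <= r * h.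
Proof.
move=> h0 df fr; have xh : x <= x + h by rewrite lerDl.
have [z /fr zr ->] := mvt df xh.
by rewrite addrAC subrr add0r normrM (ger0_norm h0) ler_wpM2r.
Qed.
End derivatives.

(** * Improper integrals by exhaustion *)

Section ftc_exhaustion.
Context (R : realType).
Notation mu := (@lebesgue_measure R).
Variables (D : set R) (F f g : R -> R) (a b : nat -> R).
Hypothesis ab : forall n, a n < b n.
Hypothesis abD : forall n x, a n <= x <= b n -> D x.
Hypothesis Dab : forall x, D x -> \forall n \near \oo, a n <= x <= b n.
Hypothesis dF : forall x, D x -> is_derive x 1 F (f x).
Hypothesis cf : forall x, D x -> {for x, continuous f}.
Hypothesis gD : forall x, D x -> g x = f x.
Hypothesis gND : forall x, ~ D x -> g x = 0.

Let g_ n x := g x * \1_(`[a n, b n]%classic : set R) x.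

Let I_segment n : itg mu (g_ n) /\ \int[mu]_x g_ n x = F (b n) - F (a n).
Proof.
have cw : {within `[a n, b n], continuous f}.
  apply: continuous_in_subspaceT => x /[!inE] /= xab.
  by apply: cf; apply: abD xab.
have e : g_ n = (f \_ `[a n, b n]).
  apply/funext => x; rewrite /g_ patchE indicE.
  case: ifPn => h; rewrite ?h ?mulr1 ?(negbTE h) ?mulr0//.
  by apply: gD; apply: (@abD n); move: h; rewrite inE/= in_itv.
have hf : mu.-integrable `[a n, b n] (EFin \o f).
  by apply: continuous_compact_integrable => //; exact: segment_compact.
split.
  by rewrite e /itg -restrict_EFin; apply/integrable_restrict => //; rewrite setTI.
rewrite e -Rintegral_mkcond /Rintegral (@continuous_FTC2 _ f F)//.
  split => [x /[!in_itv]/= /andP[h1 h2]||].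
  - by have /dF[] : D x by apply: (@abD n); rewrite !ltW.
  - apply: cvg_at_right_filter; apply: (der_cont (a := f (a n))).
    by apply: dF; apply: (@abD n); rewrite lexx ltW.
  - apply: cvg_at_left_filter; apply: (der_cont (a := f (b n))).
    by apply: dF; apply: (@abD n); rewrite lexx ltW.
move=> x /[!in_itv]/= /andP[h1 h2]; apply: der1E; apply: dF.
by apply: (@abD n); rewrite !ltW.
Qed.

Let g_cvg x : g_ ^~ x @ \oo --> g x.
Proof.
have [Dx|Dx] := pselect (D x); last first.
  rewrite /g_ gND// (_ : (fun _ => _) = cst 0); first exact: cvg_cst.
  by apply/funext => n; rewrite mul0r.
apply: cvg_near_cst; have := Dab Dx; apply: filterS => n h.
by rewrite /g_ indicE mem_set/= ?mulr1// in_itv.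
Qed.

Let g_le n x : `|g_ n x| <= `|g x|.
Proof.
rewrite /g_ normrM ler_piMr// indicE; case: (_ \in _); by rewrite ?normr1 ?normr0.
Qed.

(** Fundamental theorem on each segment [[a n, b n]], then dominated convergence with majorant
    [|g|]. *)
Lemma ftc_itg l : itg mu g -> (fun n => F (b n) - F (a n)) @ \oo --> l ->
  \int[mu]_x g x = l.
Proof.
move=> hg hl.
have mg n := itg_measurable (I_segment n).1.
have [_ h] := dct (itg_abs hg) mg g_cvg g_le.
have e : (fun n => \int[mu]_x g_ n x) = (fun n => F (b n) - F (a n)).
  by apply/funext => n; rewrite (I_segment n).2.
by move: h; rewrite e => h; apply: cvg_unique h hl; exact: Rhausdorff.
Qed.

(** Here nonnegativity replaces integrability: Fatou's lemma produces it from the bound on the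
    increments of the primitive. *)
Lemma ftc_ge0 l : (forall x, D x -> 0 <= f x) ->
  (forall n, F (b n) - F (a n) <= l) -> itg mu g /\ \int[mu]_x g x <= l.
Proof.
move=> f0 hl; apply: (@fatou_itg _ _ _ mu g_).
- move=> n x; rewrite /g_ indicE; have [Dx|Dx] := pselect (D x).
    by rewrite mulr_ge0// gD// f0.
  by rewrite gND// mul0r.
- by move=> n; exact: (I_segment n).1.
- by move=> n; rewrite (I_segment n).2.
- exact: g_cvg.
Qed.

End ftc_exhaustion.

(** * Integrals over half-lines and of powers *)

Section one_dim_integrals.
Context (R : realType).
Notation mu := (@lebesgue_measure R).
Implicit Types (f F : R -> R).

Lemma itg_indic_itv (a b : R) : itg mu (\1_(`[a, b]%classic : set R)).
Proof. exact: integrable_indic_itv. Qed.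

Lemma I_indic_itv (a b : R) : a <= b ->
  \int[mu]_x (\1_(`[a, b]%classic : set R) x) = b - a.
Proof.
move=> ab; rewrite /Rintegral integral_indic// setIT.
have h := lebesgue_measure_itv `[a, b]; rewrite [X in fine X]h /= lte_fin.
by case: ltgtP ab => // -> _; rewrite subrr.
Qed.

Lemma itg_half f : measurable_fun setT f -> itg mu (fun h => pos h * f h) ->
  itg mu (fun h => pos h * f (- h)) -> itg mu f.
Proof.
move=> mf h1 h2; have h3 := itg_opp h2.
(* The indicator of the point 0 dominates [f] at the origin, which neither half-line sees. *)
have h4 := itgZr `|f 0| (itg_indic_itv 0 0).
have h5 := itgD (itgD (itg_abs h1) (itg_abs h3)) h4.
apply: (itg_dom h5) => // x; rewrite opprK /pos oppr_gt0.
have [x0|x0|->] := ltgtP x 0.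
- by rewrite !mul0r !mul1r normr0 add0r lerDl mulr_ge0// indicE.
- by rewrite !mul0r !mul1r normr0 addr0 lerDl mulr_ge0// indicE.
- by rewrite !mul0r normr0 !add0r indicE mem_set/= ?mul1r// in_itv/= lexx.
Qed.

Lemma ftc_pos F f (l0 l1 : R) : (forall x : R, 0 < x -> is_derive x 1 F (f x)) ->
  (forall x, 0 < x -> {for x, continuous f}) ->
  itg mu (fun x => pos x * f x) ->
  (fun n => F (n.+2%:R^-1)) @ \oo --> l0 -> (fun n => F n.+2%:R) @ \oo --> l1 ->
  \int[mu]_x (pos x * f x) = l1 - l0.
Proof.
move=> dF cf hf h0 h1.
(* With [n + 2] instead of [n + 1] the inequality [1 / (n + 2) < n + 2] is strict already at
   [n = 0]. *)
apply: (@ftc_itg R [set x | 0 < x] F f _ (fun n => n.+2%:R^-1) (fun n => n.+2%:R)) => //.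
- move=> n; apply: (@lt_le_trans _ _ 1); first by rewrite invf_lt1// ltr1n.
  by rewrite ler1n.
- by move=> n x /= /andP[h _]; apply: lt_le_trans h; rewrite invr_gt0.
- move=> x /= x0; near=> n; apply/andP; split.
    rewrite invf_ple ?posrE// (@le_trans _ _ n%:R)//; last by rewrite ler_nat -addn2 leq_addr.
    near: n; exact: nbhs_infty_ger.
  rewrite (@le_trans _ _ n%:R)//; last by rewrite ler_nat -addn2 leq_addr.
  near: n; exact: nbhs_infty_ger.
- by move=> x /=; rewrite /pos => ->; rewrite mul1r.
- by move=> x /=; rewrite /pos => /negP/negbTE ->; rewrite mul0r.
- exact: cvgB.
Unshelve. all: by end_near. Qed.

Lemma ge0_ftc_pos F f (l : R) : (forall x : R, 0 < x -> is_derive x 1 F (f x)) ->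
  (forall x, 0 < x -> {for x, continuous f}) ->
  (forall x, 0 < x -> 0 <= f x) ->
  (forall x y, 0 < x -> 0 < y -> F y - F x <= l) ->
  itg mu (fun x => pos x * f x) /\ \int[mu]_x (pos x * f x) <= l.
Proof.
move=> dF cf hf h0.
apply: (@ftc_ge0 R [set x | 0 < x] F f _ (fun n => n.+2%:R^-1) (fun n => n.+2%:R)) => //.
- move=> n; apply: (@lt_le_trans _ _ 1); first by rewrite invf_lt1// ltr1n.
  by rewrite ler1n.
- by move=> n x /= /andP[h _]; apply: lt_le_trans h; rewrite invr_gt0.
- move=> x /= x0; near=> n; apply/andP; split.
    rewrite invf_ple ?posrE// (@le_trans _ _ n%:R)//; last by rewrite ler_nat -addn2 leq_addr.
    near: n; exact: nbhs_infty_ger.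
  rewrite (@le_trans _ _ n%:R)//; last by rewrite ler_nat -addn2 leq_addr.
  near: n; exact: nbhs_infty_ger.
- by move=> x /=; rewrite /pos => ->; rewrite mul1r.
- by move=> x /=; rewrite /pos => /negP/negbTE ->; rewrite mul0r.
- by move=> n; apply: h0.
Unshelve. all: by end_near. Qed.

Lemma ftc_T F f (l0 l1 : R) : (forall x : R, is_derive x 1 F (f x)) -> continuous f ->
  itg mu f ->
  (fun n => F (- n.+1%:R)) @ \oo --> l0 -> (fun n => F n.+1%:R) @ \oo --> l1 ->
  \int[mu]_x f x = l1 - l0.
Proof.
move=> dF cf hf h0 h1.
apply: (@ftc_itg R setT F f f (fun n => - n.+1%:R) (fun n => n.+1%:R)) => //.
- by move=> n; rewrite (@lt_trans _ _ 0)// oppr_lt0.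
- move=> x /= x0; near=> n; rewrite -ler_norml.
  rewrite (@le_trans _ _ n%:R)//; last by rewrite ler_nat.
  near: n; exact: nbhs_infty_ger.
- by move=> x _; exact: (cf x).
- by move=> x /= h; case: h.
- exact: cvgB.
Unshelve. all: by end_near. Qed.

Lemma ge0_ftc_T F f (l : R) : (forall x : R, is_derive x 1 F (f x)) -> continuous f ->
  (forall x, 0 <= f x) -> (forall x y, F y - F x <= l) ->
  itg mu f /\ \int[mu]_x f x <= l.
Proof.
move=> dF cf f0 h0.
apply: (@ftc_ge0 R setT F f f (fun n => - n.+1%:R) (fun n => n.+1%:R)) => //.
- by move=> n; rewrite (@lt_trans _ _ 0)// oppr_lt0.
- move=> x /= x0; near=> n; rewrite -ler_norml.
  rewrite (@le_trans _ _ n%:R)//; last by rewrite ler_nat.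
  near: n; exact: nbhs_infty_ger.
- by move=> x _; exact: (cf x).
- by move=> x /= h; case: h.
Unshelve. all: by end_near. Qed.

Definition near0 (r h : R) : R := if 0 < h <= r then 1 else 0.
Definition far0 (r h : R) : R := if r < h then 1 else 0.

Lemma near0_ge0 (r h : R) : 0 <= near0 r h. Proof. by rewrite /near0; case: ifP. Qed.
Lemma far0_ge0 (r h : R) : 0 <= far0 r h. Proof. by rewrite /far0; case: ifP. Qed.

Lemma is_derive_powR_prim (p x : R) : 0 < x -> p + 1 != 0 ->
  is_derive x 1 (fun h => h `^ (p + 1) / (p + 1)) (x `^ p).
Proof.
move=> x0 p0; apply: der_eq (derM (is_derive1_powR (p + 1) x0) (derC x _)) _.
by rewrite mulr0 addr0 addrK mulrAC mulfV// mul1r.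
Qed.

Lemma cont_powR (p x : R) : 0 < x -> {for x, continuous (fun h => h `^ p)}.
Proof. by move=> x0; apply: der_cont (is_derive1_powR p x0). Qed.

Lemma le_powR_neg (q x y : R) : q <= 0 -> 0 < x <= y -> y `^ q <= x `^ q.
Proof.
move=> q0 /andP[x0 xy]; have y0 := lt_le_trans x0 xy.
rewrite -[q]opprK !(powRN _ (- q)) lef_pV2 ?posrE ?powR_gt0//.
by rewrite ge0_ler_powR ?oppr_ge0// nnegrE ltW.
Qed.

Lemma pow_near (p r : R) : -1 < p -> 0 < r ->
  itg mu (fun h => near0 r h * h `^ p) /\
  \int[mu]_h (near0 r h * h `^ p) <= r `^ (p + 1) / (p + 1).
Proof.
move=> p1 r0; have p10 : 0 < p + 1 by lra.
apply: (@ftc_ge0 R [set h | 0 < h <= r] (fun h => h `^ (p + 1) / (p + 1))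
  (fun h => h `^ p) _ (fun n => r * n.+2%:R^-1) (fun=> r)) => //.
- by move=> n; rewrite gtr_pMr// invf_lt1// ltr1n.
- move=> n x /= /andP[h ->]; rewrite andbT; apply: lt_le_trans h.
  by rewrite mulr_gt0.
- move=> x /= /andP[x0 ->]; near=> n; rewrite andbT.
  rewrite ler_pdivrMr// mulrC -ler_pdivrMr//.
  rewrite (@le_trans _ _ n%:R)//; last by rewrite ler_nat -addn2 leq_addr.
  near: n; exact: nbhs_infty_ger.
- by move=> x /= /andP[x0 _]; apply: is_derive_powR_prim; rewrite // gt_eqF.
- by move=> x /= /andP[x0 _]; exact: cont_powR.
- by move=> x /=; rewrite /near0 => ->; rewrite mul1r.
- by move=> x /=; rewrite /near0 => /negP/negbTE ->; rewrite mul0r.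
- by move=> x _; exact: powR_ge0.
- by move=> n; rewrite lerBlDr lerDl mulr_ge0 ?powR_ge0// invr_ge0 ltW.
Unshelve. all: by end_near. Qed.

Lemma pow_far (p r : R) : p < -1 -> 0 < r ->
  itg mu (fun h => far0 r h * h `^ p) /\
  \int[mu]_h (far0 r h * h `^ p) <= r `^ (p + 1) / - (p + 1).
Proof.
move=> p1 r0; have p10 : 0 < - (p + 1) by lra.
apply: (@ftc_ge0 R [set h | r < h] (fun h => h `^ (p + 1) / (p + 1))
  (fun h => h `^ p) _ (fun n => r + n.+1%:R^-1) (fun n => r + n.+2%:R)) => //.
- move=> n; rewrite ltrD2l (@le_lt_trans _ _ 1) ?ltr1n//.
  by rewrite invf_le1// ler1n.
- move=> n x /= /andP[h _]; apply: lt_le_trans h.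
  by rewrite ltrDl.
- move=> x /= rx; near=> n; apply/andP; split.
    rewrite -lerBrDl invf_ple ?posrE ?subr_gt0//.
    rewrite (@le_trans _ _ n%:R)//; last by rewrite ler_nat.
    near: n; exact: nbhs_infty_ger.
  rewrite -lerBlDl (@le_trans _ _ n%:R)//; last by rewrite ler_nat -addn2 leq_addr.
  near: n; exact: nbhs_infty_ger.
- move=> x /= rx; apply: is_derive_powR_prim; first exact: lt_trans rx.
  by rewrite lt_eqF// -oppr_gt0.
- by move=> x /= rx; apply: cont_powR; exact: lt_trans rx.
- by move=> x /=; rewrite /far0 => ->; rewrite mul1r.
- by move=> x /=; rewrite /far0 => /negP/negbTE ->; rewrite mul0r.
- by move=> x _; exact: powR_ge0.
- move=> n; set a := r + n.+1%:R^-1; set b := r + n.+2%:R.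
  have h1 : b `^ (p + 1) / - (p + 1) >= 0 by rewrite divr_ge0 ?powR_ge0// ltW.
  have h2 : a `^ (p + 1) / - (p + 1) <= r `^ (p + 1) / - (p + 1).
    rewrite ler_pM2r ?invr_gt0//; apply: le_powR_neg; first by lra.
    by apply/andP; split => //; rewrite /a lerDl invr_ge0 ler0n.
  by move: h1 h2; rewrite !invrN !mulrN; lra.
Unshelve. all: by end_near. Qed.

End one_dim_integrals.

(** * Poisson and Hartley transforms *)

Section special_integrals.
Context (R : realType).
Notation mu := (@lebesgue_measure R).
Implicit Types (f : R -> R) (u v : nat -> R).

Lemma cvg0_dom v u : v @ \oo --> (0 : R) -> (forall n, `|u n| <= v n) ->
  u @ \oo --> (0 : R).
Proof.
move=> v0 uv; apply: (@squeeze_cvgr _ _ _ _ (fun n => - v n) v) => //.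
- by apply: nearW => n; rewrite -ler_norml.
- by rewrite -oppr0; exact: cvgN.
Qed.

Lemma cvg_inv2 : (fun n => n.+2%:R^-1 : R) @ \oo --> (0 : R).
Proof. by have := @cvg_harmonic R; rewrite -cvg_shiftS. Qed.

Lemma cvg_expn (e : R) : 0 < e -> (fun n => expR (- (e * n.+2%:R))) @ \oo --> (0 : R).
Proof.
move=> e0; apply: (@cvg0_dom (fun n => e^-1 * n.+2%:R^-1)).
  by rewrite -(mulr0 e^-1); apply: cvgMr; exact: cvg_inv2.
move=> n; rewrite ger0_norm ?expR_ge0// expRN -invfM lef_pV2 ?posrE ?expR_gt0//.
  by apply: le_trans (expR_ge1Dx _); rewrite lerDr.
by rewrite mulr_gt0.
Qed.

Lemma is_derive_expN (e x : R) : is_derive x 1 (fun y => expR (- (e * y))) (- e * expR (- (e * x))).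
Proof.
apply: (der_eq (der_comp (derN (derM (derC x e) (derid x))) (is_derive_expR _))).
by rewrite mul0r mulr1 add0r mulrC.
Qed.

Lemma itg_exp_pos (e : R) : 0 < e -> itg mu (fun x => pos x * expR (- (e * x))).
Proof.
move=> e0.
apply: (proj1 (@ge0_ftc_pos R (fun x => - e^-1 * expR (- (e * x))) _ (e^-1) _ _ _ _)).
- move=> x _; apply: der_eq (derM (derC x _) (is_derive_expN e x)) _.
  by rewrite mul0r add0r !mulNr mulrN opprK mulKf// gt_eqF.
- by move=> x _; exact: (der_cont (is_derive_expN e x)).
- by move=> x _; exact: expR_ge0.
- move=> x y x0 y0; rewrite !mulNr opprK addrC.
  have ei : 0 <= e^-1 by rewrite invr_ge0 ltW.
  have h1 : expR (- (e * x)) <= 1.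
    by rewrite -[leRHS]expR0 ler_expR oppr_le0 mulr_ge0// ltW.
  rewrite lerBlDr; apply: (@le_trans _ _ e^-1); first exact: ler_piMr.
  by rewrite lerDl mulr_ge0 ?expR_ge0.
Qed.

Lemma itg_exp_abs (e : R) : 0 < e -> itg mu (fun x => expR (- (e * `|x|))).
Proof.
move=> e0; have h := itg_exp_pos e0.
have m : measurable_fun setT (fun x : R => expR (- (e * `|x|))).
  apply: measurableT_comp => //; apply: measurable_funN.
  by apply: measurable_funM => //; exact: measurable_normr.
apply: itg_half => //; apply: eq_itg h => x; rewrite /pos; case: ifP => x0; rewrite ?mul0r//.
  by rewrite gtr0_norm.
by rewrite normrN gtr0_norm.
Qed.

(** [prim_c] and [prim_s] are primitives in [x] of [exp (- e x) cos (x t)] and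
    [exp (- e x) sin (x t)]. *)
Definition prim_c (e t x : R) := expR (- (e * x)) * (- e * cos (x * t) + t * sin (x * t)) / (e ^+ 2 + t ^+ 2).
Definition prim_s (e t x : R) := expR (- (e * x)) * (- e * sin (x * t) - t * cos (x * t)) / (e ^+ 2 + t ^+ 2).

Lemma sumsq_neq0 (e t : R) : 0 < e -> e ^+ 2 + t ^+ 2 != 0.
Proof. by move=> e0; rewrite gt_eqF// ltr_wpDr ?sqr_ge0// exprn_gt0. Qed.

Lemma is_derive_cosM (t x : R) : is_derive x 1 (fun y => cos (y * t)) (- t * sin (x * t)).
Proof.
apply: (der_eq (der_comp (derM (derid x) (derC x t)) (is_derive_cos _))).
by rewrite mulr0 addr0 mul1r mulNr mulrC mulNr.
Qed.

Lemma is_derive_sinM (t x : R) : is_derive x 1 (fun y => sin (y * t)) (t * cos (x * t)).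
Proof.
apply: (der_eq (der_comp (derM (derid x) (derC x t)) (is_derive_sin _))).
by rewrite mulr0 addr0 mul1r mulrC.
Qed.

Lemma is_derive_prim_c (e t x : R) : 0 < e ->
  is_derive x 1 (prim_c e t) (expR (- (e * x)) * cos (x * t)).
Proof.
move=> e0; have h := sumsq_neq0 t e0.
apply: der_eq (derM (derM (is_derive_expN e x) (derD (derM (derC x (- e)) (is_derive_cosM t x)) (derM (derC x t) (is_derive_sinM t x)))) (derC x _)) _.
by field.
Qed.

Lemma is_derive_prim_s (e t x : R) : 0 < e ->
  is_derive x 1 (prim_s e t) (expR (- (e * x)) * sin (x * t)).
Proof.
move=> e0; have h := sumsq_neq0 t e0.
apply: der_eq (derM (derM (is_derive_expN e x) (derB (derM (derC x (- e)) (is_derive_sinM t x)) (derM (derC x t) (is_derive_cosM t x)))) (derC x _)) _.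
by field.
Qed.

Lemma abs_cos (x : R) : `|cos x| <= 1.
Proof. by rewrite ler_norml cos_geN1 cos_le1. Qed.
Lemma abs_sin (x : R) : `|sin x| <= 1.
Proof. by rewrite ler_norml sin_geN1 sin_le1. Qed.

Lemma measurable_cosM (t : R) : measurable_fun setT (fun x : R => cos (x * t)).
Proof. by apply: continuous_measurable_fun => x; exact: der_cont (is_derive_cosM t x). Qed.
Lemma measurable_sinM (t : R) : measurable_fun setT (fun x : R => sin (x * t)).
Proof. by apply: continuous_measurable_fun => x; exact: der_cont (is_derive_sinM t x). Qed.

Lemma I_exp_cos (e t : R) : 0 < e ->
  \int[mu]_x (pos x * (expR (- (e * x)) * cos (x * t))) = e / (e ^+ 2 + t ^+ 2).
Proof.
move=> e0.
rewrite (@ftc_pos R (prim_c e t) _ (prim_c e t 0) 0 (fun x _ => is_derive_prim_c t x e0)).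
- by rewrite /prim_c mulr0 oppr0 expR0 mul0r cos0 sin0 mulr0 addr0 mulr1 mul1r !mulNr sub0r opprK.
- move=> x _; exact: (der_cont (derM (is_derive_expN e x) (is_derive_cosM t x))).
- apply: eq_itg (itgMb (itg_exp_pos e0) (measurable_cosM t) (fun x => abs_cos (x * t))) => x.
  by rewrite mulrA.
- have /= h := der_cont (is_derive_prim_c t 0 e0).
  by apply: continuous_cvg => //; exact: cvg_inv2.
- apply: (@cvg0_dom (fun n => expR (- (e * n.+2%:R)) * ((e + `|t|) / (e ^+ 2 + t ^+ 2)))).
    by rewrite -(mul0r ((e + `|t|) / (e ^+ 2 + t ^+ 2))); apply: cvgMl; exact: cvg_expn.
  move=> n; rewrite /prim_c -mulrA normrM ger0_norm ?expR_ge0// ler_wpM2l ?expR_ge0//.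
  rewrite normrM [X in _ * X]ger0_norm ?invr_ge0 ?addr_ge0 ?sqr_ge0//.
  rewrite ler_wpM2r ?invr_ge0 ?addr_ge0 ?sqr_ge0//.
  apply: (le_trans (ler_normD _ _)); rewrite !normrM normrN (gtr0_norm e0).
  by apply: lerD; rewrite ler_piMr// ?abs_cos ?abs_sin// ltW.
Qed.

Lemma I_exp_sin (e t : R) : 0 < e ->
  \int[mu]_x (pos x * (expR (- (e * x)) * sin (x * t))) = t / (e ^+ 2 + t ^+ 2).
Proof.
move=> e0.
rewrite (@ftc_pos R (prim_s e t) _ (prim_s e t 0) 0 (fun x _ => is_derive_prim_s t x e0)).
- by rewrite /prim_s mulr0 oppr0 expR0 mul0r cos0 sin0; field; exact: sumsq_neq0.
- move=> x _; exact: (der_cont (derM (is_derive_expN e x) (is_derive_sinM t x))).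
- apply: eq_itg (itgMb (itg_exp_pos e0) (measurable_sinM t) (fun x => abs_sin (x * t))) => x.
  by rewrite mulrA.
- have /= h := der_cont (is_derive_prim_s t 0 e0).
  by apply: continuous_cvg => //; exact: cvg_inv2.
- apply: (@cvg0_dom (fun n => expR (- (e * n.+2%:R)) * ((e + `|t|) / (e ^+ 2 + t ^+ 2)))).
    by rewrite -(mul0r ((e + `|t|) / (e ^+ 2 + t ^+ 2))); apply: cvgMl; exact: cvg_expn.
  move=> n; rewrite /prim_s -mulrA normrM ger0_norm ?expR_ge0// ler_wpM2l ?expR_ge0//.
  rewrite normrM [X in _ * X]ger0_norm ?invr_ge0 ?addr_ge0 ?sqr_ge0//.
  rewrite ler_wpM2r ?invr_ge0 ?addr_ge0 ?sqr_ge0//.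
  apply: (le_trans (ler_normB _ _)); rewrite !normrM normrN (gtr0_norm e0).
  by apply: lerD; rewrite ler_piMr// ?abs_cos ?abs_sin// ltW.
Qed.

(** The right-hand side is the Poisson kernel of width [e], up to normalisation; it serves as
    approximate identity in Parseval and in inversion. *)
Lemma poisson_cos (e t : R) : 0 < e ->
  \int[mu]_x (expR (- (e * `|x|)) * cos (x * t)) = 2 * e / (e ^+ 2 + t ^+ 2).
Proof.
move=> e0; have hi := itgMb (itg_exp_abs e0) (measurable_cosM t) (fun x => abs_cos (x * t)).
rewrite (I_half hi) -[RHS]mulrA -(I_exp_cos t e0) -IZ.
  apply: eqI => x; rewrite normrN mulNr cosN /pos; case: ifP => x0; last by rewrite !mul0r mulr0.
  by rewrite gtr0_norm// !mul1r; ring.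
apply: eq_itg (itgMb (itg_exp_pos e0) (measurable_cosM t) (fun x => abs_cos (x * t))) => x.
by rewrite mulrA.
Qed.

Definition sgn0 (x : R) : R := pos x - pos (- x).

Lemma measurable_sgn0 : measurable_fun setT sgn0.
Proof.
apply: measurable_funB; first exact: measurable_pos.
by apply: measurableT_comp => //; exact: measurable_pos.
Qed.

Lemma abs_sgn0 (x : R) : `|sgn0 x| <= 1.
Proof.
rewrite /sgn0 /pos oppr_gt0; case: ltgtP => // *; rewrite ?subr0 ?sub0r ?normrN ?normr1 ?normr0//.
Qed.

Lemma sgn0N (x : R) : sgn0 (- x) = - sgn0 x.
Proof. by rewrite /sgn0 opprK opprB. Qed.

(** The right-hand side is the conjugate Poisson kernel, a smoothed [2 / t]; the Hilbert transform
    at [alpha = 1] is approached through it. *)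
Lemma poisson_sin (e t : R) : 0 < e ->
  \int[mu]_x (expR (- (e * `|x|)) * (sgn0 x * sin (x * t))) = 2 * (t / (e ^+ 2 + t ^+ 2)).
Proof.
move=> e0.
have hi : itg mu (fun x => expR (- (e * `|x|)) * (sgn0 x * sin (x * t))).
  apply: (itgMb (r := 1) (itg_exp_abs e0)).
    by apply: measurable_funM; [exact: measurable_sgn0|exact: measurable_sinM].
  by move=> x; rewrite normrM mulr_ile1 ?abs_sgn0 ?abs_sin.
rewrite (I_half hi) -(I_exp_sin t e0) -IZ.
  apply: eqI => x; rewrite normrN sgn0N (mulNr x t) sinN /sgn0 /pos oppr_gt0.
  case: ltgtP => x0; rewrite ?mul0r ?mulr0//.
  by rewrite gtr0_norm// !mul1r; ring.
apply: eq_itg (itgMb (itg_exp_pos e0) (measurable_sinM t) (fun x => abs_sin (x * t))) => x.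
by rewrite mulrA.
Qed.

(** Plays three roles: Poisson kernel at unit width, yardstick of decay for integrability, and
    profile of the weight, which is a power of it. *)
Definition q (x : R) : R := (1 + x ^+ 2)^-1.

Lemma q_gt0 (x : R) : 0 < q x.
Proof. by rewrite invr_gt0 ltr_pwDl// sqr_ge0. Qed.
Lemma q_ge0 (x : R) : 0 <= q x. Proof. exact/ltW/q_gt0. Qed.
Lemma q_le1 (x : R) : q x <= 1.
Proof. by rewrite invf_le1 ?lerDl ?sqr_ge0// ltr_pwDl// sqr_ge0. Qed.

Lemma continuous_q : continuous q.
Proof.
move=> x; have h : is_derive x 1 (fun y : R => 1 + y ^+ 2) (0 + (1 * x + x * 1)).
  rewrite (_ : (fun _ => _) = (fun y : R => 1 + y * y)); last by apply/funext => y; rewrite expr2.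
  exact: (derD (derC x 1) (derM (derid x) (derid x))).
by apply: cvgV; [rewrite gt_eqF// ltr_pwDl// sqr_ge0|exact: der_cont h].
Qed.

Lemma cvg_atan_n : (fun n => atan n.+1%:R : R) @ \oo --> (pi / 2 : R).
Proof.
have h : (fun n => n.+1%:R : R) @ \oo --> +oo%R.
  apply/cvgryPge => A; near=> n; rewrite (@le_trans _ _ n%:R)//; last by rewrite ler_nat.
  near: n; exact: nbhs_infty_ger.
exact: (cvg_comp _ _ h (@cvgy_atan R)).
Unshelve. all: by end_near. Qed.

Lemma itg_q : itg mu q.
Proof.
apply: (proj1 (@ge0_ftc_T R atan q pi (@is_derive1_atan R) continuous_q q_ge0 _)).
move=> x y; have := atan_gtNpi2 x; have := atan_ltpi2 y; lra.
Qed.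

Lemma I_q : \int[mu]_x q x = pi.
Proof.
rewrite (@ftc_T R atan q (- (pi / 2)) (pi / 2) (@is_derive1_atan R) continuous_q itg_q).
- lra.
- rewrite (_ : (fun n => _) = (fun n => - atan n.+1%:R)); first by apply: cvgN; exact: cvg_atan_n.
  by apply/funext => n; rewrite atanN.
- exact: cvg_atan_n.
Qed.

End special_integrals.

(** * Hartley transform: Parseval and inversion *)

Section hartley.
Context (R : realType).
Notation mu := (@lebesgue_measure R).
Implicit Types (f g : R -> R).

(* The Hartley kernel: for real functions it replaces the complex exponential. *)
Definition cas (t : R) : R := cos t + sin t.

Lemma abs_cas t : `|cas t| <= 2.
Proof.
apply: le_trans (ler_normD _ _) _.
have := abs_cos t; have := abs_sin t; lra.
Qed.

Lemma continuous_cas : continuous cas.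
Proof. by move=> t; exact: (der_cont (derD (is_derive_cos t) (is_derive_sin t))). Qed.

Lemma measurable_cas : measurable_fun setT cas.
Proof. by apply: continuous_measurable_fun; exact: continuous_cas. Qed.

Lemma measurable_casM (t : R) : measurable_fun setT (fun x : R => cas (x * t)).
Proof.
by apply: (measurableT_comp measurable_cas); apply: measurable_funM.
Qed.

Lemma measurable_casM' (t : R) : measurable_fun setT (fun x : R => cas (t * x)).
Proof.
by apply: (measurableT_comp measurable_cas); apply: measurable_funM.
Qed.

Lemma casM a b : cas a * cas b = cos (a - b) + sin (a + b).
Proof. by rewrite cosB sinD /cas; ring. Qed.

Definition hart f (xi : R) : R := \int[mu]_x (f x * cas (x * xi)).

Lemma itg_hart f xi : itg mu f -> itg mu (fun x => f x * cas (x * xi)).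
Proof.
by move=> hf; apply: (itgMb hf (measurable_casM xi) (fun x => abs_cas (x * xi))).
Qed.

Lemma abs_hart f xi : itg mu f -> `|hart f xi| <= 2 * \int[mu]_x `|f x|.
Proof.
move=> hf; rewrite -IZ; last exact: itg_abs.
apply: le_abs_Idom.
- exact/itgZ/itg_abs.
- exact/itg_measurable/itg_hart.
- by move=> x; rewrite normrM mulrC ler_wpM2r// abs_cas.
Qed.

Lemma continuous_hart f : itg mu f -> continuous (hart f).
Proof.
move=> hf xi; apply/(@cvg_nbhsP _ R^o) => w wxi.
apply: (proj2 (@dct _ _ _ mu (fun n x => f x * cas (x * w n)) _ (fun x => `|f x| * 2) _ _ _ _)).
- exact/itgZr/itg_abs.
- by move=> n; exact/itg_measurable/itg_hart.
- move=> x; apply: cvgMr.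
  by apply: continuous_cvg; [exact: continuous_cas|exact: cvgMr].
- by move=> n x; rewrite normrM ler_wpM2l// abs_cas.
Qed.

Lemma measurable_hart f : itg mu f -> measurable_fun setT (hart f).
Proof. by move=> hf; apply: continuous_measurable_fun; exact: continuous_hart. Qed.

(** By [casM] the product is the cosine of the difference plus the sine of the sum; the latter is
    odd in [t] and drops out. *)
Lemma poisson_cas (e x y : R) : 0 < e ->
  \int[mu]_t (expR (- (e * `|t|)) * (cas (y * t) * cas (x * t))) =
  2 * e / (e ^+ 2 + (y - x) ^+ 2).
Proof.
move=> e0; rewrite -poisson_cos//.
have h1 := itgMb (itg_exp_abs e0) (measurable_cosM (y - x)) (fun t => abs_cos (t * (y - x))).
have h2 := itgMb (itg_exp_abs e0) (measurable_sinM (y + x)) (fun t => abs_sin (t * (y + x))).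
rewrite (@eqI _ _ _ mu (fun t => expR (- (e * `|t|)) * cos (t * (y - x)) +
   expR (- (e * `|t|)) * sin (t * (y + x)))); last first.
  by move=> t; rewrite casM mulrDr; do ![congr (_ + _)|congr (_ * _)|congr cos|congr sin]; ring.
rewrite ID// [X in _ + X]I_odd ?addr0// => t.
by rewrite normrN mulNr sinN mulrN.
Qed.

(** Poisson mean of [g] at scale [e]. The kernel [2 * q] has mass [2 * pi], matching the
    unnormalised transform. *)
Definition pois g (e x : R) : R := \int[mu]_t (2 * q t * g (x + e * t)).

Lemma itg_pois g M e x : measurable_fun setT g -> (forall x, `|g x| <= M) ->
  itg mu (fun t => 2 * q t * g (x + e * t)).
Proof.
move=> mg gM; apply: (itgMb (r := M) (itgZ 2 (@itg_q R))) => //.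
by apply: measurableT_comp => //; apply: measurable_funD => //; apply: measurable_funM.
Qed.

Lemma abs_pois g M e x : measurable_fun setT g -> (forall x, `|g x| <= M) ->
  `|pois g e x| <= 2 * pi * M.
Proof.
move=> mg gM; rewrite -I_q -IZ; last exact: itg_q.
rewrite -IZr; last exact/itgZ/itg_q.
apply: le_abs_Idom.
- exact/itgZr/itgZ/itg_q.
- exact/itg_measurable/(itg_pois _ _ mg gM).
- move=> t; rewrite normrM ger0_norm; last by rewrite mulr_ge0// q_ge0.
  by rewrite ler_wpM2l// mulr_ge0// q_ge0.
Qed.

Lemma cvg_pois g M x : continuous g -> (forall x, `|g x| <= M) ->
  (fun n => pois g (n.+2%:R^-1) x) @ \oo --> 2 * pi * g x.
Proof.
move=> cg gM; have mg := continuous_measurable_fun cg.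
have -> : 2 * pi * g x = \int[mu]_t (2 * q t * g x).
  by rewrite IZr ?IZ ?I_q//; [exact: itg_q|exact/itgZ/itg_q].
apply: (proj2 (@dct _ _ _ mu (fun n t => 2 * q t * g (x + n.+2%:R^-1 * t)) _
  (fun t => 2 * q t * M) _ _ _ _)).
- exact/itgZr/itgZ/itg_q.
- by move=> n; exact/itg_measurable/(itg_pois _ _ mg gM).
- move=> t; apply: cvgMr; apply: continuous_cvg; first exact: cg.
  rewrite -[X in _ --> X]addr0; apply: cvgD; first exact: cvg_cst.
  by rewrite -(mul0r t); apply: cvgMl; exact: cvg_inv2.
- move=> n t; rewrite normrM ger0_norm; last by rewrite mulr_ge0// q_ge0.
  by rewrite ler_wpM2l// mulr_ge0// q_ge0.
Qed.

(** Fubini and [poisson_cas] give the convolution of [g] with a Poisson kernel, and the substitution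
    [y = e * t + x] rescales it to unit width. *)
Lemma hart_pois g M e x : 0 < e -> itg mu g -> (forall x, `|g x| <= M) ->
  \int[mu]_t (expR (- (e * `|t|)) * hart g t * cas (x * t)) = pois g e x.
Proof.
move=> e0 hg gM; have mg := itg_measurable hg.
pose F (t y : R) := expR (- (e * `|t|)) * g y * (cas (y * t) * cas (x * t)).
have iF : it2 F.
  apply: (@it2_dom _ (fun t y => (expR (- (e * `|t|)) * `|g y|) * 4)).
  - by apply: (itgZr 4 (it2_tensor (itg_exp_abs e0) (itg_abs hg))).
  - apply: measurable_funM.
      apply: measurable_funM.
        by apply: (measurableT_comp (itg_measurable (itg_exp_abs e0))).
      by apply: (measurableT_comp mg).
    apply: measurable_funM; apply: (measurableT_comp measurable_cas) => //.
      by apply: measurable_funM.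
    by apply: measurable_funM.
  - move=> t y; rewrite /F !normrM ger0_norm ?expR_ge0//.
    apply: ler_wpM2l; first by rewrite mulr_ge0 ?expR_ge0.
    by rewrite (_ : 4 = 2 * 2); [apply: ler_pM; rewrite ?abs_cas|ring].
transitivity (J F).
  rewrite J12//; apply: eqI => t; rewrite /F /hart.
  under [RHS]eq_Rintegral do rewrite -mulrA (mulrA (g _)) mulrA.
  rewrite -mulrA -IZr; last exact: itg_hart.
  rewrite -IZ; last exact/itgZr/itg_hart.
  by apply: eqI => y; rewrite !mulrA.
rewrite J21//.
transitivity (\int[mu]_y (g y * (2 * e / (e ^+ 2 + (y - x) ^+ 2)))).
  apply: eqI => y; rewrite /F -(poisson_cas x y e0) -IZ.
    by apply: eqI => t; ring.
  apply: (itgMb (r := 4) (itg_exp_abs e0)).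
    by apply: measurable_funM; apply: (measurableT_comp measurable_cas); apply: measurable_funM.
  by move=> t; rewrite normrM (_ : 4 = 2 * 2); [apply: ler_pM; rewrite ?abs_cas|ring].
have hk : itg mu (fun y => g y * (2 * e / (e ^+ 2 + (y - x) ^+ 2))).
  apply: (itgMb (r := 2 / e) hg).
    apply: continuous_measurable_fun => y; apply: cvgM; first exact: cvg_cst.
    apply: cvgV; first exact: sumsq_neq0.
    exact: (der_cont (derD (derC y _) (der_sqr (derB (derid y) (derC y x))))).
  move=> y; rewrite ger0_norm; last by rewrite divr_ge0 ?mulr_ge0 ?addr_ge0 ?sqr_ge0// ltW.
  rewrite ler_pdivrMr; last by rewrite ltr_wpDr ?sqr_ge0// exprn_gt0.
  rewrite mulrDr (_ : 2 / e * e ^+ 2 = 2 * e); last by field; rewrite gt_eqF.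
  by rewrite lerDl mulr_ge0 ?sqr_ge0// divr_ge0// ltW.
have ne : e != 0 by rewrite gt_eqF.
rewrite (I_affine x ne hk) gtr0_norm// -IZ; last exact: (itg_affine x ne hk).
apply: eqI => t; rewrite /q (addrC x); set gg := g _.
have h1 : 1 + t ^+ 2 != 0 by rewrite gt_eqF// ltr_pwDl// sqr_ge0.
have h2 := sumsq_neq0 (e * t + x - x) e0.
have h3 : e ^+ 2 + (e * t + x - x) ^+ 2 = e ^+ 2 * (1 + t ^+ 2) by ring.
by rewrite h3; field; rewrite ne h1.
Qed.

(** Continuity and boundedness make Poisson means converge pointwise, integrability serves Fubini;
    nothing is assumed on the transform. *)
Definition nice f := [/\ continuous f, itg mu f & exists M, forall x, `|f x| <= M].

Lemma hart_parseval_approx f g e : 0 < e -> nice f -> nice g ->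
  \int[mu]_t (expR (- (e * `|t|)) * hart f t * hart g t) =
  \int[mu]_x (f x * pois g e x).
Proof.
move=> e0 [cf hf _] [cg hg [M gM]].
pose F (t x : R) := expR (- (e * `|t|)) * hart g t * f x * cas (x * t).
have ih : itg mu (fun t => expR (- (e * `|t|)) * hart g t).
  apply: (itgMb (itg_exp_abs e0) (measurable_hart hg)) => t; exact: abs_hart.
have iF : it2 F.
  apply: (@it2_dom _ (fun t x => `|expR (- (e * `|t|)) * hart g t| * `|f x| * 2)).
  - exact: (itgZr 2 (it2_tensor (itg_abs ih) (itg_abs hf))).
  - apply: measurable_funM.
      apply: measurable_funM.
        by apply: (measurableT_comp (itg_measurable ih)).
      by apply: (measurableT_comp (itg_measurable hf)).
    by apply: (measurableT_comp measurable_cas); apply: measurable_funM.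
  - by move=> t x; rewrite /F !normrM ler_wpM2l ?abs_cas// !mulr_ge0.
transitivity (J F).
  rewrite J12//; apply: eqI => t; rewrite /F mulrAC [X in _ * X]/hart -IZ; last exact: itg_hart.
  by apply: eqI => x; rewrite !mulrA.
rewrite J21//; apply: eqI => x; rewrite /F -(hart_pois x e0 hg gM) -IZ.
  by apply: eqI => t; ring.
exact: (itgMb ih (measurable_casM' x) (fun t => abs_cas (x * t))).
Qed.

Lemma expN_cvg1 (t : R) : (fun n => expR (- (n.+2%:R^-1 * `|t|))) @ \oo --> (1 : R).
Proof.
rewrite -[X in _ --> X]expR0; apply: continuous_cvg; first exact: continuous_expR.
rewrite -[X in _ --> X]oppr0; apply: cvgN; rewrite -(mul0r `|t|); apply: cvgMl; exact: cvg_inv2.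
Qed.

Lemma expN_cvg (t a b : R) :
  (fun n => expR (- (n.+2%:R^-1 * `|t|)) * a * b) @ \oo --> a * b.
Proof.
rewrite (_ : (fun n => _) = (fun n => expR (- (n.+2%:R^-1 * `|t|)) * (a * b))).
  by rewrite -[X in _ --> X]mul1r; apply: cvgMl; exact: expN_cvg1.
by apply/funext => n; rewrite mulrA.
Qed.

Lemma expN_le1 (e t : R) : 0 < e -> expR (- (e * `|t|)) <= 1.
Proof. by move=> e0; rewrite -[leRHS]expR0 ler_expR oppr_le0 mulr_ge0// ltW. Qed.

Lemma cvg_parseval f g : nice f -> nice g ->
  (fun n => \int[mu]_t (expR (- (n.+2%:R^-1 * `|t|)) * hart f t * hart g t)) @ \oo -->
  2 * pi * \int[mu]_x (f x * g x).
Proof.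
move=> nf ng; have [cf hf _] := nf; have [cg hg [M gM]] := ng.
have mg := continuous_measurable_fun cg.
have hfg : itg mu (fun x => f x * g x) by exact: (itgMb hf mg gM).
rewrite -IZ// (_ : (fun n => _) = (fun n => \int[mu]_x (f x * pois g (n.+2%:R^-1) x))); last first.
  by apply/funext => n; apply: hart_parseval_approx; rewrite // invr_gt0.
have mp n : measurable_fun setT (pois g (n.+2%:R^-1)).
  have e0 : 0 < n.+2%:R^-1 :> R by rewrite invr_gt0.
  (* The Poisson mean is itself a Hartley transform, hence continuous and so measurable in [x]. *)
  rewrite (_ : pois g _ = fun x => hart (fun t => expR (- (n.+2%:R^-1 * `|t|)) * hart g t) x).
    apply: measurable_hart.
    by apply: (itgMb (itg_exp_abs e0) (measurable_hart hg)) => t; exact: abs_hart.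
  apply/funext => x; rewrite -(hart_pois x e0 hg gM); apply: eqI => t.
  by rewrite (mulrC x).
apply: (proj2 (@dct _ _ _ mu (fun n x => f x * pois g (n.+2%:R^-1) x) _ (fun x => `|f x| * (2 * pi * M)) _ _ _ _)).
- exact/itgZr/itg_abs.
- by move=> n; apply: measurable_funM; [exact: (itg_measurable hf)|exact: mp].
- move=> x; rewrite mulrCA; apply: cvgMr; exact: cvg_pois gM.
- by move=> n x; rewrite normrM ler_wpM2l// abs_pois.
Qed.

(** The Abel-regularised integrals converge, so they are bounded, and Fatou's lemma removes the
    regularising factor. *)
Lemma itg_hart2 f : nice f -> itg mu (fun t => hart f t * hart f t).
Proof.
move=> nf; have [cf hf [M fM]] := nf.
have c := cvg_parseval nf nf.
have [B hB] : exists B, forall n, \int[mu]_t (expR (- (n.+2%:R^-1 * `|t|)) * hart f t * hart f t) <= B.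
  have := cvg_seq_bounded (cvgP _ c) => -[B [_ hB]].
  exists (B + 1) => n; apply: le_trans (ler_norm _) _.
  by apply: hB => //; rewrite ltrDl.
apply: (proj1 (@fatou_itg _ _ _ mu
  (fun n t => expR (- (n.+2%:R^-1 * `|t|)) * hart f t * hart f t) _ B _ _ _ _)) => //.
- by move=> n t; rewrite -mulrA -expr2 mulr_ge0 ?expR_ge0 ?sqr_ge0.
- move=> n; have e0 : 0 < n.+2%:R^-1 :> R by rewrite invr_gt0.
  have h1 := itgMb (itg_exp_abs e0) (measurable_hart hf) (fun t => abs_hart t hf).
  exact: (itgMb h1 (measurable_hart hf) (fun t => abs_hart t hf)).
- by move=> t; exact: expN_cvg.
Qed.

Lemma itg_hartM f g : nice f -> nice g -> itg mu (fun t => hart f t * hart g t).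
Proof.
move=> nf ng; have [_ hf _] := nf; have [_ hg _] := ng.
apply: (itg_dom (itgD (itg_hart2 nf) (itg_hart2 ng))).
  by apply: measurable_funM; exact: measurable_hart.
move=> t; rewrite -!expr2 normrM -(real_normK (num_real (hart f t))) -(real_normK (num_real (hart g t))).
move: `|hart f t| `|hart g t| => a b; have := sqr_ge0 (a - b); have := sqr_ge0 (a + b); nra.
Qed.

Lemma parseval f g : nice f -> nice g ->
  \int[mu]_t (hart f t * hart g t) = 2 * pi * \int[mu]_x (f x * g x).
Proof.
move=> nf ng; have [_ hf _] := nf; have [_ hg _] := ng.
have mf := measurable_hart hf; have mg := measurable_hart hg.
have h : (fun n => \int[mu]_t (expR (- (n.+2%:R^-1 * `|t|)) * hart f t * hart g t)) @ \oo -->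
    \int[mu]_t (hart f t * hart g t).
  apply: (proj2 (@dct _ _ _ mu (fun n t => expR (- (n.+2%:R^-1 * `|t|)) * hart f t * hart g t)
    _ (fun t => `|hart f t * hart g t|) _ _ _ _)).
  - exact/itg_abs/itg_hartM.
  - move=> n; apply: measurable_funM => //; apply: measurable_funM => //.
    by apply: itg_measurable; apply: itg_exp_abs; rewrite invr_gt0.
  - by move=> t; exact: expN_cvg.
  - move=> n t; rewrite -mulrA normrM ler_piMl// (ger0_norm (expR_ge0 _)).
    by rewrite expN_le1// invr_gt0.
by apply: cvg_unique h (cvg_parseval nf ng); exact: Rhausdorff.
Qed.

(** Integrability of [hart g] lets dominated convergence remove the Abel factor; the same integrals
    are Poisson means of [g], whose limit is [2 * pi * g x]. *)
Lemma hart_inversion g x : nice g -> itg mu (hart g) -> hart (hart g) x = 2 * pi * g x.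
Proof.
move=> [cg hg [M gM]] hh; have mh := measurable_hart hg.
have h : (fun n => \int[mu]_t (expR (- (n.+2%:R^-1 * `|t|)) * hart g t * cas (x * t))) @ \oo -->
    hart (hart g) x.
  apply: (proj2 (@dct _ _ _ mu (fun n t => expR (- (n.+2%:R^-1 * `|t|)) * hart g t * cas (x * t))
    _ (fun t => `|hart g t| * 2) _ _ _ _)).
  - exact/itgZr/itg_abs.
  - move=> n; apply: measurable_funM; last exact: measurable_casM'.
    apply: measurable_funM => //.
    by apply: itg_measurable; apply: itg_exp_abs; rewrite invr_gt0.
  - by move=> t; rewrite (mulrC t x); exact: expN_cvg.
  - move=> n t; rewrite !normrM; apply: ler_pM; rewrite ?abs_cas ?mulr_ge0//.
    by rewrite ler_piMl// (ger0_norm (expR_ge0 _)) expN_le1// invr_gt0.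
have h' := cvg_pois (x := x) cg gM.
have e : (fun n => \int[mu]_t (expR (- (n.+2%:R^-1 * `|t|)) * hart g t * cas (x * t))) =
  (fun n => pois g (n.+2%:R^-1) x).
  by apply/funext => n; apply: hart_pois gM; rewrite // invr_gt0.
by move: h; rewrite e => h; apply: cvg_unique h h'; exact: Rhausdorff.
Qed.

End hartley.

(** * Decay classes and fractional derivatives *)

Section decay.
Context (R : realType).
Notation mu := (@lebesgue_measure R).
Implicit Types (f g : R -> R).

Definition qd f := exists C, forall x, `|f x| <= C * q x.

(** [C^k] functions that are [O(q)] together with their derivatives up to order [k]. Unlike its
    companion [bC], it ensures integrability; a product of the two kinds stays in [qC], which covers
    [u w], [u sqrt w] and [u' phi]. Derivatives are existential witnesses, so that closed formulas
    may serve. *)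
Fixpoint qC (k : nat) f : Prop := match k with
  | 0 => continuous f /\ qd f
  | k'.+1 => qd f /\
      exists f', (forall x : R, is_derive x 1 f (f' x)) /\ qC k' f' end.

Fixpoint bC (k : nat) f : Prop := match k with
  | 0 => continuous f /\ exists M, forall x, `|f x| <= M
  | k'.+1 => (exists M, forall x, `|f x| <= M) /\
      exists f', (forall x : R, is_derive x 1 f (f' x)) /\ bC k' f' end.

Lemma qC_qd k f : qC k f -> qd f. Proof. by case: k => [|k] []. Qed.

Lemma qC_continuous k f : qC k f -> continuous f.
Proof.
by case: k => [[]//|k [_ [f' [df _]]] x]; exact: der_cont (df x).
Qed.

Lemma bC_bounded k f : bC k f -> exists M, forall x, `|f x| <= M.
Proof. by case: k => [|k] []. Qed.

Lemma bC_continuous k f : bC k f -> continuous f.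
Proof.
by case: k => [[]//|k [_ [f' [df _]]] x]; exact: der_cont (df x).
Qed.

Lemma qCW k f : qC k.+1 f -> qC k f.
Proof.
elim: k f => [f h|k ih f [qf [f' [df h]]]].
  by split; [exact: qC_continuous h|exact: qC_qd h].
by split => //; exists f'; split => //; exact: ih.
Qed.

Lemma bCW k f : bC k.+1 f -> bC k f.
Proof.
elim: k f => [f h|k ih f [qf [f' [df h]]]].
  by split; [exact: bC_continuous h|exact: bC_bounded h].
by split => //; exists f'; split => //; exact: ih.
Qed.

Lemma qdD f g : qd f -> qd g -> qd (fun x => f x + g x).
Proof.
move=> [C hC] [D hD]; exists (C + D) => x.
by rewrite mulrDl (le_trans (ler_normD _ _))// lerD.
Qed.

Lemma qdM f g M : qd f -> (forall x, `|g x| <= M) -> qd (fun x => f x * g x).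
Proof.
move=> [C hC] hM; exists (C * M) => x.
by rewrite normrM mulrAC ler_pM.
Qed.

Lemma qCD k f g : qC k f -> qC k g -> qC k (fun x => f x + g x).
Proof.
elim: k f g => [f g [cf qf] [cg qg]|k ih f g [qf [f' [df hf]]] [qg [g' [dg hg]]]].
  by split; [move=> x; apply: cvgD; [exact: cf|exact: cg]|exact: qdD].
split; first exact: qdD.
by exists (fun x => f' x + g' x); split => [x|]; [exact: derD|exact: ih].
Qed.

Lemma qCM k f g : qC k f -> bC k g -> qC k (fun x => f x * g x).
Proof.
elim: k f g => [f g [cf qf] [cg [M gM]]|k ih f g hf hg].
  by split; [move=> x; apply: cvgM; [exact: cf|exact: cg]|exact: qdM gM].
have [M gM] := bC_bounded hg; have hf0 := qCW hf; have hg0 := bCW hg.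
move: hf hg => [qf [f' [df hf]]] [_ [g' [dg hg]]].
split; first exact: qdM gM.
exists (fun x => f' x * g x + f x * g' x); split => [x|].
  exact: derM.
by apply: qCD; exact: ih.
Qed.

Lemma qd_itg f : measurable_fun setT f -> qd f -> itg mu f.
Proof. by move=> mf [C hC]; exact: itg_dom (itgZ C (@itg_q R)) mf hC. Qed.

Lemma qd_bounded f : qd f -> exists M, forall x, `|f x| <= M.
Proof.
move=> [C hC]; exists `|C| => x; apply: (le_trans (hC x)).
apply: le_trans (_ : `|C| * q x <= _).
  by rewrite ler_wpM2r ?q_ge0 ?ler_norm.
by rewrite ler_piMr ?q_le1.
Qed.

Lemma qC_itg k f : qC k f -> itg mu f.
Proof.
move=> h; apply: qd_itg; last exact: qC_qd h.
apply: continuous_measurable_fun; exact: qC_continuous h.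
Qed.

Lemma qC_nice k f : qC k f -> nice f.
Proof.
move=> h; split; [exact: qC_continuous h|exact: qC_itg h|].
exact: qd_bounded (qC_qd h).
Qed.

Lemma q_cvg0 : (fun n => q (n.+1%:R : R)) @ \oo --> (0 : R).
Proof.
apply: (@cvg0_dom _ (fun n => n.+1%:R^-1)); first exact: cvg_harmonic.
move=> n; rewrite ger0_norm ?q_ge0// lef_pV2 ?posrE ?ltr_pwDl ?sqr_ge0//.
rewrite expr2 (@le_trans _ _ (n.+1%:R * n.+1%:R))//; last by rewrite lerDr.
by rewrite ler_peMr// ler1n.
Qed.

Lemma qN (x : R) : q (- x) = q x. Proof. by rewrite /q sqrrN. Qed.

Lemma qd_cvg f : qd f -> (fun n => f n.+1%:R) @ \oo --> (0 : R) /\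
  (fun n => f (- n.+1%:R)) @ \oo --> (0 : R).
Proof.
move=> [C hC].
have h : (fun n => C * q (n.+1%:R : R)) @ \oo --> (0 : R).
  by rewrite -(mulr0 C); apply: cvgMr; exact: q_cvg0.
by split; apply: (cvg0_dom h) => n; rewrite ?hC// -qN hC.
Qed.

Lemma I_derive f f' : (forall x : R, is_derive x 1 f (f' x)) -> continuous f' ->
  qd f -> itg mu f' -> \int[mu]_x f' x = 0.
Proof.
move=> df cf qf hf; have [h1 h2] := qd_cvg qf.
by rewrite (ftc_T df cf hf h2 h1) subrr.
Qed.

Lemma is_derive_casM (t x : R) :
  is_derive x 1 (fun y => cas (y * t)) (t * cas (x * - t)).
Proof.
apply: der_eq (derD (is_derive_cosM t x) (is_derive_sinM t x)) _.
by rewrite /cas mulrN cosN sinN; ring.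
Qed.

(** Integration by parts. Differentiation reflects the frequency because the derivative of [cas] at
    [t] is [cas (- t)]. *)
Lemma hart_derive f f' xi : (forall x : R, is_derive x 1 f (f' x)) -> continuous f' ->
  qd f -> itg mu f' -> hart f' xi = - xi * hart f (- xi).
Proof.
move=> df cf' qf hf'; have cf : continuous f by move=> x; exact: der_cont (df x).
have hf : itg mu f by apply: qd_itg qf; exact: continuous_measurable_fun.
have h1 := itg_hart xi hf'; have h2 := itgZ xi (itg_hart (- xi) hf).
have := @I_derive (fun x => f x * cas (x * xi))
  (fun x => f' x * cas (x * xi) + xi * (f x * cas (x * - xi))) _ _ _ _.
rewrite ID// IZ; last exact: itg_hart.
move=> h; apply/eqP; rewrite mulNr -addr_eq0; apply/eqP; apply: h.
- by move=> x; apply: der_eq (derM (df x) (is_derive_casM xi x)) _; ring.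
- move=> x; apply: cvgD; first by apply: cvgM; [exact: cf'|exact: (der_cont (is_derive_casM xi x))].
  apply: cvgMr; apply: cvgM; [exact: cf|exact: (der_cont (is_derive_casM (- xi) x))].
- by apply: (qdM (M := 2) qf) => x; exact: abs_cas.
- exact: itgD.
Qed.

Lemma hart_decay k f : qC k f -> exists C, forall xi, `|xi| ^+ k * `|hart f xi| <= C.
Proof.
elim: k f => [f h|k ih f [qf [f' [df h]]]].
  by exists (2 * \int[mu]_x `|f x|) => xi; rewrite expr0 mul1r abs_hart//; exact: (qC_itg (k := 0)).
have [C hC] := ih _ h; exists C => xi.
have := hC (- xi); rewrite (hart_derive _ df (qC_continuous h) qf (qC_itg h)).
by rewrite !opprK normrM normrN exprSr mulrA.
Qed.

Lemma hart_decay2 k f : qC k.*2 f -> exists C, forall xi, `|hart f xi| <= C * q xi ^+ k.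
Proof.
move=> h; have [C hC] := hart_decay h.
have [D hD] : exists C, forall xi, `|hart f xi| <= C.
  by exists (2 * \int[mu]_x `|f x|) => xi; rewrite abs_hart//; exact: qC_itg h.
exists (2 ^+ k * (C + D)) => xi; rewrite exprVn ler_pdivlMr; last by rewrite exprn_gt0// ltr_pwDl// sqr_ge0.
have D0 : 0 <= D by exact: le_trans (hD 0).
have C0 : 0 <= C by apply: le_trans (hC 0); rewrite mulr_ge0// exprn_ge0.
have [x1|x1] := leP `|xi| 1.
  apply: (@le_trans _ _ (D * 2 ^+ k)).
    rewrite ler_pM ?exprn_ge0 ?addr_ge0 ?sqr_ge0// lerXn2r ?nnegrE ?addr_ge0 ?sqr_ge0//.
    have : xi ^+ 2 <= 1 by rewrite -real_normK ?num_real// exprn_ile1.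
    by lra.
  by rewrite mulrC ler_wpM2l ?exprn_ge0// lerDr.
apply: (@le_trans _ _ (`|hart f xi| * (2 ^+ k * `|xi| ^+ k.*2))).
  have h2 : 1 + xi ^+ 2 <= 2 * `|xi| ^+ 2.
    have : 1 <= `|xi| ^+ 2 by rewrite exprn_ege1// ltW.
    by rewrite real_normK ?num_real//; lra.
  rewrite ler_wpM2l// -mul2n exprM -exprMn.
  by apply: lerXn2r h2; rewrite nnegrE; [rewrite addr_ge0 ?sqr_ge0|rewrite mulr_ge0 ?exprn_ge0].
by rewrite mulrCA ler_wpM2l ?exprn_ge0// mulrC (le_trans (hC _))// lerDl.
Qed.

End decay.

(** * Fractional derivatives as Hartley multipliers *)

Section absD_hartley.
Context (R : realType).
Notation mu := (@lebesgue_measure R).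
Implicit Types (f g : R -> R).

Lemma powR_le1 (x p : R) : 0 <= p -> 0 <= x <= 1 -> x `^ p <= 1.
Proof.
move=> p0 /andP[x0 x1]; have := @ge0_ler_powR R p p0 x 1; rewrite powR1.
by apply; rewrite ?nnegrE.
Qed.

Lemma itg_q_powR (p : R) : 1 / 2 < p -> itg mu (fun x => q x `^ p).
Proof.
move=> p2.
have mf : measurable_fun setT (fun x : R => q x `^ p).
  by apply: (measurableT_comp (measurable_powR p)); apply: continuous_measurable_fun; exact: continuous_q.
have p0 : 0 <= p by lra.
have [h1 _] := @pow_near R 0 1 ltac:(lra) ltr01.
have [h2 _] := @pow_far R (- (2 * p)) 1 ltac:(lra) ltr01.
have h : itg mu (fun x => pos x * q x `^ p).
  apply: (itg_dom (itgD h1 h2)); first by apply: measurable_funM => //; exact: measurable_pos.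
  move=> x; rewrite /pos /near0 /far0; case: ifPn => x0; last first.
    by rewrite mul0r normr0 addr_ge0// mulr_ge0 ?powR_ge0//; case: ifP.
  rewrite mul1r ger0_norm ?powR_ge0//; case: ifPn => /= x1.
    rewrite ltNge x1/= mul0r addr0 mul1r powRr0.
    by rewrite powR_le1 ?q_ge0 ?q_le1.
  rewrite -ltNge in x1; rewrite x1 mul0r add0r mul1r.
  have -> : x `^ (- (2 * p)) = (x ^- 2) `^ p.
    by rewrite -powR_invn ?ltW// -powRrM mulNr.
  rewrite ge0_ler_powR ?nnegrE ?q_ge0 ?invr_ge0 ?sqr_ge0//.
  by rewrite lef_pV2 ?posrE ?exprn_gt0 ?ltr_pwDl ?sqr_ge0// lerDr.
by apply: itg_half => //; apply: eq_itg h => x; rewrite qN.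
Qed.

Lemma continuous_abs_powR (s : R) : 0 < s -> continuous (fun x : R => `|x| `^ s).
Proof.
move=> s0 x; have [->|x0] := eqVneq x 0; last first.
  apply: (@continuous_comp _ _ _ (fun x : R => `|x|) (fun y => y `^ s)).
    exact: norm_continuous.
  by apply: cont_powR; rewrite normr_gt0.
apply/cvgrPdist_lt => e e0; rewrite normr0 powR0 ?gt_eqF//.
near=> y; rewrite sub0r normrN ger0_norm ?powR_ge0//.
have -> : e = (e `^ s^-1) `^ s by rewrite -powRrM mulVf ?gt_eqF// powRr1 ?ltW.
rewrite gt0_ltr_powR ?nnegrE ?powR_ge0//.
near: y; exists (e `^ s^-1); first by rewrite /= powR_gt0.
by move=> y /=; rewrite sub0r normrN.
Unshelve. all: by end_near. Qed.

Lemma measurable_abs_powR (s : R) : measurable_fun setT (fun x : R => `|x| `^ s).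
Proof. by apply: (measurableT_comp (measurable_powR s)); exact: normr_measurable. Qed.

Lemma abs_powR_le (s x : R) : 0 <= s -> `|x| `^ s <= q x `^ (- (s / 2)).
Proof.
move=> s0; have -> : `|x| `^ s = (`|x| ^+ 2) `^ (s / 2).
  by rewrite -powR_mulrn// -powRrM; congr (_ `^ _); field.
have -> : q x `^ (- (s / 2)) = (1 + x ^+ 2) `^ (s / 2).
  rewrite /q -powR_inv1 ?addr_ge0 ?sqr_ge0// -powRrM; congr (_ `^ _); ring.
rewrite ge0_ler_powR ?divr_ge0 ?nnegrE ?addr_ge0 ?sqr_ge0//.
by rewrite real_normK ?num_real// lerDr.
Qed.

Definition absH s f (xi : R) : R := `|xi| `^ s * hart f xi.

Lemma absH_decay k s f : 0 <= s -> qC k.*2 f ->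
  exists C, forall xi, `|absH s f xi| <= C * q xi `^ (k%:R - s / 2).
Proof.
move=> s0 /hart_decay2 [C hC]; exists C => xi.
have q0 := q_gt0 xi.
have -> : C * q xi `^ (k%:R - s / 2) = q xi `^ (- (s / 2)) * (C * q xi ^+ k).
  rewrite powRB; last by rewrite (gt_eqF q0) implybT.
  by rewrite powR_mulrn ?ltW// powRN; ring.
rewrite /absH normrM (ger0_norm (powR_ge0 _ _)).
by apply: ler_pM; rewrite ?powR_ge0 ?abs_powR_le.
Qed.

(** [2k] derivatives give the decay [q^k] of the transform, and [|xi|^s q^k] is integrable as soon
    as [2k - s > 1]. *)
Lemma itg_absH k s f : 0 <= s < 2 * k%:R - 1 -> qC k.*2 f -> itg mu (absH s f).
Proof.
move=> /andP[s0 sk] hf; have [C hC] := absH_decay s0 hf.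
have h : 1 / 2 < k%:R - s / 2 by lra.
apply: (itg_dom (itgZ C (itg_q_powR h))) => //.
apply: measurable_funM; first exact: measurable_abs_powR.
apply: measurable_hart; exact: qC_itg hf.
Qed.

Lemma nice_absH k s f : 0 < s < 2 * k%:R - 1 -> qC k.*2 f -> nice (absH s f).
Proof.
move=> /andP[s0 sk] hf; split.
- move=> x; apply: cvgM; first exact: continuous_abs_powR.
  apply: continuous_hart; exact: qC_itg hf.
- by apply: itg_absH hf; rewrite ltW.
have [C hC] := absH_decay (ltW s0) hf; exists C => xi.
have C0 : 0 <= C.
  have := hC 0; rewrite /q expr0n addr0 invr1 powR1 mulr1; exact: le_trans.
apply: (le_trans (hC xi)); rewrite ler_piMr//.
rewrite powR_le1 ?q_ge0 ?q_le1//; lra.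
Qed.

(** The symbol is even, so the real part of the complex integrand is the even part in [xi] of the
    Hartley integrand, and both have the same integral. *)
Lemma absD_hart s f x : itg mu f -> itg mu (absH s f) ->
  absD s f x = (2 * pi)^-1 * hart (absH s f) x.
Proof.
move=> hf hs.
have hc xi := itgMb hf (measurable_cosM xi) (fun y => abs_cos (y * xi)).
have hsn xi := itgMb hf (measurable_sinM xi) (fun y => abs_sin (y * xi)).
pose fc xi := \int[mu]_y (f y * cos (y * xi)).
pose fs xi := \int[mu]_y (f y * sin (y * xi)).
have e1 xi : \int[mu]_y (cos (- (y * xi)) * f y - sin (- (y * xi)) * 0) = fc xi.
  by apply: eqI => y; rewrite mulr0 subr0 cosN mulrC.
have e2 xi : \int[mu]_y (cos (- (y * xi)) * 0 + sin (- (y * xi)) * f y) = - fs xi.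
  by rewrite /fs -IN//; apply: eqI => y; rewrite mulr0 add0r sinN mulNr mulrC.
have e3 xi : hart f xi = fc xi + fs xi.
  by rewrite /fc /fs -ID//; apply: eqI => y; rewrite mulrDr.
have e4 xi : hart f (- xi) = fc xi - fs xi.
  by rewrite /fc /fs -IB//; apply: eqI => y; rewrite /cas mulrN cosN sinN mulrBr.
rewrite /absD /inv_fourier /cintegral /= mul0r subr0; congr (_ * _).
have h1 := itg_hart x hs; have h2 := itg_opp h1.
transitivity (\int[mu]_xi (2^-1 * (absH s f xi * cas (xi * x) + absH s f (- xi) * cas (- xi * x)))).
  by apply: eqI => xi; rewrite e1 e2 /absH normrN e3 e4 /cas (mulrC x) mulNr cosN sinN; field.
by rewrite (IZ 2^-1 (itgD h1 h2)) (ID h1 h2) (I_opp h1) /hart; field.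
Qed.

End absD_hartley.

(** * The quadratic form of the fractional Laplacian *)

Section form_kernel.
Context (R : realType).
Notation mu := (@lebesgue_measure R).
Implicit Types (f g : R -> R) (a : R).

(** Restricted to [h > 0]: the forms are symmetric in the two points [x] and [x + h], so each pair
    is counted once. *)
Definition K a (h : R) : R := pos h * h `^ (- (1 + a)).
Definition mm (h : R) : R := if h ^+ 2 <= 1 then h ^+ 2 else 1.

Lemma K_ge0 a h : 0 <= K a h.
Proof. by rewrite mulr_ge0 ?pos_ge0 ?powR_ge0. Qed.

Lemma measurable_K a : measurable_fun setT (K a).
Proof. by apply: measurable_funM; [exact: measurable_pos|exact: measurable_powR]. Qed.

Lemma K_pos a h : 0 < h -> K a h = h `^ (- (1 + a)).
Proof. by rewrite /K /pos => ->; rewrite mul1r. Qed.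

Lemma K_npos a h : h <= 0 -> K a h = 0.
Proof. by rewrite /K /pos ltNge => ->; rewrite mul0r. Qed.

Lemma mm_ge0 h : 0 <= mm h.
Proof. by rewrite /mm; case: ifP => // _; exact: sqr_ge0. Qed.

Lemma mm_le1 h : mm h <= 1. Proof. by rewrite /mm; case: ifP. Qed.

Lemma measurable_mm : measurable_fun setT mm.
Proof.
have e : mm = (fun h => Num.min (h ^+ 2) 1).
  by apply/funext => h; rewrite /mm minElt le_eqVlt; case: ltgtP => // <-.
by rewrite e; apply: measurable_minr => //; exact: exprn_measurable.
Qed.

Lemma itg_Kmm a : 0 < a < 2 -> itg mu (fun h => K a h * mm h).
Proof.
move=> /andP[a0 a2].
have [h1 _] := @pow_near R (1 - a) 1 ltac:(lra) ltr01.
have [h2 _] := @pow_far R (- (1 + a)) 1 ltac:(lra) ltr01.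
apply: (itg_dom (itgD h1 h2)).
  by apply: measurable_funM; [exact: measurable_K|exact: measurable_mm].
move=> h; have [h0|h0] := ltP 0 h; last first.
  rewrite K_npos// mul0r normr0 addr_ge0// mulr_ge0 ?powR_ge0//.
    exact: near0_ge0.
  exact: far0_ge0.
rewrite K_pos// ger0_norm; last by rewrite mulr_ge0 ?powR_ge0 ?mm_ge0.
rewrite /near0 /far0 /mm h0 /=; have [h1'|h1'] := leP h 1.
  rewrite mul1r mul0r addr0 exprn_ile1 ?(ltW h0)//.
  have -> : h `^ (1 - a) = h `^ (- (1 + a)) * h ^+ 2.
    rewrite -powR_mulrn ?(ltW h0)// -powRD ?(gt_eqF h0) ?implybT//.
    by congr (_ `^ _); ring.
  by rewrite /= lexx.
rewrite mul0r add0r mul1r ler_piMr ?powR_ge0//.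
by case: ifP.
Qed.

Lemma abs_sin_le (x : R) : `|sin x| <= `|x|.
Proof.
wlog x0 : x / 0 <= x.
  move=> hw; have [/hw//|x0] := leP 0 x.
  by have := hw (- x); rewrite sinN !normrN; apply; rewrite oppr_ge0 ltW.
have := @mvt_abs R sin cos 1 0 x x0 (@is_derive_sin R) (fun z _ => abs_cos z).
by rewrite add0r sin0 subr0 mul1r [X in _ -> _ <= X]ger0_norm.
Qed.

Lemma cos_le_mm (t : R) : 0 <= 1 - cos t <= 2 * mm t.
Proof.
have c1 := cos_le1 t; have c2 := cos_geN1 t.
have e : 1 - cos t = 2 * sin (t / 2) ^+ 2.
  rewrite [X in cos X](_ : t = t / 2 + t / 2); last by field.
  by rewrite cosD; have := cos2Dsin2 (t / 2); rewrite !expr2; lra.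
have s2 : sin (t / 2) ^+ 2 <= t ^+ 2 / 4.
  rewrite -real_normK ?num_real// (_ : t ^+ 2 / 4 = `|t / 2| ^+ 2).
    by rewrite lerXn2r ?nnegrE// abs_sin_le.
  by rewrite real_normK ?num_real//; field.
have t2 := sqr_ge0 t.
rewrite /mm; case: ifP => _; apply/andP; split; lra.
Qed.

Lemma mm_scale (h r : R) : mm (h * r) <= (1 + r ^+ 2) * mm h.
Proof.
have h2 := sqr_ge0 h; have r2 := sqr_ge0 r.
rewrite /mm exprMn; case: ifPn; case: ifPn; rewrite -?ltNge => *; nra.
Qed.

Lemma itg_Kcos a xi : 0 < a < 2 -> itg mu (fun h => K a h * (1 - cos (h * xi))).
Proof.
move=> ha; apply: (itg_dom (itgZ (2 * (1 + xi ^+ 2)) (itg_Kmm ha))).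
  apply: measurable_funM; first exact: measurable_K.
  by apply: measurable_funB => //; exact: measurable_cosM.
move=> h; have /andP[c1 c2] := cos_le_mm (h * xi).
rewrite normrM (ger0_norm (K_ge0 a h)) (ger0_norm c1) mulrCA.
rewrite ler_wpM2l ?K_ge0// (le_trans c2)// -mulrA ler_wpM2l//; exact: mm_scale.
Qed.

Definition kk a : R := \int[mu]_h (K a h * (1 - cos h)).

(** Homogeneity: rescaling [h] by [|xi|] produces the symbol, the cosine being even. The constant
    [kk] thus normalises the kernel against [|D|^a]. *)
Lemma kk_scale a xi : 0 < a < 2 ->
  \int[mu]_h (K a h * (1 - cos (h * xi))) = kk a * `|xi| `^ a.
Proof.
move=> ha; have [a0 a2] := andP ha.
have [->|x0] := eqVneq xi 0.
  rewrite normr0 powR0 ?gt_eqF// mulr0 -[RHS](@I0 _ _ _ mu); apply: eqI => h.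
  by rewrite mulr0 cos0 subrr mulr0.
have r0 : 0 < `|xi| by rewrite normr_gt0.
have hi : itg mu (fun h => K a h * (1 - cos h)).
  by apply: eq_itg (itg_Kcos 1 ha) => h; rewrite mulr1.
have rn : `|xi| != 0 by rewrite gt_eqF.
have h1 := I_scale rn hi; have h2 := itgZ_scale rn hi.
have -> : kk a = `|xi| * \int[mu]_h (K a (`|xi| * h) * (1 - cos (`|xi| * h))).
  by rewrite h1 normr_id mulrA mulfV// mul1r.
rewrite mulrAC.
have -> : `|xi| * `|xi| `^ a = `|xi| `^ (1 + a).
  by rewrite powRD ?rn ?implybT// powRr1.
rewrite -IZ//; apply: eqI => h.
have -> : cos (h * xi) = cos (`|xi| * h).
  by case: (ger0P xi) => _; rewrite mulrC ?mulNr ?cosN.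
rewrite mulrA; congr (_ * _).
have [h0|h0] := ltP 0 h; last first.
  by rewrite !K_npos ?mulr0// pmulr_rle0.
rewrite !K_pos ?mulr_gt0// powRM ?ltW// mulrA -powRD ?rn ?implybT//.
by rewrite subrr powRr0 mul1r.
Qed.

Lemma kk_gt0 a : 0 < a < 2 -> 0 < kk a.
Proof.
move=> ha; have [a0 a2] := andP ha; have p0 := pi_gt0 R.
have hi : itg mu (fun h => K a h * (1 - cos h)).
  by apply: eq_itg (itg_Kcos 1 ha) => h; rewrite mulr1.
have c0 : 0 < (pi : R) `^ (- (1 + a)) by rewrite powR_gt0.
(* On [[pi / 2, pi]] the cosine is nonpositive, so the integrand is at least [pi^(-1-a)] there. *)
apply: (@lt_le_trans _ _ (pi `^ (- (1 + a)) * (pi - pi / 2))).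
  by rewrite mulr_gt0//; lra.
rewrite -(@I_indic_itv R (pi / 2) pi); last by lra.
rewrite -IZ; last exact: itg_indic_itv.
apply: le_I => //; first exact/itgZ/itg_indic_itv.
move=> h; rewrite indicE; case: (boolP (h \in _)); rewrite ?mulr1 ?mulr0; last first.
  by rewrite mulr_ge0 ?K_ge0// subr_ge0 cos_le1.
rewrite inE /= in_itv /= => /andP[h1 h2].
have h0 : 0 < h by lra.
have hc : cos h <= 0.
  by rewrite -(@cos_pihalf R) leNgt; apply/negP; rewrite ltr_cos ?in_itv /=; lra.
rewrite K_pos// -[leLHS]mulr1 ler_pM ?powR_ge0//; last by lra.
by apply: le_powR_neg; [lra|rewrite h0].
Qed.

End form_kernel.

(** * The double integral on the Hartley side *)

Section form_identity.
Context (R : realType).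
Notation mu := (@lebesgue_measure R).
Implicit Types (f g : R -> R) (a : R) (G : R -> R -> R).

Lemma m2_K a G : m2 G -> m2 (fun x h => K a h * G x h).
Proof. by move=> mG; apply: measurable_funM => //; exact: (measurableT_comp (measurable_K a)). Qed.

Lemma m2_fun1 f : measurable_fun setT f -> m2 (fun x h => f x).
Proof. by move=> mf; exact: (measurableT_comp mf). Qed.

Lemma m2_fun2 f : measurable_fun setT f -> m2 (fun x h => f h).
Proof. by move=> mf; exact: (measurableT_comp mf). Qed.

Lemma m2_shift f : measurable_fun setT f -> m2 (fun x h => f (x + h)).
Proof. by move=> mf; apply: (measurableT_comp mf); apply: measurable_funD. Qed.

Lemma m2D F G : m2 F -> m2 G -> m2 (fun x h => F x h + G x h).
Proof. by move=> hF hG; exact: measurable_funD. Qed.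
Lemma m2B F G : m2 F -> m2 G -> m2 (fun x h => F x h - G x h).
Proof. by move=> hF hG; exact: measurable_funB. Qed.
Lemma m2M F G : m2 F -> m2 G -> m2 (fun x h => F x h * G x h).
Proof. by move=> hF hG; exact: measurable_funM. Qed.

Definition qq (x h : R) : R := q x + q (x + h).

Lemma qq_ge0 (x h : R) : 0 <= qq x h.
Proof. by rewrite addr_ge0 ?q_ge0. Qed.

Lemma qq_le2 (x h : R) : qq x h <= 2.
Proof. by have := q_le1 x; have := q_le1 (x + h); rewrite /qq; lra. Qed.

Lemma it2_Kmmqq a : 0 < a < 2 -> it2 (fun x h => K a h * (mm h * qq x h)).
Proof.
move=> ha; have h1 := it2_tensor (@itg_q R) (itg_Kmm ha).
have h2 := it2_shear 1 h1.
apply: eq_it2 (it2D h1 h2) => x h; rewrite /qq mul1r; ring.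
Qed.

Lemma it2_form C a G : 0 < a < 2 -> m2 G ->
  (forall x h, 0 < h -> `|G x h| <= C * (mm h * qq x h)) ->
  it2 (fun x h => K a h * G x h).
Proof.
move=> ha mG hG.
apply: (it2_dom (it2Z C (it2_Kmmqq ha))); first exact: m2_K.
move=> x h; rewrite normrM (ger0_norm (K_ge0 a h)).
have [h0|h0] := ltP 0 h; last by rewrite K_npos// !mul0r mulr0.
by rewrite mulrCA ler_wpM2l ?K_ge0// hG.
Qed.

Definition mh (h : R) : R := if h <= 1 then h else 1.

Lemma mh_sqr (h : R) : 0 < h -> mh h * mh h = mm h.
Proof.
move=> h0; rewrite /mh /mm -expr2 expr_le1 ?(ltW h0)//.
by case: ifP; rewrite ?expr1n.
Qed.

Lemma mh_ge0 (h : R) : 0 < h -> 0 <= mh h.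
Proof. by move=> h0; rewrite /mh; case: ifP => // _; exact: ltW. Qed.

Lemma q_near (x z : R) : x <= z <= x + 1 -> q z <= 3 * q x.
Proof.
move=> /andP[h1 h2]; have p1 := q_gt0 x; have p2 := q_gt0 z.
rewrite !invr_gt0 in p1 p2.
rewrite /q ler_pdivlMr// mulrC ler_pdivrMr//.
pose t := z - x; have ex : x = z - t by rewrite /t; ring.
have : 0 <= t <= 1 by rewrite /t; lra.
rewrite ex; move: t {ex} => t /andP[t0 t1]; have := sqr_ge0 (z + t); have := sqr_ge0 z; have : t * t <= 1 by nra.
rewrite !expr2; lra.
Qed.

Definition dl f (x h : R) : R := f (x + h) - f x.

Lemma m2_dl f : measurable_fun setT f -> m2 (dl f).
Proof. by move=> mf; apply: m2B; [exact: m2_shift|exact: m2_fun1]. Qed.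

Lemma dl_bound f : qC 1 f -> exists2 C, 0 <= C &
  forall x h, 0 < h -> `|dl f x h| <= C * (mh h * qq x h).
Proof.
move=> [[C hC] [f' [df [cf' [D hD]]]]].
have C0 : 0 <= C.
  by have := le_trans (normr_ge0 _) (hC 0); rewrite pmulr_lge0 ?q_gt0.
have D0 : 0 <= D.
  by have := le_trans (normr_ge0 _) (hD 0); rewrite pmulr_lge0 ?q_gt0.
exists (C + 3 * D) => [|x h h0]; first by rewrite addr_ge0// mulr_ge0.
rewrite /mh; case: ifPn => h1.
  apply: (@le_trans _ _ (3 * D * q x * h)).
    apply: (mvt_abs (ltW h0) df) => z /andP[z1 z2].
    rewrite (le_trans (hD z))// (mulrC 3) -mulrA ler_wpM2l// q_near// z1/=.
    by rewrite (le_trans z2)// lerD2l.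
  have -> : (C + 3 * D) * (h * qq x h) = ((C + 3 * D) * qq x h) * h by ring.
  rewrite ler_wpM2r ?(ltW h0)//.
  by apply: ler_pM; rewrite ?mulr_ge0 ?q_ge0 ?lerDr// /qq lerDl q_ge0.
rewrite mul1r; apply: (@le_trans _ _ (C * qq x h)).
  by rewrite /dl /qq (addrC (q x)) mulrDr (le_trans (ler_normB _ _))// lerD.
by rewrite ler_wpM2r ?qq_ge0// lerDl mulr_ge0.
Qed.

Lemma dl2_bound f g : qC 1 f -> qC 1 g -> exists C,
  forall x h, 0 < h -> `|dl f x h * dl g x h| <= C * (mm h * qq x h).
Proof.
move=> /dl_bound[C C0 hC] /dl_bound[D D0 hD]; exists (2 * C * D) => x h h0.
rewrite normrM; apply: (le_trans (ler_pM (normr_ge0 _) (normr_ge0 _) (hC x h h0) (hD x h h0))).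
have -> : C * (mh h * qq x h) * (D * (mh h * qq x h)) = C * D * (mm h * qq x h) * qq x h.
  by rewrite -mh_sqr//; ring.
have -> : 2 * C * D * (mm h * qq x h) = C * D * (mm h * qq x h) * 2 by ring.
by rewrite ler_wpM2l ?qq_le2// !mulr_ge0 ?mm_ge0 ?qq_ge0.
Qed.

Lemma it2_dl2 a f g : 0 < a < 2 -> qC 1 f -> qC 1 g ->
  it2 (fun x h => K a h * (dl f x h * dl g x h)).
Proof.
move=> ha hf hg; have [C hC] := dl2_bound hf hg; apply: it2_form hC => //.
have mf := continuous_measurable_fun (qC_continuous hf).
have mg := continuous_measurable_fun (qC_continuous hg).
by apply: m2M; exact: m2_dl.
Qed.

(** A single translation mixes the frequencies [xi] and [- xi]; the sum of two opposite ones is a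
    true multiplier. *)
Lemma hart_two_shift f h xi : itg mu f ->
  hart (fun x => f (x + h) + f (x - h)) xi = 2 * cos (h * xi) * hart f xi.
Proof.
move=> hf; have hp := itg_shift h hf; have hm := itg_shift (- h) hf.
rewrite /hart -IZ; last exact: itg_hart.
under eq_Rintegral do rewrite mulrDl.
rewrite ID; [|exact: itg_hart|exact: itg_hart].
have k1 : itg mu (fun x => f x * cas ((x - h) * xi)).
  by apply: eq_itg (itg_shift (- h) (itg_hart xi hp)) => x; rewrite subrK.
have k2 : itg mu (fun x => f x * cas ((x + h) * xi)).
  by apply: eq_itg (itg_shift h (itg_hart xi hm)) => x; rewrite addrK.
have -> : \int[mu]_x (f (x + h) * cas (x * xi)) = \int[mu]_x (f x * cas ((x - h) * xi)).
  by rewrite -(I_shift h k1); apply: eqI => x; rewrite addrK.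
have -> : \int[mu]_x (f (x - h) * cas (x * xi)) = \int[mu]_x (f x * cas ((x + h) * xi)).
  by rewrite -(I_shift (- h) k2); apply: eqI => x; rewrite subrK.
rewrite -ID//; apply: eqI => x; rewrite -mulrDr mulrCA; congr (_ * _).
by rewrite /cas !mulrDl mulNr cosB cosD sinB sinD; ring.
Qed.

Lemma nice_two_shift f h : nice f -> nice (fun x => f (x + h) + f (x - h)).
Proof.
move=> [cf hf [M fM]]; split.
- have c k : continuous (fun x : R => f (x + k)).
    move=> x; apply: (@continuous_comp _ _ _ (fun x => x + k) f); last exact: cf.
    exact: (der_cont (derD (derid x) (derC x k))).
  by move=> x; apply: cvgD; exact: c.
- by apply: itgD; exact: itg_shift.
- exists (M + M) => x; exact: (le_trans (ler_normD _ _) (lerD (fM _) (fM _))).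
Qed.

(** After expanding, translation of a cross term leaves only the symmetric shift of [f], to which
    Parseval and [hart_two_shift] apply. *)
Lemma I_dl2 f g h : nice f -> nice g ->
  \int[mu]_x (dl f x h * dl g x h) =
  (2 * pi)^-1 * \int[mu]_xi (hart f xi * hart g xi * (2 * (1 - cos (h * xi)))).
Proof.
move=> nf ng; have [cf hf [M fM]] := nf; have [cg hg [N gN]] := ng.
have mf := continuous_measurable_fun cf; have mg := continuous_measurable_fun cg.
have ns := nice_two_shift h nf; have [cs hs _] := ns.
have tp : 2 * pi != 0 :> R by rewrite mulf_neq0// gt_eqF// pi_gt0.
have i1 : itg mu (fun x => f x * g x) by exact: itgMb hf mg gN.
have i2 : itg mu (fun x => (f (x + h) + f (x - h)) * g x) by exact: itgMb hs mg gN.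
have i3 : itg mu (fun x => f (x + h) * g (x + h)) by exact: (itg_shift h i1).
have i4 : itg mu (fun x => f (x + h) * g x) by exact: itgMb (itg_shift h hf) mg gN.
have i5 : itg mu (fun x => f (x - h) * g x) by exact: itgMb (itg_shift (- h) hf) mg gN.
have i6 : itg mu (fun x => f x * g (x + h)).
  by apply: eq_itg (itg_shift h i5) => x; rewrite addrK.
have -> : \int[mu]_x (dl f x h * dl g x h) =
    2 * \int[mu]_x (f x * g x) - \int[mu]_x ((f (x + h) + f (x - h)) * g x).
  transitivity (\int[mu]_x ((f (x + h) * g (x + h) - f (x + h) * g x) + (f x * g x - f x * g (x + h)))).
    by apply: eqI => x; rewrite /dl; ring.
  rewrite (ID (itgB i3 i4) (itgB i1 i6)) (IB i3 i4) (IB i1 i6).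
  rewrite (I_shift h i1).
  have -> : \int[mu]_x (f x * g (x + h)) = \int[mu]_x (f (x - h) * g x).
    by rewrite -(I_shift h i5); apply: eqI => x; rewrite addrK.
  have -> : \int[mu]_x ((f (x + h) + f (x - h)) * g x) =
      \int[mu]_x (f (x + h) * g x) + \int[mu]_x (f (x - h) * g x).
    by rewrite -ID//; apply: eqI => x; rewrite mulrDl.
  ring.
apply: (mulfI tp); rewrite mulrBr mulrCA -!(parseval _ ng)// mulrA mulfV// mul1r.
rewrite -IZ; last exact: itg_hartM.
rewrite -IB; [|exact/itgZ/itg_hartM|exact: itg_hartM].
by apply: eqI => xi; rewrite hart_two_shift//; ring.
Qed.

(** Fubini brings the [h]-integral inside, where [kk_scale] turns it into [kk a * |xi|^a]. *)
Lemma J_form a f g : 0 < a < 2 -> qC 1 f -> qC 1 g ->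
  itg mu (fun xi => `|xi| `^ a * (hart f xi * hart g xi)) ->
  J (fun x h => K a h * (dl f x h * dl g x h)) =
  2 * kk a * (2 * pi)^-1 * \int[mu]_xi (`|xi| `^ a * (hart f xi * hart g xi)).
Proof.
move=> ha hf hg hi; have nf := qC_nice hf; have ng := qC_nice hg.
have iH := itg_hartM nf ng; have mH := itg_measurable iH.
rewrite J21; last exact: it2_dl2.
pose F (xi h : R) := hart f xi * hart g xi * (K a h * (1 - cos (h * xi))).
have mF : m2 F.
  apply: m2M; first exact: (m2_fun1 mH).
  apply: m2M; first exact: (m2_fun2 (measurable_K a)).
  apply: m2B; first exact: measurable_cst.
  apply: (measurableT_comp (continuous_measurable_fun (@continuous_cos R))).
  exact: measurable_funM.
have iF : it2 F.
  apply: (@it2_crit _ (fun xi => kk a * `| `|xi| `^ a * (hart f xi * hart g xi)|)) => //.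
  - exact/itgZ/itg_abs.
  - by move=> xi; apply: itgZ; exact: itg_Kcos.
  - move=> xi; rewrite le_eqVlt; apply/orP; left; apply/eqP.
    transitivity (\int[mu]_h (`|hart f xi * hart g xi| * (K a h * (1 - cos (h * xi))))).
      apply: eqI => h; rewrite /F normrM; congr (_ * _).
      by rewrite ger0_norm// mulr_ge0 ?K_ge0// subr_ge0 cos_le1.
    rewrite IZ; last exact: itg_Kcos.
    by rewrite kk_scale// (normrM (`|xi| `^ a)) (ger0_norm (powR_ge0 `|xi| a)); ring.
transitivity (\int[mu]_h (2 * (2 * pi)^-1 * \int[mu]_xi (F xi h))).
  apply: eqI => h.
  have hd : itg mu (fun x => dl f x h * dl g x h).
    have [cf jf [M fM]] := nf; have [cg jg [N gN]] := ng.
    apply: (itgMb (r := N + N)).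
    - by apply: itgB => //; exact: itg_shift.
    - apply: measurable_funB; last exact: continuous_measurable_fun.
      by apply: itg_measurable; exact: itg_shift.
    - by move=> x; exact: (le_trans (ler_normB _ _) (lerD (gN _) (gN _))).
  have mc : measurable_fun setT (fun xi : R => cos (h * xi)).
    by apply: (measurableT_comp (continuous_measurable_fun (@continuous_cos R))); apply: measurable_funM.
  have hb : itg mu (fun xi => hart f xi * hart g xi * (1 - cos (h * xi))).
    apply: (itgMb (r := 2) iH); first exact: measurable_funB.
    move=> xi; have := abs_cos (h * xi); rewrite ler_norml => /andP[c1 c2].
    by rewrite ger0_norm; lra.
  rewrite IZ// I_dl2//.
  have -> : \int[mu]_xi (hart f xi * hart g xi * (2 * (1 - cos (h * xi)))) =
      2 * \int[mu]_xi (hart f xi * hart g xi * (1 - cos (h * xi))).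
    by rewrite -IZ//; apply: eqI => xi; ring.
  have -> : \int[mu]_xi (F xi h) =
      K a h * \int[mu]_xi (hart f xi * hart g xi * (1 - cos (h * xi))).
    by rewrite -IZ//; apply: eqI => xi; rewrite /F; ring.
  ring.
rewrite IZ; last exact: it2_itg2.
rewrite -J21// J12//.
have -> : \int[mu]_x \int[mu]_y F x y = kk a * \int[mu]_xi (`|xi| `^ a * (hart f xi * hart g xi)).
  rewrite -IZ//; apply: eqI => xi; rewrite /F IZ; last exact: itg_Kcos.
  by rewrite kk_scale//; ring.
ring.
Qed.

End form_identity.

(** * Pairings with the fractional derivatives *)

Section absD_form.
Context (R : realType).
Notation mu := (@lebesgue_measure R).
Implicit Types (f g u : R -> R) (a : R).

Lemma hart_swap f g : itg mu f -> itg mu g ->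
  \int[mu]_x (hart f x * g x) = \int[mu]_x (f x * hart g x).
Proof.
move=> hf hg.
pose F (y x : R) := f y * g x * cas (y * x).
have iF : it2 F.
  apply: (it2_dom (it2Z 2 (it2_tensor (itg_abs hf) (itg_abs hg)))).
    apply: m2M; first exact: itg_measurable (it2_tensor hf hg).
    by apply: (measurableT_comp (@measurable_cas R)); apply: measurable_funM.
  by move=> y x; rewrite /F !normrM mulrC ler_wpM2r ?abs_cas// mulr_ge0.
transitivity (J F).
  rewrite J21//; apply: eqI => x; rewrite /hart -IZr; last exact: itg_hart.
  by apply: eqI => y; rewrite /F mulrAC.
rewrite J12//; apply: eqI => y; rewrite /hart -IZ; last exact: itg_hart.
by apply: eqI => x; rewrite /F mulrA (mulrC y).
Qed.

Lemma pi_neq0 : pi != 0 :> R.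
Proof. by rewrite gt_eqF// pi_gt0. Qed.

Section absD_basic.
Variables (k : nat) (s : R) (f : R -> R).
Hypotheses (hs : 0 < s < 2 * k%:R - 1) (hf : qC k.*2 f).

Let iH : itg mu (absH s f).
Proof. by apply: itg_absH hf; move: hs => /andP[/ltW -> ->]. Qed.

Lemma absD_hartE : absD s f = (fun x => (2 * pi)^-1 * hart (absH s f) x).
Proof. by apply/funext => x; rewrite absD_hart//; exact: qC_itg hf. Qed.

Lemma continuous_absD : continuous (absD s f).
Proof. by rewrite absD_hartE => x; apply: cvgMr; exact: continuous_hart. Qed.

Lemma absD_bounded : exists M, forall x, `|absD s f x| <= M.
Proof.
exists (`|(2 * pi)^-1| * (2 * \int[mu]_x `|absH s f x|)) => x.
by rewrite absD_hartE normrM ler_wpM2l// abs_hart.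
Qed.

Lemma itg_absD2 : itg mu (fun x => absD s f x * absD s f x).
Proof.
apply: eq_itg (itgZ ((2 * pi)^-1 ^+ 2) (itg_hart2 (nice_absH hs hf))) => x.
by rewrite absD_hartE expr2; ring.
Qed.

Lemma itg_absDM g : itg mu g -> itg mu (fun x => absD s f x * g x).
Proof.
move=> hg; have [M hM] := absD_bounded.
have h := itgMb hg (continuous_measurable_fun continuous_absD) hM.
by apply: eq_itg h => x; rewrite mulrC.
Qed.
End absD_basic.

(** The whole multiplier sits on [u], and four derivatives make it integrable since [a < 3]. One
    derivative of [f] is enough, so [f] may contain [u'] and the cut-off. *)
Lemma absD_pairing a u f : 0 < a < 2 -> qC 4 u -> qC 1 f ->
  \int[mu]_x (absD a u x * f x) =
  (2 * kk a)^-1 * J (fun x h => K a h * (dl u x h * dl f x h)).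
Proof.
move=> ha hu hf; have [a0 a2] := andP ha.
have hs : 0 < a < 2 * 2%:R - 1 by rewrite a0/=; lra.
have hu1 : qC 1 u by do 3 apply: qCW.
have iH : itg mu (absH a u) by apply: (itg_absH (k := 2)) => //; rewrite ltW//=; lra.
have iq := qC_itg hf.
have [M hM] : exists M, forall xi, `|hart f xi| <= M.
  by exists (2 * \int[mu]_x `|f x|) => xi; exact: abs_hart.
have iHH : itg mu (fun xi => absH a u xi * hart f xi).
  exact: (itgMb iH (measurable_hart iq) hM).
have e : (fun xi => absH a u xi * hart f xi) = (fun xi => `|xi| `^ a * (hart u xi * hart f xi)).
  by apply/funext => xi; rewrite /absH mulrA.
rewrite (J_form ha hu1 hf) -?e//.
rewrite (absD_hartE (k := 2) hs hu) -(hart_swap iH iq).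
have ik : itg mu (fun x => hart (absH a u) x * f x).
  have [N hN] : exists M, forall xi, `|hart (absH a u) xi| <= M.
    by exists (2 * \int[mu]_x `|absH a u x|) => xi; exact: abs_hart.
  by apply: eq_itg (itgMb iq (measurable_hart iH) hN) => x; rewrite mulrC.
under eq_Rintegral do rewrite -mulrA.
rewrite IZ//; set X := \int[mu]_x _; have := pi_neq0; have := kk_gt0 ha.
move: (kk a) (pi : R) X => k p X /gt_eqF/negbT k0 p0.
by field; rewrite k0 p0.
Qed.

(** The multiplier is split evenly; as [a / 2 < 1], two derivatives on each side make both halves
    nice, so Parseval applies to them. *)
Lemma absD_half_pairing a f g : 0 < a < 2 -> qC 2 f -> qC 2 g ->
  itg mu (fun x => absD (a / 2) f x * absD (a / 2) g x) /\
  \int[mu]_x (absD (a / 2) f x * absD (a / 2) g x) =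
  (2 * kk a)^-1 * J (fun x h => K a h * (dl f x h * dl g x h)).
Proof.
move=> ha hf hg; have [a0 a2] := andP ha.
have hs : 0 < a / 2 < 2 * 1%:R - 1 by lra.
have nf := nice_absH (k := 1) hs hf; have ng := nice_absH (k := 1) hs hg.
have ip : itg mu (fun xi => absH (a / 2) f xi * absH (a / 2) g xi).
  have [_ h [M hM]] := nf; have [c _ [N hN]] := ng.
  exact: (itgMb h (continuous_measurable_fun c) hN).
have e : (fun xi => absH (a / 2) f xi * absH (a / 2) g xi) =
    (fun xi => `|xi| `^ a * (hart f xi * hart g xi)).
  apply/funext => xi; have -> : `|xi| `^ a = `|xi| `^ (a / 2) * `|xi| `^ (a / 2).
    rewrite -powRD; first by congr (_ `^ _); field.
    apply/implyP => /eqP; lra.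
  by rewrite /absH; ring.
rewrite (absD_hartE (k := 1) hs hf) (absD_hartE (k := 1) hs hg).
have e2 : (fun x => (2 * pi)^-1 * hart (absH (a / 2) f) x * ((2 * pi)^-1 * hart (absH (a / 2) g) x)) =
   (fun x => (2 * pi)^-1 ^+ 2 * (hart (absH (a / 2) f) x * hart (absH (a / 2) g) x)).
  by apply/funext => x; rewrite mulrACA expr2.
rewrite e2; have ih := itg_hartM nf ng; split; first exact: itgZ.
rewrite IZ// parseval// (J_form ha (qCW hf) (qCW hg)) -?e//.
set X := \int[mu]_x _; have := pi_neq0; have := kk_gt0 ha.
move: (kk a) (pi : R) X => k p X /gt_eqF/negbT k0 p0.
by field; rewrite k0 p0.
Qed.

End absD_form.

(** * The flow identity *)

Section flow.
Context (R : realType).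
Notation mu := (@lebesgue_measure R).
Implicit Types (f g u v : R -> R) (a : R) (G : R -> R -> R).

Definition Bd G := exists C, forall x h, 0 < h -> `|G x h| <= C * (mm h * qq x h).

Lemma Bd_it2 a G : 0 < a < 2 -> m2 G -> Bd G -> it2 (fun x h => K a h * G x h).
Proof. by move=> ha mG [C hC]; exact: it2_form hC. Qed.

Lemma BdD F G : Bd F -> Bd G -> Bd (fun x h => F x h + G x h).
Proof.
move=> [C hC] [D hD]; exists (C + D) => x h h0.
by rewrite mulrDl (le_trans (ler_normD _ _))// lerD ?hC ?hD.
Qed.

Lemma BdM M F G : Bd F -> (forall x h, 0 < h -> `|G x h| <= M) ->
  Bd (fun x h => F x h * G x h).
Proof.
move=> [C hC] hM; exists (C * M) => x h h0.
by rewrite normrM mulrAC ler_pM ?hC ?hM.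
Qed.

Lemma eq_Bd F G : (forall x h, 0 < h -> F x h = G x h) -> Bd G -> Bd F.
Proof. by move=> e [C hC]; exists C => x h h0; rewrite e// hC. Qed.

Lemma Bd_dl2 f g : qC 1 f -> qC 1 g -> Bd (fun x h => dl f x h * dl g x h).
Proof. by move=> hf hg; exact: dl2_bound. Qed.

Lemma dl_bound_b f : bC 1 f -> exists2 C, 0 <= C &
  forall x h, 0 < h -> `|dl f x h| <= C * mh h.
Proof.
move=> [[C hC] [f' [df [cf' [D hD]]]]].
have C0 : 0 <= C by exact: le_trans (hC 0).
have D0 : 0 <= D by exact: le_trans (hD 0).
exists (C + C + D) => [|x h h0]; first by rewrite !addr_ge0.
rewrite /mh; case: ifPn => h1.
  apply: (@le_trans _ _ (D * h)).
    by apply: (mvt_abs (ltW h0) df) => z _.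
  by rewrite ler_wpM2r ?(ltW h0)// lerDr addr_ge0.
by rewrite mulr1 (le_trans (ler_normB _ _))// (le_trans (lerD (hC _) (hC _)))// lerDl.
Qed.

Lemma qC_bC k f : qC k f -> bC k f.
Proof.
elim: k f => [f [cf qf]|k ih f [qf [f' [df hf]]]].
  by split => //; exact: qd_bounded.
by split; [exact: qd_bounded|exists f'; split => //; exact: ih].
Qed.

(** The cut-off is bounded without decay, so all the decay must come from the factor at [x + h]; the
    majorant [qq] contains [q (x + h)] and absorbs it. *)
Lemma Bd_dl2_tail f g w : bC 1 f -> bC 1 g -> qd w ->
  Bd (fun x h => dl f x h * dl g x h * w (x + h)).
Proof.
move=> /dl_bound_b[C C0 hC] /dl_bound_b[D D0 hD] [E hE].
exists (C * D * `|E|) => x h h0; rewrite !normrM.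
have -> : C * D * `|E| * (mm h * qq x h) = (C * mh h) * (D * mh h) * (`|E| * qq x h).
  by rewrite -mh_sqr//; ring.
have m0 := mh_ge0 h0.
apply: ler_pM; rewrite ?mulr_ge0//.
  by apply: ler_pM; rewrite ?hC ?hD.
apply: (le_trans (hE _)); apply: (@le_trans _ _ (`|E| * q (x + h))).
  by rewrite ler_wpM2r ?q_ge0// ler_norm.
by rewrite ler_wpM2l// /qq lerDr q_ge0.
Qed.

Lemma q_shift (x h : R) : q (x + h) <= (2 + 2 * h ^+ 2) * q x.
Proof.
have p1 := q_gt0 x; have p2 := q_gt0 (x + h).
rewrite !invr_gt0 in p1 p2.
rewrite /q ler_pdivlMr// mulrC ler_pdivrMr//.
have h1 := sqr_ge0 (x + 2 * h); have h2 := sqr_ge0 h; have h3 := sqr_ge0 (x + h).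
have h4 : 0 <= h ^+ 2 * (x + h) ^+ 2 by rewrite mulr_ge0.
rewrite !expr2 in h1 h2 h3 h4 *; lra.
Qed.

Lemma qd_shift f h : qd f -> qd (fun x => f (x + h)).
Proof.
move=> [C hC]; exists (`|C| * (2 + 2 * h ^+ 2)) => x.
apply: (le_trans (hC _)); apply: (@le_trans _ _ (`|C| * q (x + h))).
  by rewrite ler_wpM2r ?q_ge0// ler_norm.
by rewrite -mulrA ler_wpM2l// q_shift.
Qed.

Lemma der_shift f (x c d : R) : is_derive (x + c) 1 f d ->
  is_derive x 1 (fun y => f (y + c)) d.
Proof.
move=> h; apply: der_eq (der_comp (derD (derid x) (derC x c)) h) _.
by rewrite addr0 mulr1.
Qed.

Lemma der_shiftl f (x c d : R) : is_derive (c + x) 1 f d ->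
  is_derive x 1 (fun y => f (c + y)) d.
Proof.
move=> h; apply: der_eq (der_comp (derD (derC x c) (derid x)) h) _.
by rewrite add0r mulr1.
Qed.

Lemma measurable_inv : measurable_fun setT (fun h : R => h^-1).
Proof.
have -> : (fun h : R => h^-1) = (fun h => pos h * h `^ (-1) - pos (- h) * (- h) `^ (-1)).
  apply/funext => h; rewrite /pos oppr_gt0.
  have [h0|h0|->] := ltgtP h 0.
  - by rewrite mul0r sub0r mul1r powR_inv1 ?oppr_ge0 ?(ltW h0)// invrN opprK.
  - by rewrite mul0r subr0 mul1r powR_inv1 ?(ltW h0).
  - by rewrite !mul0r subr0 invr0.
apply: measurable_funB; apply: measurable_funM.
- exact: measurable_pos.
- exact: measurable_powR.
- by apply: (measurableT_comp (@measurable_pos R)); exact: measurable_funN.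
- by apply: (measurableT_comp (measurable_powR (-1))); exact: measurable_funN.
Qed.

Section flow_identity.
Variables (a : R) (u v u1 v1 phi w : R -> R).
Hypotheses (ha : 0 < a < 2).
Hypotheses (du : forall x : R, is_derive x 1 u (u1 x)) (qu : qd u) (qu1 : qC 1 u1).
Hypotheses (dv : forall x : R, is_derive x 1 v (v1 x)) (qv : qd v) (qv1 : qC 1 v1).
Hypotheses (dphi : forall x : R, is_derive x 1 phi (- w x)) (cw : continuous w).
Variables (Mphi Mw : R).
Hypotheses (bphi : forall x, `|phi x| <= Mphi) (bw : forall x, `|w x| <= Mw).

Let hu : qC 1 u. Proof. by split => //; exists u1; split => //; exact: qCW. Qed.
Let hv : qC 1 v. Proof. by split => //; exists v1; split => //; exact: qCW. Qed.
Let hphi : bC 1 phi.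
Proof.
split; first by exists Mphi.
exists (fun x => - w x); split => //; split; first by move=> x; apply: cvgN; exact: cw.
by exists Mw => x; rewrite normrN.
Qed.
Let mu_ : measurable_fun setT u.
Proof. exact: continuous_measurable_fun (qC_continuous hu). Qed.
Let mv_ : measurable_fun setT v.
Proof. exact: continuous_measurable_fun (qC_continuous hv). Qed.
Let mu1 : measurable_fun setT u1.
Proof. exact: continuous_measurable_fun (qC_continuous qu1). Qed.
Let mv1 : measurable_fun setT v1.
Proof. exact: continuous_measurable_fun (qC_continuous qv1). Qed.
Let mphi : measurable_fun setT phi.
Proof. exact: continuous_measurable_fun (bC_continuous hphi). Qed.
Let mw : measurable_fun setT w.
Proof. exact: continuous_measurable_fun cw. Qed.

(** Since the derivative of [phi] is [- w], this is the mean of [w] over [[x, x + h]]; hence the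
    order of the difference. *)
Definition mean_slope (phi : R -> R) (x h : R) := (phi x - phi (x + h)) / h.

Let Q x h := dl u x h * dl v x h.
(** [A] is the [x]-derivative of [phi x * Q x h], and [K a h * B x h] is the [h]-derivative of
    [K a h * (dl phi x h * Q x h)] for [h > 0]; the term with [mean_slope] comes from
    differentiating the kernel. *)
Let A x h := - w x * Q x h + phi x * (dl u1 x h * dl v x h + dl u x h * dl v1 x h).
Let B x h := - w (x + h) * Q x h
  + dl phi x h * (u1 (x + h) * dl v x h + dl u x h * v1 (x + h))
  + (1 + a) * (mean_slope phi x h * Q x h).

Lemma m2_mean_slope : m2 (mean_slope phi).
Proof.
apply: m2M.
  by apply: m2B; [exact: m2_fun1|exact: m2_shift].
apply: m2_fun2.
exact: measurable_inv.
Qed.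

Lemma abs_mean_slope (x h : R) : 0 < h -> `|mean_slope phi x h| <= Mw.
Proof.
move=> h0; rewrite /mean_slope normrM normfV (gtr0_norm h0) ler_pdivrMr//.
rewrite distrC; apply: (mvt_abs (ltW h0) dphi) => z _; by rewrite normrN.
Qed.

Let mQ : m2 Q. Proof. by apply: m2M; exact: m2_dl. Qed.
Let bQ : Bd Q. Proof. exact: Bd_dl2. Qed.

Let mA : m2 A.
Proof.
apply: m2D; first by apply: m2M => //; apply: m2_fun1; exact: measurable_funN.
apply: m2M; first exact: m2_fun1.
by apply: m2D; apply: m2M; exact: m2_dl.
Qed.

Let bA : Bd A.
Proof.
apply: BdD.
  apply: (@eq_Bd _ (fun x h => Q x h * - w x)) => [x h _|]; first by rewrite mulrC.
  by apply: (BdM (M := Mw) bQ) => x h _; rewrite normrN.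
apply: (@eq_Bd _ (fun x h => (dl u1 x h * dl v x h + dl u x h * dl v1 x h) * phi x)) => [x h _|].
  by rewrite mulrC.
by apply: (BdM (M := Mphi)) => //; apply: BdD; exact: Bd_dl2.
Qed.

Let mB : m2 B.
Proof.
apply: m2D; last first.
  apply: m2M; first by apply: m2_fun1.
  by apply: m2M => //; exact: m2_mean_slope.
apply: m2D.
  by apply: m2M => //; apply: (m2_shift (f := fun x => - w x)); exact: measurable_funN.
apply: m2M; first exact: m2_dl.
apply: m2D; apply: m2M; by [exact: m2_dl|exact: m2_shift].
Qed.

Let bB : Bd B.
Proof.
apply: BdD; last first.
  apply: (@eq_Bd _ (fun x h => Q x h * ((1 + a) * mean_slope phi x h))) => [x h _|]; first by ring.
  apply: (BdM (M := `|1 + a| * Mw) bQ) => x h h0.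
  by rewrite normrM ler_wpM2l// abs_mean_slope.
apply: BdD.
  apply: (@eq_Bd _ (fun x h => Q x h * - w (x + h))) => [x h _|]; first by rewrite mulrC.
  by apply: (BdM (M := Mw) bQ) => x h _; rewrite normrN.
apply: (@eq_Bd _ (fun x h => dl phi x h * dl v x h * u1 (x + h) + dl phi x h * dl u x h * v1 (x + h))) => [x h _|]; first by ring.
by apply: BdD; apply: Bd_dl2_tail => //; [exact: qC_bC|exact: qC_qd qu1|exact: qC_bC|exact: qC_qd qv1].
Qed.

Let JA0 : J (fun x h => K a h * A x h) = 0.
Proof.
have iA := Bd_it2 ha mA bA.
rewrite J21// -[RHS](@I0 _ _ _ mu); apply: eqI => h.
have cd f : continuous f -> continuous (fun x => dl f x h).
  move=> cf x; apply: cvgB; last exact: cf.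
  apply: (@continuous_comp _ _ _ (fun x => x + h) f); last exact: cf.
  exact: (der_cont (derD (derid x) (derC x h))).
have qdl f : qd f -> qd (fun x => dl f x h).
  move=> qf; have [C hC] := qd_shift h qf; have [D hD] := qf; exists (C + D) => x.
  by rewrite mulrDl (le_trans (ler_normB _ _))// lerD.
have ddl f f' (x : R) : (forall y : R, is_derive y 1 f (f' y)) -> is_derive x 1 (fun x => dl f x h) (dl f' x h).
  by move=> df; exact: (derB (der_shift (df (x + h))) (df x)).
have du_ := cd _ (qC_continuous hu); have dv_ := cd _ (qC_continuous hv).
have du1 := cd _ (qC_continuous qu1); have dv1 := cd _ (qC_continuous qv1).
have cA : continuous (A ^~ h).
  move=> x; apply: cvgD.
    apply: cvgM; first by apply: cvgN; exact: cw.
    by apply: cvgM; [exact: du_|exact: dv_].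
  apply: cvgM; first exact: (der_cont (dphi x)).
  by apply: cvgD; apply: cvgM; by [exact: du_|exact: dv_|exact: du1|exact: dv1].
have qA : qd (A ^~ h).
  have bb f : qd f -> exists M, forall x, `|f x| <= M by exact: qd_bounded.
  have [N1 hN1] := bb _ (qdl _ qv).
  have [N2 hN2] := bb _ (qdl _ (qC_qd qv1)).
  apply: qdD.
    have [C hC] := qdM (qdM (qdl _ qu) hN1) bw.
    by exists C => x; rewrite mulNr normrN mulrC hC.
  have [C hC] := qdM (qdD (qdM (qdl _ (qC_qd qu1)) hN1) (qdM (qdl _ qu) hN2)) bphi.
  by exists C => x; rewrite mulrC hC.
have iA_h : itg mu (A ^~ h) by apply: qd_itg => //; exact: continuous_measurable_fun.
have dA (x : R) : is_derive x 1 (fun x => phi x * (dl u x h * dl v x h)) (A x h).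
  by apply: der_eq (derM (dphi x) (derM (ddl _ _ x du) (ddl _ _ x dv))) _.
rewrite IZ// (I_derive dA cA _ iA_h) ?mulr0//.
have [N1 hN1] := qd_bounded (qdl _ qv).
have [C hC] := qdM (qdM (qdl _ qu) hN1) bphi.
by exists C => x; rewrite mulrC hC.
Qed.

Let JB0 : J (fun x h => K a h * B x h) = 0.
Proof.
have [a0 a2] := andP ha.
have iB := Bd_it2 ha mB bB.
rewrite J12// -[RHS](@I0 _ _ _ mu); apply: eqI => x.
have [C hC] := bB.
have iBx : itg mu (fun h => K a h * B x h).
  apply: (itg_dom (itgZ (`|C| * 2) (itg_Kmm ha))).
    by apply: measurable_funM; [exact: measurable_K|exact: m2_snd].
  move=> h; have [h0|h0] := ltP 0 h; last by rewrite K_npos// !mul0r mulr0 normr0.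
  rewrite normrM (ger0_norm (K_ge0 a h)) mulrCA ler_wpM2l ?K_ge0//.
  apply: (le_trans (hC x h h0)); apply: (@le_trans _ _ (`|C| * (mm h * qq x h))).
    by rewrite ler_wpM2r ?mulr_ge0 ?mm_ge0 ?qq_ge0// ler_norm.
  by rewrite -mulrA ler_wpM2l// mulrC ler_wpM2r ?mm_ge0// qq_le2.
pose F h := h `^ (- (1 + a)) * (dl phi x h * Q x h).
pose f h := h `^ (- (1 + a)) * B x h.
have e h : K a h * B x h = pos h * f h by rewrite /K /f mulrA.
rewrite (_ : \int[mu]_h (K a h * B x h) = \int[mu]_h (pos h * f h)); last exact: eqI.
have [D D0 hD] := dl_bound_b hphi.
have [E hE] := bQ.
have FF h : 0 < h -> `|F h| <= h `^ (- (1 + a)) * (D * mh h * (`|E| * mm h * 2)).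
  move=> h0; rewrite normrM (ger0_norm (powR_ge0 _ _)) ler_wpM2l ?powR_ge0//.
  rewrite normrM ler_pM ?hD// (le_trans (hE x h h0))//.
  apply: (@le_trans _ _ (`|E| * (mm h * qq x h))).
    by rewrite ler_wpM2r ?mulr_ge0 ?mm_ge0 ?qq_ge0// ler_norm.
  by rewrite -mulrA ler_wpM2l// ler_wpM2l ?mm_ge0// qq_le2.
have ddl g g' (h : R) : (forall y : R, is_derive y 1 g (g' y)) -> is_derive h 1 (fun h => dl g x h) (g' (x + h)).
  by move=> dg; apply: der_eq (derB (der_shiftl (dg (x + h))) (derC h (g x))) _; rewrite subr0.
have dF (h : R) : 0 < h -> is_derive h 1 F (f h).
  move=> h0; apply: der_eq (derM (is_derive1_powR (- (1 + a)) h0) (derM (ddl _ _ h dphi) (derM (ddl _ _ h du) (ddl _ _ h dv)))) _.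
  rewrite powRB; last by rewrite (gt_eqF h0) implybT.
  rewrite powRr1 ?(ltW h0)// /f /B /Q /mean_slope.
  have -> : phi x - phi (x + h) = - dl phi x h by rewrite /dl opprB.
  have hn : h != 0 by rewrite gt_eqF.
  by field.
(* Both boundary terms vanish: [F] is [O(h^(2-a))] at zero, one power of [h] coming from each of the
   three differences, and [O(1/h)] at infinity. *)
rewrite (ftc_pos dF (l0 := 0) (l1 := 0)) ?subr0//.
- move=> h h0; apply: cvgM; first exact: cont_powR.
  have c1 g : continuous g -> {for h, continuous (fun h => g (x + h))}.
    move=> cg; apply: (@continuous_comp _ _ _ (fun h => x + h) g); last exact: cg.
    exact: (der_cont (derD (derC h x) (derid h))).
  have c2 g : continuous g -> {for h, continuous (fun h => dl g x h)}.
    by move=> cg; apply: cvgB; [exact: c1|exact: cvg_cst].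
  have cphi := bC_continuous hphi.
  have cu := qC_continuous hu; have cv := qC_continuous hv.
  have cu1 := qC_continuous qu1; have cv1 := qC_continuous qv1.
  have cQ : {for h, continuous (Q x)} by apply: cvgM; exact: c2.
  apply: cvgD; first apply: cvgD.
  + apply: cvgM; last exact: cQ.
    by apply: cvgN; exact: c1.
  + apply: cvgM; first exact: c2.
    by apply: cvgD; apply: cvgM; by [exact: c1|exact: c2].
  + apply: cvgM; first exact: cvg_cst.
    apply: cvgM; last exact: cQ.
    apply: cvgM; last by apply: cvgV; [rewrite gt_eqF|exact: cvg_id].
    by apply: cvgB; [exact: cvg_cst|exact: c1].
- by apply: eq_itg iBx => h; rewrite e.
- have a20 : 0 < 2 - a by lra.
  have lim : (fun n => D * (`|E| * 2) * `| n.+2%:R^-1 | `^ (2 - a)) @ \oo --> (0 : R).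
    rewrite -(mulr0 (D * (`|E| * 2))); apply: cvgMr.
    have := @continuous_abs_powR R _ a20 0; rewrite /continuous_at normr0 powR0 ?gt_eqF// => c.
    exact: (cvg_comp _ _ (@cvg_inv2 R) c).
  apply: (cvg0_dom lim) => n.
  have h0 : 0 < n.+2%:R^-1 :> R by rewrite invr_gt0.
  have h1 : n.+2%:R^-1 <= 1 :> R by rewrite invf_le1// ler1n.
  apply: (le_trans (FF _ h0)).
  move: (n.+2%:R^-1) h0 h1 => h h0 h1.
  rewrite (gtr0_norm h0) /mh h1 -mh_sqr// /mh h1.
  have -> : h `^ (2 - a) = h `^ (- (1 + a)) * h ^+ 3.
    rewrite -powR_mulrn ?(ltW h0)// -powRD ?(gt_eqF h0) ?implybT//.
    by congr (_ `^ _); ring.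
  by rewrite le_eqVlt; apply/orP; left; apply/eqP; ring.
- have lim : (fun n => D * (`|E| * 2) * n.+2%:R^-1) @ \oo --> (0 : R).
    by rewrite -(mulr0 (D * (`|E| * 2))); apply: cvgMr; exact: cvg_inv2.
  apply: (cvg0_dom lim) => n.
  have h0 : 0 < n.+2%:R :> R by [].
  apply: (le_trans (FF _ h0)); rewrite mulrC.
  apply: ler_pM; rewrite ?powR_ge0//.
  + by rewrite !mulr_ge0 ?mh_ge0 ?mm_ge0.
  + rewrite -[leLHS]mulrA ler_wpM2l//.
    have m1 : mh (n.+2%:R : R) <= 1 by rewrite /mh; case: ifP.
    have m2 := mm_le1 (n.+2%:R : R); have m3 := mm_ge0 (n.+2%:R : R); have m4 := mh_ge0 h0.
    have e0 : 0 <= `|E| by [].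
    apply: (@le_trans _ _ (1 * (`|E| * 1 * 2))); last by rewrite mul1r mulr1.
    apply: ler_pM => //; first by rewrite !mulr_ge0.
    by rewrite ler_wpM2r// ler_wpM2l.
  + rewrite powRN lef_pV2 ?posrE ?powR_gt0//.
    by apply: le1r_powR; [rewrite ler1n|lra].
Qed.

(** Pointwise the left integrand is the right one plus [K * A] and [K * B]. These two have zero
    double integral, the first on integrating in [x], the second on integrating in [h], so no
    derivative of [u] or [v] survives. *)
Lemma flow_identity :
  J (fun x h => K a h * (dl u x h * dl (fun y => v1 y * phi y) x h
                       + dl v x h * dl (fun y => u1 y * phi y) x h)) =
  J (fun x h => K a h * (dl u x h * dl v x h *
    (w x + w (x + h) - (1 + a) * mean_slope phi x h))).
Proof.
pose T x h := Q x h * (w x + w (x + h) - (1 + a) * mean_slope phi x h).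
have mT : m2 T.
  apply: m2M => //; apply: m2B.
    by apply: m2D; [exact: m2_fun1|exact: m2_shift].
  by apply: m2M; [exact: m2_fun1|exact: m2_mean_slope].
have bT : Bd T.
  apply: (BdM (M := Mw + Mw + `|1 + a| * Mw) bQ) => x h h0.
  apply: (le_trans (ler_normB _ _)); apply: lerD.
    by apply: (le_trans (ler_normD _ _)); apply: lerD.
  by rewrite normrM ler_wpM2l// abs_mean_slope.
have iA := Bd_it2 ha mA bA; have iB := Bd_it2 ha mB bB; have iT := Bd_it2 ha mT bT.
transitivity (J (fun x h => (K a h * A x h + K a h * B x h) + K a h * T x h)).
  apply: eqJ => x h; rewrite -!mulrDr; congr (_ * _).
  by rewrite /A /B /T /Q /dl; ring.
by rewrite JD//; [rewrite JD// JA0 JB0 !add0r|exact: it2D].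
Qed.

End flow_identity.
End flow.

(** * The weight *)

Lemma le_powR (R : realType) (p x y : R) : 0 <= p -> 0 <= x -> x <= y ->
  x `^ p <= y `^ p.
Proof.
move=> p0 x0 xy; apply: ge0_ler_powR => //; rewrite nnegrE//.
exact: le_trans xy.
Qed.

Lemma derV (R : realType) (f : R -> R) (x a : R) : f x != 0 ->
  is_derive x 1 f a -> is_derive x 1 (fun y => (f y)^-1) (- (f x) ^- 2 * a).
Proof.
by move=> f0 [df <-]; apply: DeriveDef; [exact: derivableV|rewrite deriveV].
Qed.

Lemma is_derive_q (R : realType) (z : R) :
  is_derive z 1 (@q R) (- (2 * z) * q z ^+ 2).
Proof.
have h : 1 + z ^+ 2 != 0 by rewrite gt_eqF// ltr_pwDl// sqr_ge0.
have d1 := derD (derC z 1) (der_sqr (derid z)).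
have d2 : is_derive z 1 (@q R) _ := @derV R (fun y => 1 + y ^+ 2) z _ h d1.
by apply: der_eq d2 _; rewrite /q; field.
Qed.

Section weight.
Context (R : realType).
Notation mu := (@lebesgue_measure R).
Variables (a A m : R).
Hypotheses (ha : 0 < a < 2) (hA : 0 < A).

Let p := (1 + a) / 2.
Let a0 : 0 < a. Proof. by case/andP: ha. Qed.
Let a2 : a < 2. Proof. by case/andP: ha. Qed.
Let p0 : 0 < p. Proof. by have := a0; have := a2; rewrite /p; lra. Qed.
Let p1 : 1 / 2 < p. Proof. by have := a0; have := a2; rewrite /p; lra. Qed.
Let p2 : 2 * p <= 3. Proof. by have := a0; have := a2; rewrite /p; lra. Qed.
Let An0 : A != 0. Proof. by rewrite gt_eqF. Qed.

Lemma japanese_q (y : R) : (japanese y `^ (1 + a))^-1 = q y `^ p.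
Proof.
rewrite /japanese -powR12_sqrt ?addr_ge0 ?sqr_ge0// -powRrM /q.
rewrite -powR_inv1 ?powR_ge0// -(powR_inv1 (addr_ge0 ler01 (sqr_ge0 y))) -!powRrM.
by congr (_ `^ _); rewrite /p; field.
Qed.

Lemma C_phiE : C_phi a = (\int[mu]_y (q y `^ p))^-1.
Proof. by rewrite /C_phi; congr (_^-1); apply: eqI => y; rewrite japanese_q. Qed.

Let iq : itg mu (fun y => q y `^ p). Proof. exact: itg_q_powR. Qed.

Lemma C_phi_gt0 : 0 < C_phi a.
Proof.
rewrite C_phiE invr_gt0.
have h0 : 0 < (1 / 2 : R) `^ p by rewrite powR_gt0.
apply: (lt_le_trans h0).
have -> : (1 / 2 : R) `^ p = (1 / 2) `^ p * (1 - 0) by rewrite subr0 mulr1.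
rewrite -(I_indic_itv (@ler01 R)) -IZ; last exact: itg_indic_itv.
apply: le_I => //; first exact/itgZ/itg_indic_itv.
move=> x; rewrite indicE; case: (boolP (x \in _)); last by rewrite mulr0 powR_ge0.
rewrite inE/= in_itv/= mulr1 => /andP[x0 x1].
have hq : 1 / 2 <= q x.
  rewrite /q div1r lef_pV2 ?posrE ?ltr_pwDl ?sqr_ge0//.
  have : x ^+ 2 <= 1 by rewrite exprn_ile1.
  lra.
by apply: le_powR hq; [exact: ltW|exact: divr_ge0].
Qed.

Lemma phiE (x : R) : phi a x = 1 - C_phi a * \int[mu]_(y in `]-oo, x]) (q y `^ p).
Proof. by rewrite /phi; congr (_ - _ * _); apply: eq_Rintegral => y _; rewrite japanese_q. Qed.

Let cq : continuous (fun y : R => q y `^ p).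
Proof.
move=> y; exact: (der_cont (der_comp (is_derive_q y) (is_derive1_powR p (q_gt0 y)))).
Qed.

Lemma is_derive_phi (x : R) : is_derive x 1 (phi a) (- (C_phi a * q x `^ p)).
Proof.
have -> : phi a = (fun x => 1 - C_phi a * \int[mu]_(y in `]-oo, x]) (q y `^ p)).
  by apply/funext => y; exact: phiE.
have [] := @continuous_FTC1 R (fun y => q y `^ p) -oo%O x (x + 1) _ _ _ (@cq x).
- by rewrite ltrDl.
- by apply: integrableS iq => //.
- by rewrite ltNyr.
move=> h1 h2.
apply: der_eq (derB (derC x 1) (derM (derC x (C_phi a)) (@DeriveDef _ _ _ _ _ _ _ h1 _))) _.
  by rewrite -derive1E h2.
by rewrite mul0r !add0r.
Qed.

Lemma phi_01 (x : R) : 0 <= phi a x <= 1.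
Proof.
have c0 := C_phi_gt0; rewrite phiE.
have i0 : 0 <= \int[mu]_(y in `]-oo, x]) (q y `^ p).
  by apply: Rintegral_ge0 => y _; exact: powR_ge0.
have i1 : \int[mu]_(y in `]-oo, x]) (q y `^ p) <= \int[mu]_y (q y `^ p).
  rewrite Rintegral_mkcond; apply: le_I => //.
    rewrite /itg -restrict_EFin; apply/integrable_restrict => //.
    by rewrite setTI; apply: integrableS iq.
  move=> y; rewrite patchE; case: ifP => // _; exact: powR_ge0.
rewrite subr_ge0 lerBlDr lerDl mulr_ge0 ?(ltW c0)// andbT.
move: c0; rewrite C_phiE; set X := \int[mu]_y _ => c0.
by rewrite ler_pdivrMl ?mulr1// -invr_gt0.
Qed.

(* Locked so that lemmas about products do not unify with the weight. *)
Definition wt (x : R) : R := locked (C_phi a / A * q ((x - m) / A) `^ p).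
Lemma wtE x : wt x = C_phi a / A * q ((x - m) / A) `^ p.
Proof. by rewrite /wt -lock. Qed.

Definition DD (x : R) : R := A ^+ 2 + (x - m) ^+ 2.
(** The distance in the plane from [(x, A)] to [(m, 0)], which is why it is 1-Lipschitz and at least
    [A]. *)
Definition rh (x : R) : R := Num.sqrt (DD x).

Lemma DD_gt0 x : 0 < DD x.
Proof. by rewrite ltr_wpDr ?sqr_ge0// exprn_gt0. Qed.

Lemma rh_sqr x : rh x ^+ 2 = DD x.
Proof. by rewrite sqr_sqrtr// ltW// DD_gt0. Qed.

Lemma rh_gt0 x : 0 < rh x.
Proof. by rewrite sqrtr_gt0 DD_gt0. Qed.

Lemma rh_geA x : A <= rh x.
Proof.
rewrite -[leLHS]gtr0_norm// -sqrtr_sqr ler_sqrt ?(ltW (DD_gt0 _))//.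
by rewrite lerDl sqr_ge0.
Qed.

Lemma rh_gex x : `|x - m| <= rh x.
Proof.
rewrite -sqrtr_sqr ler_sqrt ?(ltW (DD_gt0 _))//.
by rewrite lerDr sqr_ge0.
Qed.

Lemma rhD x h : rh (x + h) <= rh x + `|h|.
Proof.
have r0 := rh_gt0 x.
rewrite -[leRHS]ger0_norm ?addr_ge0 ?(ltW r0)// -sqrtr_sqr ler_sqrt ?sqr_ge0//.
rewrite sqrrD rh_sqr /DD real_normK ?num_real//.
have h1 : (x - m) * h <= rh x * `|h|.
  by apply: (le_trans (ler_norm _)); rewrite normrM ler_wpM2r// rh_gex.
have -> : (x + h - m) ^+ 2 = (x - m) ^+ 2 + 2 * ((x - m) * h) + h ^+ 2 by ring.
move: h1; rewrite -mulr_natr; lra.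
Qed.

Lemma wt_gt0 x : 0 < wt x.
Proof. by rewrite wtE mulr_gt0 ?divr_gt0 ?C_phi_gt0// powR_gt0// q_gt0. Qed.

Lemma q_rh x : q ((x - m) / A) = (A / rh x) ^+ 2.
Proof.
rewrite exprMn exprVn rh_sqr /q /DD; field.
by rewrite An0 -[_ + _]/(DD x) !gt_eqF ?DD_gt0// ?ltr_pwDl ?sqr_ge0.
Qed.

(** The source of the factors [A^(-a)]: since [q ((x - m) / A)] is [(A / rh x)^2], the kernel at
    distance [rh x] is a multiple of the weight. *)
Lemma wt_rh x : rh x `^ (- (1 + a)) = A `^ (- a) * wt x / C_phi a.
Proof.
have c0 := C_phi_gt0; have r0 := rh_gt0 x.
rewrite wtE q_rh -powR_mulrn ?divr_ge0 ?(ltW hA) ?(ltW r0)// -powRrM.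
have -> : 2 * p = 1 + a by rewrite /p; field.
rewrite powRM ?invr_ge0 ?(ltW hA) ?(ltW r0)//.
rewrite -(powR_inv1 (ltW r0)) -(powRrM (rh x)) mulN1r.
have -> : A `^ (- a) * (C_phi a / A * (A `^ (1 + a) * rh x `^ (- (1 + a)))) / C_phi a =
   (A `^ (- a) * A `^ (1 + a) / A) * rh x `^ (- (1 + a)).
  by field; rewrite An0 gt_eqF.
rewrite -powRD ?An0 ?implybT//.
have -> : - a + (1 + a) = 1 by ring.
by rewrite powRr1 ?(ltW hA)// mulfV// mul1r.
Qed.

Lemma itg_wt : itg mu wt.
Proof.
have -> : wt = (fun x => C_phi a / A * q ((x - m) / A) `^ p).
  by apply/funext => x; exact: wtE.
apply: itgZ; have An : A^-1 != 0 by rewrite invr_eq0.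
apply: eq_itg (itg_affine (- m / A) An iq) => x; congr (q _ `^ _); ring.
Qed.

(** The choice of [C_phi] makes the mass independent of [A] and [m]; translates of the weight
    therefore cost a fixed constant in the far region. *)
Lemma I_wt : \int[mu]_x wt x = 1.
Proof.
have c0 := C_phi_gt0.
have An : A^-1 != 0 by rewrite invr_eq0.
have h := itg_affine (- m / A) An iq.
have e : (fun x => q (A^-1 * x + - m / A) `^ p) = (fun x => q ((x - m) / A) `^ p).
  by apply/funext => x; congr (q _ `^ _); ring.
have hE := I_affine (- m / A) An iq.
rewrite /= e in h hE.
rewrite (eqI mu wtE) IZ//; move: c0; rewrite C_phiE hE gtr0_norm ?invr_gt0//.
set X := \int[mu]_x _ => c0.
have X0 : X != 0 by apply: contraTneq c0 => ->; rewrite mulr0 ltxx.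
by field; rewrite An0 X0.
Qed.

(** The derivatives of [wt] are written as [wt] times rational functions of size [1 / rh] and, for
    [wt2], [1 / rh^2], so bounds relative to [wt] can be read off. *)
Definition wt1 (x : R) : R := - (1 + a) * ((x - m) / DD x) * wt x.
Definition wt2 (x : R) : R := - (1 + a) * ((DD x - (x - m) * (2 * (x - m))) / DD x ^+ 2) * wt x
  - (1 + a) * ((x - m) / DD x) * wt1 x.

Lemma is_derive_wt (x : R) : is_derive x 1 wt (wt1 x).
Proof.
have D0 := DD_gt0 x; have c0 := C_phi_gt0.
have qE : q ((x - m) / A) = A ^+ 2 / DD x.
  by rewrite q_rh exprMn exprVn rh_sqr.
have dz : is_derive x 1 (fun x => (x - m) / A) A^-1.
  by apply: der_eq (derM (derB (derid x) (derC x m)) (derC x A^-1)) _; ring.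
have d := der_comp (der_comp dz (is_derive_q _)) (is_derive1_powR p (q_gt0 _)).
have -> : wt = (fun x => C_phi a / A * q ((x - m) / A) `^ p).
  by apply/funext => y; exact: wtE.
apply: der_eq (derM (derC x (C_phi a / A)) d) _.
rewrite powRB ?powRr1 ?q_ge0//; last by rewrite (gt_eqF (q_gt0 _)) implybT.
rewrite /wt1 wtE; set X := q _ `^ p; rewrite qE /p.
by field; rewrite An0 (gt_eqF D0).
Qed.

Lemma is_derive_wt1 (x : R) : is_derive x 1 wt1 (wt2 x).
Proof.
have D0 := DD_gt0 x; have Dn : DD x != 0 by rewrite gt_eqF.
have dD : is_derive x 1 DD (2 * (x - m)).
  by apply: der_eq (derD (derC x (A ^+ 2)) (der_sqr (derB (derid x) (derC x m)))) _; ring.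
have dV := @derV R DD x _ Dn dD.
have d := derM (derM (derC x (- (1 + a))) (derM (derB (derid x) (derC x m)) dV)) (is_derive_wt x).
apply: der_eq d _; rewrite /wt2.
by field.
Qed.

Lemma wt1E x : wt1 x = - (1 + a) * ((x - m) / DD x) * wt x.
Proof. by []. Qed.
Lemma wt2E x : wt2 x = - (1 + a) * ((DD x - (x - m) * (2 * (x - m))) / DD x ^+ 2) * wt x
  - (1 + a) * ((x - m) / DD x) * wt1 x.
Proof. by []. Qed.
Lemma DDE x : DD x = A ^+ 2 + (x - m) ^+ 2.
Proof. by []. Qed.

End weight.

(** * Pointwise bounds on the weight and its differences *)

Section estimates.
Context (R : realType).
Notation mu := (@lebesgue_measure R).
Variables (a A m : R).
Hypotheses (ha : 0 < a < 2) (hA : 0 < A).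
Notation wt := (wt a A m).
Notation wt1 := (wt1 a A m).
Notation wt2 := (wt2 a A m).
Notation rh := (rh A m).
Notation DD := (DD A m).
Implicit Types (x y z h t : R) (G : R -> R -> R) (f u v : R -> R).

Lemma wt_ge0 x : 0 <= wt x. Proof. exact/ltW/wt_gt0. Qed.
Lemma rh_ge0 x : 0 <= rh x. Proof. exact/ltW/rh_gt0. Qed.

Lemma wt_comp x y : rh x <= 2 * rh y -> wt y <= 8 * wt x.
Proof.
move=> xy; have [a0 a2] := andP ha.
rewrite !wtE mulrCA ler_wpM2l ?divr_ge0 ?(ltW hA) ?(ltW (C_phi_gt0 ha))//.
have rx := rh_gt0 m hA x; have ry := rh_gt0 m hA y.
have e : q ((y - m) / A) <= 4 * q ((x - m) / A).
  rewrite !(q_rh _ hA) (_ : 4 = 2 ^+ 2); last by ring.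
  have xy2 : A / rh y <= 2 * (A / rh x).
    rewrite mulrA ler_pdivlMr// mulrAC ler_pdivrMr//.
    by have := ler_wpM2l (ltW hA) xy; lra.
  have k1 : 0 <= A / rh y by rewrite divr_ge0 ?(ltW hA) ?(ltW ry).
  have k2 : 0 <= 2 * (A / rh x) by rewrite mulr_ge0// divr_ge0 ?(ltW hA) ?(ltW rx).
  by rewrite -exprMn; apply: lerXn2r xy2; rewrite nnegrE.
apply: (le_trans (le_powR _ (q_ge0 _) e)); first by lra.
rewrite powRM ?q_ge0// ler_wpM2r ?powR_ge0//.
(* Squaring the ratio gives 4 for [q], and the exponent [(1 + a) / 2] is below [3 / 2]. *)
rewrite (_ : 8 = 4 `^ (3 / 2)); last first.
  rewrite (_ : 4 = 2 `^ 2%:R); last by rewrite powR_mulrn//; ring.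
  rewrite -powRrM (_ : 2%:R * (3 / 2) = 3%:R); last by field.
  by rewrite powR_mulrn//; ring.
by rewrite ler_powR//; lra.
Qed.

Lemma rh_near x t : `|t| <= rh x / 2 -> rh x <= 2 * rh (x + t).
Proof.
move=> ht; have := rhD m hA (x + t) (- t); rewrite addrK normrN; lra.
Qed.

Lemma abs_wt1 x : `|wt1 x| <= 3 * wt x / rh x.
Proof.
have [a0 a2] := andP ha; have r0 := rh_gt0 m hA x; have w0 := wt_gt0 m ha hA x.
rewrite wt1E.
rewrite (normrM _ (wt x)) (normrM (- (1 + a))) (normrM (x - m)) normrN (gtr0_norm w0) normfV -(rh_sqr _ hA).
rewrite (ger0_norm (sqr_ge0 (rh x))).
have h1 : `|1 + a| <= 3 by rewrite ger0_norm; lra.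
have h2 := rh_gex m hA x.
have -> : 3 * wt x / rh x = 3 * (rh x / rh x ^+ 2) * wt x by field; rewrite gt_eqF.
rewrite ler_wpM2r ?(ltW w0)//; apply: ler_pM; rewrite ?mulr_ge0 ?invr_ge0 ?sqr_ge0//.
by rewrite ler_wpM2r// invr_ge0 sqr_ge0.
Qed.

Lemma abs_wt2 x : `|wt2 x| <= 12 * wt x / rh x ^+ 2.
Proof.
have [a0 a2] := andP ha; have r0 := rh_gt0 m hA x; have w0 := wt_gt0 m ha hA x.
have D0 := DD_gt0 m hA x.
have h1 : `|1 + a| <= 3 by rewrite ger0_norm; lra.
have h2 := rh_gex m hA x; have h3 := abs_wt1 x.
rewrite wt2E; apply: (le_trans (ler_normB _ _)).
have -> : 12 * wt x / rh x ^+ 2 = 3 * (rh x ^+ 2)^-1 * wt x + 3 * (rh x / rh x ^+ 2) * (3 * wt x / rh x).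
  by field; rewrite gt_eqF.
rewrite -(rh_sqr _ hA) in D0 *.
apply: lerD.
  rewrite (normrM _ (wt x)) (normrM (- (1 + a))) normrN (gtr0_norm w0) ler_wpM2r ?(ltW w0)//; apply: ler_pM => //.
  rewrite normrM normfV (ger0_norm (sqr_ge0 (rh x ^+ 2))).
  rewrite ler_pdivrMr ?exprn_gt0//.
  have -> : (rh x ^+ 2)^-1 * (rh x ^+ 2) ^+ 2 = rh x ^+ 2 by field; rewrite gt_eqF.
  rewrite (rh_sqr _ hA) DDE.
  have s1 := sqr_ge0 A; have s2 := sqr_ge0 (x - m).
  rewrite ler_norml; apply/andP; split; rewrite !expr2 in s1 s2 *; lra.
rewrite (normrM _ (wt1 x)) (normrM (1 + a)); apply: ler_pM => //; apply: ler_pM => //.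
rewrite normrM normfV (ger0_norm (sqr_ge0 (rh x))).
by rewrite ler_wpM2r// invr_ge0 sqr_ge0.
Qed.

(** [48 = 3 * 8 * 2]: the bound on [wt1], the comparability of [wt], and that of [rh]. *)
Lemma wt1_near x t : `|t| <= rh x / 2 -> `|wt1 (x + t)| <= 48 * wt x / rh x.
Proof.
move=> ht; have rr := rh_near ht; have ww := wt_comp rr.
have r0 := rh_gt0 m hA x; have r1 := rh_gt0 m hA (x + t); have w0 := wt_gt0 m ha hA x.
apply: (le_trans (abs_wt1 _)); rewrite ler_pdivrMr// mulrAC ler_pdivlMr//.
have -> : 48 * wt x * rh (x + t) = (3 * (8 * wt x)) * (2 * rh (x + t)) by ring.
apply: ler_pM; rewrite ?mulr_ge0 ?wt_ge0 ?rh_ge0//.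
by rewrite ler_wpM2l.
Qed.

(** [384 = 12 * 8 * 4], the last factor being the square of the comparability constant of [rh]. *)
Lemma wt2_near x t : `|t| <= rh x / 2 -> `|wt2 (x + t)| <= 384 * wt x / rh x ^+ 2.
Proof.
move=> ht; have rr := rh_near ht; have ww := wt_comp rr.
have r0 := rh_gt0 m hA x; have r1 := rh_gt0 m hA (x + t); have w0 := wt_gt0 m ha hA x.
apply: (le_trans (abs_wt2 _)).
rewrite ler_pdivrMr ?exprn_gt0// mulrAC ler_pdivlMr ?exprn_gt0//.
have -> : 384 * wt x * rh (x + t) ^+ 2 = (12 * (8 * wt x)) * (2 * rh (x + t)) ^+ 2 by ring.
apply: ler_pM; [by rewrite mulr_ge0 ?wt_ge0|exact: sqr_ge0|by rewrite ler_wpM2l|].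
by apply: lerXn2r; rewrite ?nnegrE ?mulr_ge0 ?rh_ge0.
Qed.

Lemma wt_diff_right x h : 0 <= h <= rh x / 2 ->
  `|wt (x + h) - wt x| <= 48 * wt x * (h / rh x).
Proof.
move=> /andP[h0 h1].
have -> : 48 * wt x * (h / rh x) = 48 * wt x / rh x * h by ring.
apply: (mvt_abs h0 (is_derive_wt m ha hA)) => z /andP[z1 z2].
by rewrite -(subrK x z) addrC wt1_near// ger0_norm; lra.
Qed.

Lemma wt_diff_left x h : 0 <= h <= rh x / 2 ->
  `|wt x - wt (x - h)| <= 48 * wt x * (h / rh x).
Proof.
move=> /andP[h0 h1].
have -> : 48 * wt x * (h / rh x) = 48 * wt x / rh x * h by ring.
have := @mvt_abs _ wt wt1 (48 * wt x / rh x) (x - h) h h0 (is_derive_wt m ha hA).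
rewrite subrK; apply => z /andP[z1 z2].
by rewrite -(subrK x z) addrC wt1_near// ler0_norm; lra.
Qed.

(** The map [t -> wt (x + t) + wt (x - t)] has derivative [wt1 (x + t) - wt1 (x - t)], which is at
    most [2 t] times the bound on [wt2]; hence [768 = 2 * 384]. *)
Lemma wt_second_diff x h : 0 <= h <= rh x / 2 ->
  `|2 * wt x - wt (x + h) - wt (x - h)| <= 768 * wt x * (h / rh x) ^+ 2.
Proof.
move=> /andP[h0 h1].
have dg (t : R) : is_derive t 1 (fun t => wt (x + t) + wt (x + - t)) (wt1 (x + t) - wt1 (x + - t)).
  have d1 := der_shiftl (is_derive_wt m ha hA (x + t)).
  have d2 := der_comp (derN (derid t)) (der_shiftl (is_derive_wt m ha hA (x + - t))).
  by apply: der_eq (derD d1 d2) _; ring.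
have r0 := rh_gt0 m hA x.
have := @mvt_abs _ _ _ (768 * wt x / rh x ^+ 2 * h) 0 h h0 dg.
rewrite add0r addr0 oppr0 addr0 => hh.
have -> : 2 * wt x - wt (x + h) - wt (x - h) = - (wt (x + h) + wt (x + - h) - (wt x + wt x)) by ring.
have -> : 768 * wt x * (h / rh x) ^+ 2 = 768 * wt x / rh x ^+ 2 * h * h.
  by field; rewrite gt_eqF.
rewrite normrN; apply: hh => z /andP[z0 z1].
have := @mvt_abs _ wt1 wt2 (384 * wt x / rh x ^+ 2) (x + - z) (2 * z) _ (is_derive_wt1 m ha hA).
have -> : x + - z + 2 * z = x + z by ring.
move=> k; have z20 : 0 <= 2 * z by lra.
apply: (le_trans (k z20 _)).
  move=> s /andP[s1 s2]; rewrite -(subrK x s) addrC wt2_near// ler_norml; apply/andP; split; lra.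
have c0 : 0 <= wt x / rh x ^+ 2 by rewrite divr_ge0 ?wt_ge0 ?sqr_ge0.
have -> : 384 * wt x / rh x ^+ 2 * (2 * z) = 768 * (wt x / rh x ^+ 2) * z by ring.
have -> : 768 * wt x / rh x ^+ 2 * h = 768 * (wt x / rh x ^+ 2) * h by ring.
have zh : z <= h by lra.
exact: (ler_wpM2l (mulr_ge0 (ler0n _ 768) c0) zh).
Qed.

(** Error of the trapezoidal rule for the mean of [wt]. The auxiliary [G] vanishes to third order up
    to a constant: its derivative is [t / 2] times a difference of values of [wt1], and dividing its
    increment by [h] leaves [S * h^2]. *)
Lemma trapezoid phi S x h : (forall z : R, is_derive z 1 phi (- wt z)) -> 0 < h ->
  (forall z, x <= z <= x + h -> `|wt2 z| <= S) ->
  `|(wt x + wt (x + h)) / 2 - mean_slope phi x h| <= S * h ^+ 2.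
Proof.
move=> dphi h0 hS.
have S0 : 0 <= S by apply: le_trans (hS x _); rewrite ?normr_ge0// lexx lerDl ltW.
pose G t := phi (x + t) + t * (wt x + wt (x + t)) / 2.
have dG (t : R) : is_derive t 1 G ((wt x - wt (x + t) + t * wt1 (x + t)) / 2).
  have d1 := der_shiftl (dphi (x + t)).
  have d2 := der_shiftl (is_derive_wt m ha hA (x + t)).
  apply: der_eq (derD d1 (derM (derM (derid t) (derD (derC t (wt x)) d2)) (derC t 2^-1))) _.
  by field.
have := @mvt_abs _ G _ (S * h ^+ 2) 0 h (ltW h0) dG.
rewrite add0r /G mul0r mul0r !addr0 => k.
have -> : (wt x + wt (x + h)) / 2 - mean_slope phi x h =
   (phi (x + h) + h * (wt x + wt (x + h)) / 2 - phi x) / h.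
  by rewrite /mean_slope; field; rewrite gt_eqF.
rewrite normrM normfV (gtr0_norm h0) ler_pdivrMr//; apply: k => t /andP[t0 t1].
have xt : x <= x + t by rewrite lerDl.
have [z /andP[z0 z1] e] := mvt (is_derive_wt m ha hA) xt.
have -> : wt x - wt (x + t) + t * wt1 (x + t) = t * (wt1 (x + t) - wt1 z).
  have -> : wt x - wt (x + t) = - (wt (x + t) - wt x) by ring.
  by rewrite e; ring.
have k2 := @mvt_abs _ wt1 wt2 S z (x + t - z) _ (is_derive_wt1 m ha hA).
rewrite (_ : z + (x + t - z) = x + t) in k2; last by ring.
have xtz : 0 <= x + t - z by lra.
have k3 : `|wt1 (x + t) - wt1 z| <= S * h.
  apply: (le_trans (k2 xtz _)).
    by move=> s /andP[s1 s2]; apply: hS; apply/andP; split; lra.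
  by rewrite ler_wpM2l//; lra.
rewrite !normrM (ger0_norm t0) (@ger0_norm _ (2^-1))//.
have k4 : t * `|wt1 (x + t) - wt1 z| <= h * (S * h) by apply: ler_pM.
have : 0 <= h * (S * h) by rewrite !mulr_ge0 ?(ltW h0).
rewrite (_ : S * h ^+ 2 = h * (S * h)); [lra|ring].
Qed.

End estimates.

(** * Near and far regions *)

Section near_far.
Context (R : realType).
Notation mu := (@lebesgue_measure R).
Variables (a A m : R).
Hypotheses (ha : 0 < a < 2) (hA : 0 < A).
Notation wt := (wt a A m).
Notation rh := (rh A m).
Implicit Types (x y z h t : R) (G T : R -> R -> R) (f u v : R -> R).

(** A two-scale bound: vanishing of relative order [n] within [rh x / 2], and at all distances a
    majorant whose integral against the kernel over [h > rh x / 2] is [O(A^(-a) wt x)]. The term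
    [1 / h] accommodates the mean slope of a cut-off with values in [[0, 1]]. *)
Definition NF (n : nat) (C : R) G := forall x h, 0 < h ->
  (h <= rh x / 2 -> `|G x h| <= C * wt x * (h / rh x) ^+ n) /\
  `|G x h| <= C * (wt x + wt (x + h) + wt (x - h) + h^-1).

(** [4 / (n - a)] bounds the near region and [4 / a] the term [wt x] of the far region;
    [24 = 16 + 8] collects the two translates of [wt] and the term [1 / h]. *)
Definition CE (n : nat) : R := 4 / (n%:R - a) + 4 / a + 24 / C_phi a.

Lemma CE_ge0 n : a < n%:R -> 0 <= CE n.
Proof.
move=> an; have [a0 a2] := andP ha; have c0 := C_phi_gt0 ha.
by rewrite !addr_ge0 ?divr_ge0 ?subr_ge0 ?(ltW a0) ?(ltW an) ?(ltW c0).
Qed.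

Let half x := rh x / 2.
Let half_gt0 x : 0 < half x. Proof. by rewrite divr_gt0 ?rh_gt0. Qed.

Lemma half_powa x : half x `^ (- a) <= 4 * A `^ (- a).
Proof.
have [a0 a2] := andP ha.
have hA2 : 0 < A / 2 by rewrite divr_gt0.
apply: (@le_trans _ _ ((A / 2) `^ (- a))).
  apply: le_powR_neg; first by lra.
  by rewrite hA2 /= ler_wpM2r// rh_geA.
rewrite powRM ?invr_ge0 ?(ltW hA)// mulrC ler_wpM2r ?powR_ge0//.
rewrite -powR_inv1// -powRrM mulN1r opprK.
apply: (@le_trans _ _ (2 `^ 2%:R)); last by rewrite powR_mulrn// expr2; lra.
by rewrite ler_powR//; lra.
Qed.

Lemma half_pow1a x : half x `^ (- (1 + a)) <= 8 * (A `^ (- a) * wt x / C_phi a).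
Proof.
have [a0 a2] := andP ha.
rewrite -(wt_rh m ha hA) /half powRM ?invr_ge0 ?(ltW (rh_gt0 m hA x))//.
rewrite mulrC ler_wpM2r ?powR_ge0//.
rewrite -powR_inv1// -powRrM mulN1r opprK.
apply: (@le_trans _ _ (2 `^ 3%:R)); last by rewrite powR_mulrn// !exprS expr0; lra.
by rewrite ler_powR//; lra.
Qed.

(** The condition [a < n] makes [h^(n-1-a)] integrable at zero. In both regions the integrals are
    powers of [rh x / 2], which [half_powa] and [half_pow1a] convert into [A^(-a)] and into
    [A^(-a) wt x]. *)
Lemma near_far_I n C G x : 0 <= C -> a < n%:R -> m2 G -> NF n C G ->
  itg mu (fun h => K a h * G x h) /\
  \int[mu]_h `|K a h * G x h| <= C * CE n * A `^ (- a) * wt x.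
Proof.
move=> C0 an mG hG; have [a0 a2] := andP ha; have c0 := C_phi_gt0 ha.
have r0 := half_gt0 x; have R0 := rh_gt0 m hA x; have w0 := wt_gt0 m ha hA x.
have ia : (1 + a)^-1 <= 1 by rewrite invf_le1; lra.
have na : - (1 + a) <= 0 by lra.
have hr : half x <= rh x by rewrite ler_pdivrMr// ler_peMr ?(ltW R0)// ler1n.
have [i1 b1] := @pow_near R (n%:R - 1 - a) (half x) ltac:(lra) r0.
have [i2 b2] := @pow_far R (- (1 + a)) (half x) ltac:(lra) r0.
have [i4 b4] := @pow_far R (- (2 + a)) (half x) ltac:(lra) r0.
have iw := itg_wt m ha hA.
have N1 : -1 != 0 :> R by rewrite oppr_eq0 oner_neq0.
have iwp : itg mu (fun h => wt (x + h)).
  by apply: eq_itg (itg_shift x iw) => h; rewrite addrC.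
have iwm : itg mu (fun h => wt (x - h)).
  by apply: eq_itg (itg_affine x N1 iw) => h; congr (wt _); ring.
have Iwp : \int[mu]_h wt (x + h) = 1.
  by rewrite -(I_wt m ha hA) -[RHS](I_shift x iw); apply: eqI => h; rewrite addrC.
have Iwm : \int[mu]_h wt (x - h) = 1.
  rewrite -(I_wt m ha hA) [RHS](I_affine x N1 iw) normrN1 mul1r.
  by apply: eqI => h; congr (wt _); ring.
have i3 := itgD iwp iwm.
(* Four pieces: the near region; the term [wt x] far away; the two translates, with the kernel
   frozen at [rh x / 2]; and the term [1 / h] far away. *)
pose M h := (C * wt x / rh x ^+ n * (near0 (half x) h * h `^ (n%:R - 1 - a))
  + C * wt x * (far0 (half x) h * h `^ (- (1 + a))))
  + (C * half x `^ (- (1 + a)) * (wt (x + h) + wt (x - h))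
  + C * (far0 (half x) h * h `^ (- (2 + a)))).
have iM : itg mu M by apply: itgD; apply: itgD; exact: itgZ.
have n0 h : 0 <= near0 (half x) h := near0_ge0 _ _.
have f0 h : 0 <= far0 (half x) h := far0_ge0 _ _.
have p0 h s : 0 <= h `^ s := powR_ge0 _ _.
have W0 y : 0 <= wt y := wt_ge0 m ha hA y.
have t1 h : 0 <= C * wt x / rh x ^+ n * (near0 (half x) h * h `^ (n%:R - 1 - a)).
  apply: mulr_ge0; last exact: mulr_ge0.
  by apply: divr_ge0; [exact: mulr_ge0|exact/exprn_ge0/ltW].
have t2 h : 0 <= C * wt x * (far0 (half x) h * h `^ (- (1 + a))).
  by apply: mulr_ge0; exact: mulr_ge0.
have t3 h : 0 <= C * half x `^ (- (1 + a)) * (wt (x + h) + wt (x - h)).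
  by apply: mulr_ge0; [exact: mulr_ge0|exact: addr_ge0].
have t4 h : 0 <= C * (far0 (half x) h * h `^ (- (2 + a))).
  by apply: mulr_ge0 => //; exact: mulr_ge0.
have KM h : `|K a h * G x h| <= M h.
  have [h0|h0] := ltP 0 h; last by rewrite K_npos// mul0r normr0 !addr_ge0.
  rewrite normrM (ger0_norm (K_ge0 a h)) K_pos//; have [g1 g2] := hG x h h0.
  have [hh|hh] := leP h (half x).
    apply: (le_trans (ler_wpM2l (p0 h _) (g1 hh))).
    rewrite -[leLHS]addr0; apply: lerD; last exact: addr_ge0.
    rewrite -[leLHS]addr0; apply: lerD => //.
    rewrite /near0 h0 hh/= mul1r expr_div_n.
    have -> : h `^ (n%:R - 1 - a) = h `^ (- (1 + a)) * h ^+ n.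
      rewrite -powR_mulrn ?(ltW h0)// -powRD ?(gt_eqF h0) ?implybT//.
      by congr (_ `^ _); ring.
    by rewrite le_eqVlt; apply/orP; left; apply/eqP; ring.
  apply: (le_trans (ler_wpM2l (p0 h _) g2)).
  rewrite /M /far0 hh !mul1r /near0 (lt_geF hh) andbF mul0r mulr0 add0r.
  have -> : h `^ (- (1 + a)) * (C * (wt x + wt (x + h) + wt (x - h) + h^-1)) =
    C * wt x * h `^ (- (1 + a)) + (C * (wt (x + h) + wt (x - h)) * h `^ (- (1 + a)) + C * (h `^ (- (1 + a)) * h^-1)).
    by ring.
  apply: lerD => //; apply: lerD.
    rewrite [leRHS]mulrAC ler_wpM2l//; first by apply: mulr_ge0 => //; exact: addr_ge0.
    apply: (le_powR_neg na).
    by rewrite r0 ltW.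
  rewrite ler_wpM2l// -(powR_inv1 (ltW h0)) -powRD ?(gt_eqF h0) ?implybT//.
  by rewrite (_ : - (1 + a) + -1 = - (2 + a))//; ring.
have mKG : measurable_fun setT (fun h => K a h * G x h).
  by apply: measurable_funM; [exact: measurable_K|exact: m2_snd].
have iKG := itg_dom iM mKG KM; split => //.
apply: (le_trans (le_I (itg_abs iKG) iM KM)).
rewrite /M ID; [|by apply: itgD; exact: itgZ|by apply: itgD; exact: itgZ].
rewrite ID; [|exact: itgZ|exact: itgZ].
rewrite ID; [|exact: itgZ|exact: itgZ].
rewrite !IZ// ID// Iwp Iwm.
set I1 := \int[mu]_h _ in b1 *; set I2 := \int[mu]_h _ in b2 *.
set I4 := \int[mu]_h _ in b4 *.
set Y := A `^ (- a); have Y0 : 0 <= Y := powR_ge0 _ _.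
have hp1 := half_powa x; have hp2 := half_pow1a x; rewrite -/Y in hp1 hp2.
have e1 : C * wt x / rh x ^+ n * I1 <= C * wt x * (4 * Y / (n%:R - a)).
  have -> : C * wt x / rh x ^+ n * I1 = C * wt x * (I1 / rh x ^+ n) by ring.
  apply: ler_wpM2l; first exact: mulr_ge0.
  rewrite ler_pdivrMr ?exprn_gt0//; apply: (le_trans b1).
  have -> : n%:R - 1 - a + 1 = n%:R - a by ring.
  rewrite mulrAC ler_wpM2r ?invr_ge0 ?subr_ge0 ?(ltW an)//.
  rewrite powRD; last by rewrite (gt_eqF r0) implybT.
  rewrite powR_mulrn ?(ltW r0)// mulrC; apply: ler_pM => //; first exact/exprn_ge0/ltW.
  by apply: lerXn2r; rewrite ?nnegrE ?(ltW r0) ?(ltW R0).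
have e2 : C * wt x * I2 <= C * wt x * (4 * Y / a).
  apply: ler_wpM2l; first exact: mulr_ge0.
  apply: (le_trans b2); rewrite (_ : - (1 + a) + 1 = - a); last by ring.
  by rewrite opprK ler_wpM2r ?invr_ge0 ?(ltW a0).
have e3 : C * half x `^ (- (1 + a)) * (1 + 1) <= C * (8 * (Y * wt x / C_phi a)) * 2.
  by rewrite (_ : 1 + 1 = 2)// ler_wpM2r// ler_wpM2l.
have e4 : C * I4 <= C * (8 * (Y * wt x / C_phi a)).
  apply: ler_wpM2l => //; apply: (le_trans b4).
  rewrite (_ : - (2 + a) + 1 = - (1 + a)); last by ring.
  rewrite opprK; apply: le_trans hp2.
  by rewrite ler_piMr.
have -> : C * CE n * Y * wt x = (C * wt x * (4 * Y / (n%:R - a)) + C * wt x * (4 * Y / a))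
   + (C * (8 * (Y * wt x / C_phi a)) * 2 + C * (8 * (Y * wt x / C_phi a))).
  by rewrite /CE; ring.
by apply: lerD; apply: lerD.
Qed.

Lemma near_far_J n C G f : 0 <= C -> a < n%:R -> m2 G -> NF n C G ->
  measurable_fun setT f -> itg mu (fun x => f x ^+ 2 * wt x) ->
  it2 (fun x h => K a h * (f x ^+ 2 * G x h)) /\
  J (fun x h => `|K a h * (f x ^+ 2 * G x h)|) <=
    C * CE n * A `^ (- a) * \int[mu]_x (f x ^+ 2 * wt x).
Proof.
move=> C0 an mG hG mf hf.
have h1 x := near_far_I x C0 an mG hG.
have i1 x : itg mu (fun h => K a h * (f x ^+ 2 * G x h)).
  by apply: eq_itg (itgZ (f x ^+ 2) (h1 x).1) => h; rewrite mulrCA.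
have hb x : \int[mu]_h `|K a h * (f x ^+ 2 * G x h)| <= C * CE n * A `^ (- a) * (f x ^+ 2 * wt x).
  rewrite (_ : \int[mu]_h _ = f x ^+ 2 * \int[mu]_h `|K a h * G x h|).
    have -> : C * CE n * A `^ (- a) * (f x ^+ 2 * wt x) = f x ^+ 2 * (C * CE n * A `^ (- a) * wt x) by ring.
    by rewrite ler_wpM2l ?sqr_ge0// (h1 x).2.
  rewrite -IZ; last exact: itg_abs (h1 x).1.
  by apply: eqI => h; rewrite mulrCA normrM (ger0_norm (sqr_ge0 _)).
have hit : it2 (fun x h => K a h * (f x ^+ 2 * G x h)).
  apply: (it2_crit (itgZ _ hf) _ i1 hb).
  apply: m2_K; apply: m2M => //; apply: (m2_fun1 (f := fun x => f x ^+ 2)).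
  exact: measurable_funX.
split => //; rewrite J12; last exact: it2_abs.
rewrite -IZ//; apply: le_I => //; last exact: itgZ.
exact: (it2_itg1 (it2_abs hit)).
Qed.

(** The second half re-bases [G] at its right end point, as is needed for terms carrying
    [f (x + h)]. *)
Definition NFb n C G := NF n C G /\ NF n C (fun x h => G (x - h) h).

(** The part with [f x] is [near_far_J]; the part with [f (x + h)] reduces to it by the translation
    [x + h -> x], which replaces [G x h] by [G (x - h) h]. *)
Lemma AM_bound n C G f T : 0 <= C -> a < n%:R -> m2 G -> NFb n C G ->
  (forall x h, 0 <= G x h) -> measurable_fun setT f ->
  itg mu (fun x => f x ^+ 2 * wt x) -> m2 T ->
  (forall x h, 0 < h -> `|T x h| <= (f x ^+ 2 + f (x + h) ^+ 2) * G x h) ->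
  it2 (fun x h => K a h * T x h) /\
  J (fun x h => `|K a h * T x h|) <=
    2 * C * CE n * A `^ (- a) * \int[mu]_x (f x ^+ 2 * wt x).
Proof.
move=> C0 an mG [hG hG'] G0 mf hf mT hT.
have mG' : m2 (fun x h => G (x - h) h).
  apply: (m2_comp mG); last exact: measurable_snd.
  by apply: measurable_funB; [exact: measurable_fst|exact: measurable_snd].
have [i1 b1] := near_far_J C0 an mG hG mf hf.
have [i2 b2] := near_far_J C0 an mG' hG' mf hf.
have i3 := it2_shear 1 i2; have b3 := J_shear 1 (it2_abs i2).
have i1a := it2_abs i1; have i3a := it2_abs i3.
have iS := it2D i1a i3a.
have bS x h : `|K a h * T x h| <= `|K a h * (f x ^+ 2 * G x h)| +
   `|K a h * (f (x + 1 * h) ^+ 2 * G (x + 1 * h - h) h)|.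
  rewrite mul1r addrK !(normrM (K a h)) (ger0_norm (K_ge0 a h)).
  rewrite (normrM (f x ^+ 2)) (normrM (f (x + h) ^+ 2)) (ger0_norm (G0 x h)).
  rewrite !(ger0_norm (sqr_ge0 _)).
  have [h0|h0] := ltP 0 h; last by rewrite K_npos// !mul0r addr0.
  by rewrite -mulrDr ler_wpM2l ?K_ge0// -mulrDl hT.
have mKT : m2 (fun x h => K a h * T x h) by exact: m2_K.
have iT : it2 (fun x h => K a h * T x h) := it2_dom iS mKT bS.
split => //; apply: (le_trans (le_J (it2_abs iT) iS bS)).
rewrite JD// b3.
have -> : 2 * C * CE n * A `^ (- a) * \int[mu]_x (f x ^+ 2 * wt x) =
  C * CE n * A `^ (- a) * \int[mu]_x (f x ^+ 2 * wt x) +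
  C * CE n * A `^ (- a) * \int[mu]_x (f x ^+ 2 * wt x) by ring.
exact: lerD.
Qed.

Lemma AM2_bound n C G u v T : 0 <= C -> a < n%:R -> m2 G -> NFb n C G ->
  (forall x h, 0 <= G x h) -> measurable_fun setT u -> measurable_fun setT v ->
  itg mu (fun x => u x ^+ 2 * wt x) -> itg mu (fun x => v x ^+ 2 * wt x) -> m2 T ->
  (forall x h, 0 < h -> `|T x h| <=
    (u x ^+ 2 + u (x + h) ^+ 2 + (v x ^+ 2 + v (x + h) ^+ 2)) * G x h) ->
  it2 (fun x h => K a h * T x h) /\
  J (fun x h => `|K a h * T x h|) <=
    2 * C * CE n * A `^ (- a) * \int[mu]_x ((u x ^+ 2 + v x ^+ 2) * wt x).
Proof.
move=> C0 an mG hG G0 mu_ mv iu iv mT hT.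
pose U x h := (u x ^+ 2 + u (x + h) ^+ 2) * G x h.
pose V x h := (v x ^+ 2 + v (x + h) ^+ 2) * G x h.
have mW f : measurable_fun setT f -> m2 (fun x h => (f x ^+ 2 + f (x + h) ^+ 2) * G x h).
  move=> mf; have mf2 : measurable_fun setT (fun x => f x ^+ 2) by exact: measurable_funX.
  by apply: m2M => //; apply: m2D; [exact: m2_fun1|exact: (m2_shift mf2)].
have W0 f x h : 0 <= (f x ^+ 2 + f (x + h) ^+ 2) * G x h.
  by apply: mulr_ge0 => //; apply: addr_ge0; exact: sqr_ge0.
have [iU bU] := AM_bound (T := U) C0 an mG hG G0 mu_ iu (mW u mu_)
  (fun x h _ => eq_ind_r (fun z => z <= _) (lexx _) (ger0_norm (W0 u x h))).
have [iV bV] := AM_bound (T := V) C0 an mG hG G0 mv iv (mW v mv)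
  (fun x h _ => eq_ind_r (fun z => z <= _) (lexx _) (ger0_norm (W0 v x h))).
have iS := it2D (it2_abs iU) (it2_abs iV).
have bS x h : `|K a h * T x h| <= `|K a h * U x h| + `|K a h * V x h|.
  rewrite !(normrM (K a h)) (ger0_norm (K_ge0 a h)) (ger0_norm (W0 u x h)) (ger0_norm (W0 v x h)).
  have [h0|h0] := ltP 0 h; last by rewrite K_npos// !mul0r addr0.
  by rewrite -mulrDr ler_wpM2l ?K_ge0// -mulrDl hT.
have iT : it2 (fun x h => K a h * T x h) := it2_dom iS (m2_K a mT) bS.
split => //; apply: (le_trans (le_J (it2_abs iT) iS bS)).
rewrite (JD (it2_abs iU) (it2_abs iV)).
rewrite (_ : \int[mu]_x ((u x ^+ 2 + v x ^+ 2) * wt x) =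
  \int[mu]_x (u x ^+ 2 * wt x) + \int[mu]_x (v x ^+ 2 * wt x)); last first.
  by rewrite -ID//; apply: eqI => x; rewrite mulrDl.
by rewrite mulrDr; exact: lerD.
Qed.

End near_far.

(** * Smoothness of the weight *)

Section weight_smooth.
Context (R : realType).
Implicit Types (f g : R -> R).

Lemma bC_cst k (c : R) : bC k (fun=> c).
Proof.
elim: k c => [c|k ih c]; first by split; [move=> x; exact: cvg_cst|exists `|c|].
split; first by exists `|c|.
by exists (fun=> 0); split => // x; exact: derC.
Qed.

Lemma bCD k f g : bC k f -> bC k g -> bC k (fun x => f x + g x).
Proof.
have bb f' g' : (exists M, forall x, `|f' x| <= M) -> (exists M, forall x, `|g' x| <= M) ->
    exists M : R, forall x : R, `|f' x + g' x| <= M.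
  move=> [M hM] [N hN]; exists (M + N) => x.
  exact: (le_trans (ler_normD _ _) (lerD (hM x) (hN x))).
elim: k f g => [f g [cf qf] [cg qg]|k ih f g [qf [f' [df hf]]] [qg [g' [dg hg]]]].
  by split; [move=> x; apply: cvgD; [exact: cf|exact: cg]|exact: bb].
split; first exact: bb.
by exists (fun x => f' x + g' x); split => [x|]; [exact: derD|exact: ih].
Qed.

Lemma bCM k f g : bC k f -> bC k g -> bC k (fun x => f x * g x).
Proof.
have bb f' g' : (exists M, forall x, `|f' x| <= M) -> (exists M, forall x, `|g' x| <= M) ->
    exists M : R, forall x : R, `|f' x * g' x| <= M.
  move=> [M hM] [N hN]; exists (M * N) => x.
  by rewrite normrM ler_pM.
elim: k f g => [f g [cf qf] [cg qg]|k ih f g hf hg].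
  by split; [move=> x; apply: cvgM; [exact: cf|exact: cg]|exact: bb].
have hf0 := bCW hf; have hg0 := bCW hg.
move: hf hg => [bf [f' [df hf]]] [bg [g' [dg hg]]].
split; first exact: bb.
exists (fun x => f' x * g x + f x * g' x); split => [x|]; first exact: derM.
by apply: bCD; exact: ih.
Qed.

(** With [z = (x - m) / A], the derivative of [q(z)^s] is a multiple of [z q(z) q(z)^s], and that of
    [z q(z)] is a combination of [q(z)] and [(z q(z))^2]; the two families are therefore handled in
    one induction. *)
Lemma bC_q_powR (A m : R) k (s : R) : 0 < s -> A != 0 ->
  bC k (fun x => q ((x - m) / A) `^ s) /\
  bC k (fun x => (x - m) / A * q ((x - m) / A)).
Proof.
move=> s0 A0.
have dz (x : R) : is_derive x 1 (fun x => (x - m) / A) A^-1.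
  by apply: der_eq (derM (derB (derid x) (derC x m)) (derC x A^-1)) _; ring.
pose Q s x := q ((x - m) / A) `^ s; pose G x := (x - m) / A * q ((x - m) / A).
have bQ s' : 0 < s' -> exists M, forall x, `|Q s' x| <= M.
  move=> s'0; exists 1 => x; rewrite ger0_norm ?powR_ge0// powR_le1 ?(ltW s'0)//.
  by rewrite q_ge0 q_le1.
have bG : exists M, forall x, `|G x| <= M.
  exists 1 => x; rewrite /G; move: ((x - m) / A) => z.
  have p1 : 0 < 1 + z ^+ 2 by rewrite ltr_pwDl// sqr_ge0.
  rewrite normrM (ger0_norm (q_ge0 z)) ler_pdivrMr// mul1r ler_norml.
  have h1 := sqr_ge0 (z - 1); have h2 := sqr_ge0 (z + 1); rewrite !expr2 in h1 h2 *; apply/andP; split; lra.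
have dQ s' (x : R) : is_derive x 1 (Q s') (- (2 * s' / A) * (G x * Q s' x)).
  have d := der_comp (der_comp (dz x) (is_derive_q _)) (is_derive1_powR s' (q_gt0 _)).
  apply: der_eq d _.
  rewrite powRB ?powRr1 ?q_ge0//; last by rewrite (gt_eqF (q_gt0 _)) implybT.
  rewrite /G /Q; set X := _ `^ s'; set y := q _.
  by field; rewrite A0 gt_eqF// q_gt0.
have dG (x : R) : is_derive x 1 G (A^-1 * (Q 1 x + (-2) * (G x * G x))).
  have d := derM (dz x) (der_comp (dz x) (is_derive_q _)).
  apply: der_eq d _.
  by rewrite /Q powRr1 ?q_ge0// /G; field.
suff h : (forall s', 0 < s' -> bC k (Q s')) /\ bC k G by split; [exact: h.1|exact: h.2].
elim: k => [|k [ih1 ih2]].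
  split.
    move=> s' s'0; split; last exact: bQ.
    by move=> x; exact: (der_cont (dQ s' x)).
  by split => //; move=> x; exact: (der_cont (dG x)).
split.
  move=> s' s'0; split; first exact: bQ.
  exists (fun x => - (2 * s' / A) * (G x * Q s' x)); split => //.
  by apply: bCM; [exact: bC_cst|apply: bCM => //; exact: ih1].
split => //; exists (fun x => A^-1 * (Q 1 x + (-2) * (G x * G x))); split => //.
apply: bCM; first exact: bC_cst.
apply: bCD; first exact: ih1.
by apply: bCM; [exact: bC_cst|exact: bCM].
Qed.

End weight_smooth.

(** * Differences of the weight in near-far form *)

Section weight_bounds.
Context (R : realType).
Notation mu := (@lebesgue_measure R).
Variables (a A m : R).
Hypotheses (ha : 0 < a < 2) (hA : 0 < A).
Notation wt := (wt a A m).
Notation rh := (rh A m).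
Implicit Types (x y z h t : R) (G T : R -> R -> R) (f u v : R -> R).

Definition om x := Num.sqrt (wt x).
Definition phm x := phi a ((x - m) / A).

Lemma om_sqr x : om x ^+ 2 = wt x.
Proof. by rewrite sqr_sqrtr// wt_ge0. Qed.

Lemma om_gt0 x : 0 < om x.
Proof. by rewrite sqrtr_gt0 wt_gt0. Qed.

Let An0 : A != 0. Proof. by rewrite gt_eqF. Qed.

Lemma bC_wt k : bC k wt.
Proof.
have [a0 a2] := andP ha.
have -> : wt = (fun x => C_phi a / A * q ((x - m) / A) `^ ((1 + a) / 2)).
  by apply/funext => x; exact: wtE.
apply: bCM; first exact: bC_cst.
have p0 : 0 < (1 + a) / 2 by lra.
exact: (bC_q_powR m k p0 An0).1.
Qed.

Lemma bC_om k : bC k om.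
Proof.
have [a0 a2] := andP ha; have c0 := C_phi_gt0 ha.
have -> : om = (fun x => Num.sqrt (C_phi a / A) * q ((x - m) / A) `^ ((1 + a) / 4)).
  apply/funext => x; rewrite /om wtE sqrtrM ?divr_ge0 ?(ltW hA) ?(ltW c0)//.
  rewrite -[X in _ * X = _]powR12_sqrt ?powR_ge0// -powRrM.
  by congr (_ * _ `^ _); field.
apply: bCM; first exact: bC_cst.
have p0 : 0 < (1 + a) / 4 by lra.
exact: (bC_q_powR m k p0 An0).1.
Qed.

Lemma measurable_wt : measurable_fun setT wt.
Proof. exact: itg_measurable (itg_wt m ha hA). Qed.

Lemma measurable_om : measurable_fun setT om.
Proof. exact: continuous_measurable_fun (bC_continuous (bC_om 0)). Qed.

Lemma is_derive_phm (x : R) : is_derive x 1 phm (- wt x).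
Proof.
have dz : is_derive x 1 (fun x : R => (x - m) / A) A^-1.
  by apply: der_eq (derM (derB (derid x) (derC x m)) (derC x A^-1)) _; ring.
by apply: der_eq (der_comp dz (is_derive_phi ha _)) _; rewrite wtE; ring.
Qed.

Lemma phm_01 x : 0 <= phm x <= 1. Proof. exact: phi_01. Qed.

Lemma abs_phm x : `|phm x| <= 1.
Proof. by have /andP[h1 h2] := phm_01 x; rewrite ger0_norm. Qed.

(** Four measures of the variation of the weight. [S1], the trapezoidal defect [D2] and the second
    difference [S2] are of relative order two, hence admissible for all [a < 2]; [L1] is only of
    order one. *)
Definition S1 x h := (om x - om (x + h)) ^+ 2.
Definition D2 x h := `|(wt x + wt (x + h)) / 2 - mean_slope phm x h|.
Definition S2 x h := `|2 * wt x - wt (x + h) - wt (x - h)|.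
Definition L1 x h := `|wt x - wt (x + h)|.

Lemma m2X n G : m2 G -> m2 (fun x h => G x h ^+ n).
Proof. by move=> mG; exact: measurable_funX. Qed.

Lemma m2_abs G : m2 G -> m2 (fun x h => `|G x h|).
Proof. by move=> mG; exact: measurableT_comp. Qed.

Lemma m2_S1 : m2 S1.
Proof.
apply: (m2X 2 (G := fun x h => om x - om (x + h))).
by apply: m2B; [exact: (m2_fun1 measurable_om)|exact: (m2_shift measurable_om)].
Qed.

Lemma m2_L1 : m2 L1.
Proof.
apply: m2_abs; apply: m2B; first exact: (m2_fun1 measurable_wt).
exact: (m2_shift measurable_wt).
Qed.

Let mphm : measurable_fun setT phm.
Proof. by apply: continuous_measurable_fun => x; exact: (der_cont (is_derive_phm x)). Qed.

Lemma m2_mean_slope_phm : m2 (mean_slope phm).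
Proof.
apply: m2M; last exact: (m2_fun2 (@measurable_inv R)).
by apply: m2B; [exact: (m2_fun1 mphm)|exact: (m2_shift mphm)].
Qed.

Lemma m2_D2 : m2 D2.
Proof.
apply: m2_abs; apply: m2B; last exact: m2_mean_slope_phm.
apply: m2M; last exact: measurable_cst.
by apply: m2D; [exact: (m2_fun1 measurable_wt)|exact: (m2_shift measurable_wt)].
Qed.

Lemma m2_wt_left : m2 (fun x h => wt (x - h)).
Proof. by apply: (measurableT_comp measurable_wt); apply: measurable_funB. Qed.

Let w0 x : 0 <= wt x := wt_ge0 m ha hA x.

Lemma S1_le x y (P := om x) (Q := om y) : (P - Q) ^+ 2 <= wt x + wt y.
Proof.
rewrite -!om_sqr -/P -/Q.
have P0 : 0 < P := om_gt0 x; have Q0 : 0 < Q := om_gt0 y.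
have : 0 <= P * Q by rewrite mulr_ge0 ?ltW.
rewrite !expr2; lra.
Qed.

(** Since [wt x - wt y] factors as [(om x - om y) * (om x + om y)] and the second factor is at least
    [om x], a first order bound on [wt] yields a second order bound on [S1]. *)
Lemma S1_le_diff x y : wt x * (om x - om y) ^+ 2 <= (wt x - wt y) ^+ 2.
Proof.
rewrite -!om_sqr; have P0 := om_gt0 x; have Q0 := om_gt0 y.
rewrite subr_sqr exprMn mulrC ler_wpM2l ?sqr_ge0//.
apply: lerXn2r; rewrite ?nnegrE ?addr_ge0 ?(ltW P0) ?(ltW Q0)//.
by rewrite lerDl ltW.
Qed.

Let near_sqr (C W X E : R) : 0 < W -> `|E| <= C * W * X -> E ^+ 2 <= W * (C ^+ 2 * W * X ^+ 2).
Proof.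
move=> W0 hE; rewrite -(real_normK (num_real E)).
have -> : W * (C ^+ 2 * W * X ^+ 2) = (C * W * X) ^+ 2 by ring.
apply: lerXn2r; rewrite ?nnegrE//; exact: le_trans hE.
Qed.

Let wpos x : 0 < wt x := wt_gt0 m ha hA x.

Let far_le C x h X : 1 <= C -> 0 < h -> X <= wt x + wt (x + h) + wt (x - h) + h^-1 ->
  X <= C * (wt x + wt (x + h) + wt (x - h) + h^-1).
Proof.
move=> C1 h0 hX; apply: (le_trans hX); rewrite ler_peMl//.
by rewrite !addr_ge0// invr_ge0 ltW.
Qed.

(** The square of the first order constant 48, as [S1] requires; it exceeds 48, 384 and 768, so one
    constant serves all four quantities. *)
Let C0 : R := 48 ^+ 2.
Let C01 : 1 <= C0. Proof. by rewrite /C0 expr2; lra. Qed.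

Lemma NFb_S1 : NFb a A m 2 C0 S1.
Proof.
split=> x h h0; split.
- move=> hh; rewrite ger0_norm ?sqr_ge0//.
  rewrite -(ler_pM2l (wpos x)); apply: (le_trans (S1_le_diff _ _)).
  apply: near_sqr => //; rewrite distrC; apply: wt_diff_right => //.
  by rewrite (ltW h0).
- rewrite ger0_norm ?sqr_ge0//; apply: far_le => //.
  apply: (le_trans (S1_le _ _)); rewrite -addrA lerDl.
  by rewrite addr_ge0// invr_ge0 ltW.
- move=> hh; rewrite ger0_norm ?sqr_ge0// /S1 subrK -sqrrN opprB.
  rewrite -(ler_pM2l (wpos x)); apply: (le_trans (S1_le_diff _ _)).
  apply: near_sqr => //; apply: wt_diff_left => //.
  by rewrite (ltW h0).
- rewrite ger0_norm ?sqr_ge0//; apply: far_le => //; rewrite /S1 subrK.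
  apply: (le_trans (S1_le _ _)).
  have h1 := w0 (x + h); have h2 : 0 <= h^-1 by rewrite invr_ge0 ltW.
  lra.
Qed.

Lemma NFb_L1 : NFb a A m 1 C0 L1.
Proof.
have C048 : 48 <= C0 by rewrite /C0 expr2; lra.
have up x h : 0 < h -> 48 * wt x * (h / rh x) <= C0 * wt x * (h / rh x) ^+ 1.
  move=> h0; rewrite expr1 ler_wpM2r ?divr_ge0 ?(ltW h0) ?(ltW (rh_gt0 m hA x))//.
  by rewrite ler_wpM2r.
split=> x h h0; split.
- move=> hh; rewrite normr_id; apply: le_trans (up x h h0).
  by rewrite /L1 distrC; apply: wt_diff_right => //; rewrite (ltW h0).
- rewrite normr_id; apply: far_le => //; rewrite /L1.
  apply: (le_trans (ler_normB _ _)); rewrite !ger0_norm//.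
  by rewrite -addrA lerDl addr_ge0// invr_ge0 ltW.
- move=> hh; rewrite normr_id; apply: le_trans (up x h h0).
  by rewrite /L1 subrK distrC; apply: wt_diff_left => //; rewrite (ltW h0).
- rewrite normr_id; apply: far_le => //; rewrite /L1 subrK.
  apply: (le_trans (ler_normB _ _)); rewrite !ger0_norm//.
  have h1 := w0 (x + h); have h2 : 0 <= h^-1 by rewrite invr_ge0 ltW.
  lra.
Qed.

Lemma NF_S2 : NF a A m 2 C0 S2.
Proof.
have C0768 : 768 <= C0 by rewrite /C0 expr2; lra.
move=> x h h0; split.
- move=> hh; rewrite normr_id; apply: (@le_trans _ _ (768 * wt x * (h / rh x) ^+ 2)).
    by apply: wt_second_diff => //; rewrite (ltW h0).
  by rewrite ler_wpM2r ?sqr_ge0// ler_wpM2r.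
- rewrite normr_id; apply: (@le_trans _ _ (2 * (wt x + wt (x + h) + wt (x - h) + h^-1))).
    apply: (le_trans (ler_normB _ _)); rewrite (ger0_norm (w0 (x - h))).
    apply: (le_trans (lerD (ler_normB _ _) (lexx _))); rewrite (ger0_norm (w0 (x + h))).
    rewrite normrM (ger0_norm (w0 x)) (@ger0_norm _ 2)//.
    have h1 := w0 (x + h); have h3 := w0 (x - h); have h2 : 0 <= h^-1 by rewrite invr_ge0 ltW.
    lra.
  rewrite ler_wpM2r; [by []|by rewrite !addr_ge0// invr_ge0 ltW|lra].
Qed.

Lemma NFb_D2 : NFb a A m 2 C0 D2.
Proof.
have C0768 : 384 <= C0 by rewrite /C0 expr2; lra.
have up x h : 0 < h -> 384 * wt x / rh x ^+ 2 * h ^+ 2 <= C0 * wt x * (h / rh x) ^+ 2.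
  move=> h0; have -> : 384 * wt x / rh x ^+ 2 * h ^+ 2 = 384 * wt x * (h / rh x) ^+ 2.
    by field; rewrite gt_eqF// rh_gt0.
  by rewrite ler_wpM2r ?sqr_ge0// ler_wpM2r.
(* The mean slope is at most [1 / h] because the cut-off takes its values in [[0, 1]]. *)
have far x h : 0 < h -> D2 x h <= wt x + wt (x + h) + h^-1.
  move=> h0; apply: (le_trans (ler_normB _ _)); apply: lerD.
    have h1 := w0 x; have h2 := w0 (x + h).
    by rewrite ger0_norm; lra.
  rewrite /mean_slope normrM normfV (gtr0_norm h0) ler_piMl ?invr_ge0 ?(ltW h0)//.
  have /andP[? ?] := phm_01 x; have /andP[? ?] := phm_01 (x + h).
  rewrite ler_norml; apply/andP; split; lra.
split=> x h h0; split.
- move=> hh; rewrite normr_id; apply: le_trans (up x h h0).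
  apply: (trapezoid ha hA is_derive_phm h0) => z /andP[z1 z2].
  by rewrite -(subrK x z) addrC wt2_near// ger0_norm; lra.
- rewrite normr_id; apply: far_le => //; apply: (le_trans (far x h h0)).
  have h1 := w0 (x - h); lra.
- move=> hh; rewrite normr_id; apply: le_trans (up x h h0).
  apply: (trapezoid ha hA is_derive_phm h0) => z; rewrite subrK => /andP[z1 z2].
  by rewrite -(subrK x z) addrC wt2_near// ler0_norm; lra.
- rewrite normr_id; apply: far_le => //; apply: (le_trans (far (x - h) h h0)).
  rewrite subrK; have h1 := w0 (x + h); lra.
Qed.

End weight_bounds.

(** * Bilinear estimates *)

Section bilinear.
Context (R : realType).
Notation mu := (@lebesgue_measure R).
Variables (a A m : R).
Hypotheses (ha : 0 < a < 2) (hA : 0 < A).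
Notation wt := (wt a A m).
Notation om := (om a A m).
Notation phm := (phm a A m).
Notation rh := (rh A m).
Implicit Types (x y z h t : R) (G T : R -> R -> R) (f g u v : R -> R).

Let mw := measurable_wt m ha hA.
Let mo := measurable_om m ha hA.
Let bw k : bC k wt := bC_wt m ha hA k.
Let bo k : bC k om := bC_om m ha hA k.

Lemma qC_measurable k f : qC k f -> measurable_fun setT f.
Proof. by move=> hf; exact: continuous_measurable_fun (qC_continuous hf). Qed.

Lemma Bd_dl_qb f g : qC 1 f -> bC 1 g -> Bd (fun x h => dl f x h * dl g x h).
Proof.
move=> /dl_bound[C C0 hC] /dl_bound_b[D D0 hD]; exists (C * D) => x h h0.
rewrite normrM; apply: (le_trans (ler_pM (normr_ge0 _) (normr_ge0 _) (hC x h h0) (hD x h h0))).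
by rewrite -mh_sqr// le_eqVlt; apply/orP; left; apply/eqP; ring.
Qed.

Lemma itg_sqr_wt k u : qC k u -> itg mu (fun x => u x ^+ 2 * wt x).
Proof.
move=> hu; have [M hM] := bC_bounded (bC_wt m ha hA 0); have [N hN] := qd_bounded (qC_qd hu).
have i1 : itg mu (fun x => u x ^+ 2).
  by apply: eq_itg (itgMb (qC_itg hu) (qC_measurable hu) hN) => x; rewrite expr2.
exact: (itgMb i1 mw hM).
Qed.

Lemma I_sqr2_wt k u v : qC k u -> qC k v ->
  \int[mu]_x ((u x ^+ 2 + v x ^+ 2) * wt x) =
  \int[mu]_x (u x ^+ 2 * wt x) + \int[mu]_x (v x ^+ 2 * wt x).
Proof.
move=> hu hv; rewrite -ID; [|exact: itg_sqr_wt hu|exact: itg_sqr_wt hv].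
by apply: eqI => x; rewrite mulrDl.
Qed.

Let C0 : R := 48 ^+ 2.
Let C00 : 0 <= C0. Proof. exact: sqr_ge0. Qed.
Let a2n : a < 2%:R. Proof. by case/andP: ha. Qed.

Let G2 x h := 2 * wt x - wt (x + h) - wt (x - h).

Lemma m2_G2 : m2 G2.
Proof.
apply: m2B; last exact: m2_wt_left.
apply: m2B; last exact: (m2_shift mw).
by apply: m2M; [exact: measurable_cst|exact: (m2_fun1 mw)].
Qed.

Lemma NF_G2 : NF a A m 2 C0 G2.
Proof.
move=> x h h0; have [h1 h2] := NF_S2 m ha hA x h0; split; last by rewrite -normr_id.
by move=> hh; rewrite -normr_id; exact: h1.
Qed.

Lemma it2_second_diff u v : qC 1 u -> qC 1 v ->
  it2 (fun x h => K a h * (u x * v x * G2 x h)) /\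
  `|J (fun x h => K a h * (u x * v x * G2 x h))| <=
    C0 * CE a 2 * A `^ (- a) * \int[mu]_x ((u x ^+ 2 + v x ^+ 2) * wt x).
Proof.
move=> hu hv; have mu_ := qC_measurable hu; have mv := qC_measurable hv.
have [i1 b1] := near_far_J ha hA C00 a2n m2_G2 NF_G2 mu_ (itg_sqr_wt hu).
have [i2 b2] := near_far_J ha hA C00 a2n m2_G2 NF_G2 mv (itg_sqr_wt hv).
have iS := it2D (it2_abs i1) (it2_abs i2).
have mT : m2 (fun x h => K a h * (u x * v x * G2 x h)).
  apply: m2_K; apply: m2M; last exact: m2_G2.
  by apply: m2M; exact: m2_fun1.
have hT x h : `|K a h * (u x * v x * G2 x h)| <=
    `|K a h * (u x ^+ 2 * G2 x h)| + `|K a h * (v x ^+ 2 * G2 x h)|.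
  rewrite !(normrM (K a h)) -mulrDr ler_wpM2l// !(normrM _ (G2 x h)) -mulrDl ler_wpM2r//.
  rewrite !(ger0_norm (sqr_ge0 _)) ler_norml !expr2.
  by apply/andP; split; nra.
split; first exact: it2_dom iS mT hT.
apply: (le_trans (le_abs_J iS mT hT)); rewrite JD; [|exact: it2_abs|exact: it2_abs].
by rewrite (I_sqr2_wt hu hv) mulrDr; exact: lerD.
Qed.

(** Summation by parts: translating the terms with the product [u v] at [x + h] collects the first
    differences of [wt] into a second difference. *)
Lemma J_second_diff u v : qC 1 u -> qC 1 v ->
  J (fun x h => K a h * (dl (fun y => u y * v y) x h * dl wt x h)) =
  J (fun x h => K a h * (u x * v x * G2 x h)).
Proof.
move=> hu hv; pose f x := u x * v x.
have hf : qC 1 f := qCM hu (qC_bC hv).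
have i1 : it2 (fun x h => K a h * (dl f x h * dl wt x h)).
  apply: Bd_it2 => //; last exact: Bd_dl_qb.
  by apply: m2M; apply: m2_dl => //; exact: qC_measurable hf.
rewrite (J21 i1) (J21 (it2_second_diff hu hv).1); apply: eqI => h.
have [M hM] := bC_bounded (bw 0).
have iF := qC_itg hf.
have iW g : measurable_fun setT g -> (forall x, `|g x| <= M) -> itg mu (fun x => f x * g x).
  by move=> mg hg; exact: (itgMb iF mg hg).
have mws c : measurable_fun setT (fun x => wt (x + c)).
  by apply: (measurableT_comp mw); apply: measurable_funD.
have j1 := iW wt mw hM.
have j2 := iW _ (mws h) (fun x => hM (x + h)).
have j3 := iW _ (mws (- h)) (fun x => hM (x + - h)).
have j1s := itg_shift h j1; have j3s := itg_shift h j3; rewrite /= in j1s j3s.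
have e1 := I_shift h j1; have e3 := I_shift h j3.
have k12 := itgB j1 j2.
have j3s' : itg mu (fun x => f (x + h) * wt x).
  by apply: eq_itg j3s => x; rewrite addrK.
have -> : \int[mu]_x (K a h * (dl f x h * dl wt x h)) =
   \int[mu]_x (K a h * (f x * wt x - f x * wt (x + h) + (f (x + h) * wt (x + h) - f (x + h) * wt x))).
  by apply: eqI => x; rewrite /dl; ring.
have kk1 := itgB j1s j3s'.
rewrite IZ; last exact: itgD k12 kk1.
rewrite (ID k12 kk1) (IB j1 j2) (IB j1s j3s') e1.
have -> : \int[mu]_x (f (x + h) * wt x) = \int[mu]_x (f x * wt (x + - h)).
  by rewrite -e3; apply: eqI => x; rewrite addrK.
have -> : \int[mu]_x (K a h * (f x * G2 x h)) =
   \int[mu]_x (K a h * (f x * wt x - f x * wt (x + h) + (f x * wt x - f x * wt (x + - h)))).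
  by apply: eqI => x; rewrite /G2; ring.
have kk2 := itgB j1 j3.
by rewrite (IZ _ (itgD k12 kk2)) (ID k12 kk2) (IB j1 j2) (IB j1 j3).
Qed.

Section quadratic.
Variables (u v : R -> R).
Hypotheses (hu : qC 1 u) (hv : qC 1 v).
Notation us := (fun y => u y * om y).
Notation vs := (fun y => v y * om y).
Let D := \int[mu]_x ((u x ^+ 2 + v x ^+ 2) * wt x).
Let Y := A `^ (- a).
Let mu_ := qC_measurable hu.
Let mv := qC_measurable hv.
Let mm2 f : measurable_fun setT f -> m2 (fun x h => f x) /\ m2 (fun x h => f (x + h)).
Proof. by move=> mf; split; [exact: m2_fun1|exact: m2_shift]. Qed.
Let iu := itg_sqr_wt hu.
Let iv := itg_sqr_wt hv.

(** The two integrands differ exactly by [- u x * u (x + h) * S1], a quantity of second order. *)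
Lemma form_sym_bound :
  `|J (fun x h => K a h * (dl u x h * dl (fun y => u y * wt y) x h))
    - J (fun x h => K a h * (dl us x h * dl us x h))| <=
  2 * C0 * CE a 2 * Y * \int[mu]_x (u x ^+ 2 * wt x).
Proof.
have huw : qC 1 (fun y => u y * wt y) := qCM hu (bw 1).
have huo : qC 1 us := qCM hu (bo 1).
have i1 := it2_dl2 ha hu huw; have i2 := it2_dl2 ha huo huo.
rewrite -(JB i1 i2).
have [mu1 mu2] := mm2 mu_; have mS := m2_S1 m ha hA.
pose T x h := u x * u (x + h) * S1 a A m x h.
have mT : m2 T by apply: m2M => //; exact: m2M.
have S0 x h : 0 <= S1 a A m x h := sqr_ge0 _.
have [iT bT] : it2 (fun x h => K a h * T x h) /\
    J (fun x h => `|K a h * T x h|) <= 2 * C0 * CE a 2 * A `^ (- a) * \int[mu]_x (u x ^+ 2 * wt x).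
  apply: (AM_bound ha hA C00 a2n mS (NFb_S1 m ha hA) S0 mu_ iu mT) => x h h0.
  rewrite normrM (ger0_norm (S0 x h)) ler_wpM2r// ler_norml !expr2; apply/andP; split; nra.
have -> : J (fun x h => K a h * (dl u x h * dl (fun y => u y * wt y) x h) -
     K a h * (dl us x h * dl us x h)) = J (fun x h => (-1) * (K a h * T x h)).
  by apply: eqJ => x h; rewrite /T /S1 /dl /= -!(om_sqr m ha hA); ring.
rewrite JZ// mulN1r normrN; apply: le_trans bT.
by apply: le_abs_J => //; [exact: it2_abs|exact: it2_m2].
Qed.

Lemma it2_flow : it2 (fun x h => K a h * (dl u x h * dl v x h *
   (wt x + wt (x + h) - (1 + a) * mean_slope phm x h))).
Proof.
have [M hM] := bC_bounded (bw 0); have [w1 w2] := mm2 mw.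
have mS := m2_mean_slope_phm A m ha.
apply: Bd_it2 => //.
  apply: m2M; first by apply: m2M; exact: m2_dl.
  by apply: m2B; [exact: m2D|apply: m2M => //; exact: measurable_cst].
apply: (@BdM _ (M + M + `|1 + a| * M)); first exact: Bd_dl2.
move=> x h h0; apply: (le_trans (ler_normB _ _)); apply: lerD.
  exact: (le_trans (ler_normD _ _) (lerD (hM _) (hM _))).
rewrite normrM ler_wpM2l//; apply: (abs_mean_slope (is_derive_phm A m ha)) => //.
Qed.

(* With a = u(x), b = u(x+h), p = v(x), q = v(x+h), P = om(x), Q = om(x+h), the integrand is
   (1+alpha) (a-b) (p-q) ((w+w')/2 - W) + (alpha-1)/2 ((a p - b q) (w-w') + (a q + b p) (P-Q)^2),
   where w = w(x), w' = w(x+h) and W is the mean slope; only (a p - b q) (w-w') has a first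
   order difference of w, and translation turns it into a second order one. *)
Lemma form_flow_bound :
  `|J (fun x h => K a h * (dl u x h * dl v x h *
        (wt x + wt (x + h) - (1 + a) * mean_slope phm x h)))
    + (a - 1) * J (fun x h => K a h * (dl us x h * dl vs x h))| <=
  9 * C0 * CE a 2 * Y * D.
Proof.
have huo : qC 1 us := qCM hu (bo 1).
have hvo : qC 1 vs := qCM hv (bo 1).
have i2 := it2_dl2 ha huo hvo.
have [mu1 mu2] := mm2 mu_; have [mv1 mv2] := mm2 mv.
have [mw1 mw2] := mm2 mw.
pose T1 x h := dl u x h * dl v x h * ((wt x + wt (x + h)) / 2 - mean_slope phm x h).
pose T2 x h := (u x * v (x + h) + u (x + h) * v x) * S1 a A m x h.
have mT1 : m2 T1.
  apply: m2M; first by apply: m2M; exact: m2_dl.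
  apply: m2B; last exact: m2_mean_slope_phm.
  by apply: m2M; [exact: m2D|exact: measurable_cst].
have mT2 : m2 T2.
  apply: m2M; last exact: m2_S1.
  by apply: m2D; exact: m2M.
have S0 x h : 0 <= S1 a A m x h := sqr_ge0 _.
have D0 x h : 0 <= D2 a A m x h := normr_ge0 _.
have [iT1 bT1] : it2 (fun x h => K a h * T1 x h) /\
    J (fun x h => `|K a h * T1 x h|) <= 2 * C0 * CE a 2 * Y * D.
  apply: (AM2_bound ha hA C00 a2n (m2_D2 m ha hA) (NFb_D2 m ha hA) D0 mu_ mv iu iv mT1) => x h h0.
  rewrite normrM ler_wpM2r// /dl ler_norml !expr2; apply/andP.
  have := sqr_ge0 (u (x + h) + u x); have := sqr_ge0 (v (x + h) + v x).
  have := sqr_ge0 (u (x + h) - u x - (v (x + h) - v x)).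
  have := sqr_ge0 (u (x + h) - u x + (v (x + h) - v x)).
  by rewrite !expr2 => *; split; nra.
have [iT2 bT2] : it2 (fun x h => K a h * T2 x h) /\
    J (fun x h => `|K a h * T2 x h|) <= 2 * C0 * CE a 2 * Y * D.
  apply: (AM2_bound ha hA C00 a2n (m2_S1 m ha hA) (NFb_S1 m ha hA) S0 mu_ mv iu iv mT2) => x h h0.
  rewrite normrM (ger0_norm (S0 x h)) ler_wpM2r// ler_norml !expr2; apply/andP.
  have := sqr_ge0 (u (x + h) - v x); have := sqr_ge0 (u x - v (x + h)).
  have := sqr_ge0 (u (x + h) + v x); have := sqr_ge0 (u x + v (x + h)).
  by rewrite !expr2 => *; split; nra.
have [iG bG] := it2_second_diff hu hv.
have i3 : it2 (fun x h => K a h * (dl (fun y => u y * v y) x h * dl wt x h)).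
  have hf : qC 1 (fun x => u x * v x) := qCM hu (qC_bC hv).
  apply: Bd_it2 => //; last exact: Bd_dl_qb.
  by apply: m2M; apply: m2_dl => //; exact: qC_measurable hf.
rewrite -(JZ _ i2) -(JD it2_flow (it2Z _ i2)).
have -> : J (fun x h => K a h * (dl u x h * dl v x h *
        (wt x + wt (x + h) - (1 + a) * mean_slope phm x h)) +
        (a - 1) * (K a h * (dl us x h * dl vs x h))) =
   J (fun x h => (1 + a) * (K a h * T1 x h) + ((a - 1) / 2 *
     (K a h * (dl (fun y => u y * v y) x h * dl wt x h)) + (a - 1) / 2 * (K a h * T2 x h))).
  by apply: eqJ => x h; rewrite /T1 /T2 /S1 /dl /= -!(om_sqr m ha hA); field.
rewrite JD; [|exact: it2Z|by apply: it2D; exact: it2Z].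
rewrite JD; [|exact: it2Z|exact: it2Z].
rewrite !JZ// J_second_diff//.
have aT T : it2 (fun x h => K a h * T x h) ->
    `|J (fun x h => K a h * T x h)| <= J (fun x h => `|K a h * T x h|).
  by move=> iT; apply: le_abs_J => //; [exact: it2_abs|exact: it2_m2].
have b1 := le_trans (aT _ iT1) bT1; have b2 := le_trans (aT _ iT2) bT2.
rewrite -/Y -/D in bG.
set Z := C0 * CE a 2 * Y * D in bG.
have Z0 : 0 <= Z by apply: le_trans bG.
rewrite (_ : 2 * C0 * CE a 2 * Y * D = 2 * Z) in b1 b2; try by rewrite /Z; ring.
rewrite (_ : 9 * C0 * CE a 2 * Y * D = 9 * Z); last by rewrite /Z; ring.
have [a0 a2] := andP ha.
have c1 : `|(a - 1) / 2| <= 2^-1.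
  by rewrite ler_norml; apply/andP; split; lra.
apply: (le_trans (ler_normD _ _)); rewrite normrM (@ger0_norm _ (1 + a)); last by lra.
(* Here [1 + a <= 3] and [|a - 1| / 2 <= 1 / 2], and the total [6 + 1 / 2 + 1] is below 9. *)
apply: (@le_trans _ _ (3 * (2 * Z) + (2^-1 * Z + 2^-1 * (2 * Z)))); last by lra.
apply: lerD; first by apply: ler_pM => //; lra.
apply: (le_trans (ler_normD _ _)); rewrite !(normrM ((a - 1) / 2)).
by apply: lerD; apply: ler_pM.
Qed.

(** The diagonal products [u v w] cancel, and what is left carries a first order difference of [wt]
    only. *)
Lemma form_antisym :
  J (fun x h => K a h * (dl u x h * dl (fun y => v y * wt y) x h))
  - J (fun x h => K a h * (dl v x h * dl (fun y => u y * wt y) x h)) =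
  J (fun x h => K a h * ((u x * v (x + h) - u (x + h) * v x) * (wt x - wt (x + h)))) /\
  it2 (fun x h => K a h * ((u x * v (x + h) - u (x + h) * v x) * (wt x - wt (x + h)))).
Proof.
have hvw : qC 1 (fun y => v y * wt y) := qCM hv (bw 1).
have huw : qC 1 (fun y => u y * wt y) := qCM hu (bw 1).
have i1 := it2_dl2 ha hu hvw; have i2 := it2_dl2 ha hv huw.
split; last by apply: eq_it2 (it2B i1 i2) => x h; rewrite /dl; ring.
by rewrite -JB//; apply: eqJ => x h; rewrite /dl; ring.
Qed.

(** For [a < 1] relative order one already beats the singularity of the kernel, so [L1] can be used
    with [n = 1]. *)
Lemma form_antisym_bound_lt1 : a < 1 ->
  `|J (fun x h => K a h * ((u x * v (x + h) - u (x + h) * v x) * (wt x - wt (x + h))))| <=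
  2 * C0 * CE a 1 * Y * D.
Proof.
move=> a1; have [mu1 mu2] := mm2 mu_; have [mv1 mv2] := mm2 mv; have [mw1 mw2] := mm2 mw.
pose T x h := (u x * v (x + h) - u (x + h) * v x) * (wt x - wt (x + h)).
have mT : m2 T by apply: m2M; [apply: m2B; exact: m2M|exact: m2B].
have L0 x h : 0 <= L1 a A m x h := normr_ge0 _.
have [iT bT] : it2 (fun x h => K a h * T x h) /\
    J (fun x h => `|K a h * T x h|) <= 2 * C0 * CE a 1 * Y * D.
  apply: (AM2_bound ha hA C00 _ (m2_L1 m ha hA) (NFb_L1 m ha hA) L0 mu_ mv iu iv mT) => // x h h0.
  rewrite normrM ler_wpM2r// ler_norml !expr2; apply/andP.
  have := sqr_ge0 (u (x + h) - v x); have := sqr_ge0 (u x - v (x + h)).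
  have := sqr_ge0 (u (x + h) + v x); have := sqr_ge0 (u x + v (x + h)).
  by rewrite !expr2 => *; split; nra.
apply: le_trans bT.
by apply: le_abs_J => //; [exact: it2_abs|exact: it2_m2].
Qed.

End quadratic.

End bilinear.

(** * The commutator for alpha = 1 *)

Section hilbert_form.
Context (R : realType).
Notation mu := (@lebesgue_measure R).
Implicit Types (f g : R -> R) (e : R).

(** The conjugate Poisson kernel, a bounded regularisation of [1 / t]. *)
Definition hk e (t : R) : R := t / (e ^+ 2 + t ^+ 2).

Lemma measurable_hk e : 0 < e -> measurable_fun setT (hk e).
Proof.
move=> e0; apply: continuous_measurable_fun => x.
apply: cvgM; first exact: cvg_id.
apply: cvgV; first exact: sumsq_neq0.
by apply: cvgD; [exact: cvg_cst|apply: exprn_continuous].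
Qed.

Lemma abs_hk e t : 0 < e -> `|hk e t| <= e^-1.
Proof.
move=> e0; have p : 0 < e ^+ 2 + t ^+ 2 by rewrite ltr_wpDr ?sqr_ge0// exprn_gt0.
rewrite /hk normrM normfV (gtr0_norm p) ler_pdivrMr// ler_pdivlMl//.
have := sqr_ge0 (e - `|t|); rewrite -(real_normK (num_real t)) !expr2.
have := sqr_ge0 (e + `|t|); rewrite !expr2; nra.
Qed.

Definition exp_sgn e (t : R) := expR (- (e * `|t|)) * sgn0 t.

Lemma itg_exp_sgn e : 0 < e -> itg mu (exp_sgn e).
Proof. by move=> e0; exact: (itgMb (itg_exp_abs e0) (@measurable_sgn0 R) (@abs_sgn0 R)). Qed.

Lemma I_exp_sgn_cas e x y : 0 < e ->
  \int[mu]_t (exp_sgn e t * (cas (x * - t) * cas (t * y))) = 2 * hk e (y - x).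
Proof.
move=> e0; have iE := itg_exp_sgn e0.
have i1 := itgMb iE (measurable_cosM (- (x + y))) (fun t => abs_cos (t * - (x + y))).
have i2 := itgMb iE (measurable_sinM (y - x)) (fun t => abs_sin (t * (y - x))).
transitivity (\int[mu]_t (exp_sgn e t * cos (t * - (x + y)) + exp_sgn e t * sin (t * (y - x)))).
  by apply: eqI => t; rewrite casM -mulrDr; congr (_ * (cos _ + sin _)); ring.
rewrite ID// (I_odd i1) ?add0r.
  by rewrite /hk -poisson_sin//; apply: eqI => t; rewrite /exp_sgn mulrA.
by move=> t; rewrite /exp_sgn sgn0N normrN mulNr cosN; ring.
Qed.

(** On the Hartley side a Hilbert transform is the multiplier sign composed with a reflection of the
    frequency; the exponential factor smooths [1 / t] into [hk e]. *)
Lemma hart_exp_sgn e f y : 0 < e -> itg mu f ->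
  hart (fun t => exp_sgn e t * hart f (- t)) y = \int[mu]_x (f x * (2 * hk e (y - x))).
Proof.
move=> e0 hf; have iE := itg_exp_sgn e0; have mf := itg_measurable hf.
pose F (t x : R) := exp_sgn e t * f x * (cas (x * - t) * cas (t * y)).
have iF : it2 F.
  apply: (it2_dom (it2Z 4 (it2_abs (it2_tensor iE hf)))).
    apply: measurable_funM; first exact: (it2_m2 (it2_tensor iE hf)).
    apply: measurable_funM; apply: (measurableT_comp (@measurable_cas R)); last exact: measurable_funM.
    by apply: measurable_funM => //; exact: measurable_funN.
  move=> t x; rewrite /F normrM mulrC ler_wpM2r// normrM.
  have := abs_cas (x * - t); have := abs_cas (t * y).
  have := normr_ge0 (cas (x * - t)); have := normr_ge0 (cas (t * y)); nra.
transitivity (\int[mu]_t \int[mu]_x F t x).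
  apply: eqI => t; rewrite /hart -IZ; last exact: itg_hart.
  rewrite -IZr; last by apply: itgZ; exact: itg_hart.
  by apply: eqI => x; rewrite /F; ring.
rewrite -J12// J21//; apply: eqI => x.
rewrite -I_exp_sgn_cas// -IZ; first by apply: eqI => t; rewrite /F; ring.
have b t : `|cas (x * - t) * cas (t * y)| <= 4.
  rewrite normrM; have := abs_cas (x * - t); have := abs_cas (t * y).
  have := normr_ge0 (cas (x * - t)); have := normr_ge0 (cas (t * y)); nra.
apply: (itgMb iE _ b); apply: measurable_funM; last exact: measurable_casM.
apply: (measurableT_comp (@measurable_cas R)); exact: measurable_funM.
Qed.

Lemma it2_hk e f g : 0 < e -> itg mu f -> itg mu g ->
  it2 (fun x h => hk e h * (f x * g (x + h))) /\
  it2 (fun x h => hk e h * (f (x + h) * g x)).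
Proof.
move=> e0.
have hw f' g' : itg mu f' -> itg mu g' -> it2 (fun x h => hk e h * (f' x * g' (x + h))).
  move=> hf hg; have i := it2_swap (it2_shear 1 (it2_tensor hg hf)).
  have i' : it2 (fun x h => f' x * g' (x + h)).
    by apply: eq_it2 i => x h; rewrite mul1r mulrC [h + x]addrC.
  apply: (it2_dom (it2Z e^-1 (it2_abs i'))).
    apply: m2M; last exact: (it2_m2 i').
    exact: (m2_fun2 (measurable_hk e0)).
  by move=> x h; rewrite normrM ler_wpM2r// abs_hk.
move=> hf hg; split; first exact: hw.
by apply: eq_it2 (hw g f hg hf) => x h; congr (_ * _); rewrite mulrC.
Qed.

Definition hilbert e f g : R :=
  J (fun x h => pos h * (hk e h * (f x * g (x + h) - f (x + h) * g x))).

Lemma it2_pos (G : R -> R -> R) : it2 G -> it2 (fun x h => pos h * G x h).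
Proof.
move=> iG; apply: (it2_dom (it2_abs iG)).
  apply: m2M; last exact: (it2_m2 iG).
  exact: (m2_fun2 (@measurable_pos R)).
by move=> x h; rewrite normrM ler_piMl// pos_le1.
Qed.

(** Translating the second product by [- h] and using that [hk e] is odd unfolds the half-line
    integral to the full line. *)
Lemma hilbert_full e f g : 0 < e -> itg mu f -> itg mu g ->
  hilbert e f g = J (fun x h => hk e h * (f x * g (x + h))).
Proof.
move=> e0 hf hg; have [i1 i2] := it2_hk e0 hf hg.
have p1 := it2_pos i1; have p2 := it2_pos i2.
transitivity (J (fun x h => pos h * (hk e h * (f x * g (x + h)))) -
    J (fun x h => pos h * (hk e h * (f (x + h) * g x)))).
  by rewrite -JB//; apply: eqJ => x h; ring.
rewrite -(J_shear (-1) p2); have p2' := it2_shear (-1) p2.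
rewrite -(JB p1 p2') (J12 (it2B p1 p2')) (J12 i1).
apply: eqI => x; rewrite [RHS]I_half.
  apply: eqI => h; rewrite mulN1r addrNK /hk sqrrN; ring.
have ig : itg mu (fun h => f x * g (x + h)).
  by apply: itgZ; apply: eq_itg (itg_shift x hg) => h; rewrite addrC.
have := itgMb ig (measurable_hk e0) (fun h => abs_hk h e0).
by apply: eq_itg => h; rewrite mulrC.
Qed.

Lemma hilbert_hart e f g : 0 < e -> nice f -> nice g ->
  2 * hilbert e f g = \int[mu]_t (exp_sgn e t * hart f (- t) * hart g t).
Proof.
move=> e0 [cf hf [M fM]] [cg hg [N gN]]; rewrite hilbert_full//.
have iE := itg_exp_sgn e0.
have mh : measurable_fun setT (fun t : R => hart f (- t)).
  by apply: (measurableT_comp (measurable_hart hf)); exact: measurable_funN.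
have iP := itgMb iE mh (fun t => abs_hart (- t) hf).
rewrite -(hart_swap iP hg).
have [i1 _] := it2_hk e0 hf hg.
pose F (y x : R) := hk e (y - x) * (f x * g y).
have iF : it2 F.
  apply: eq_it2 (it2_shear (-1) (it2_swap i1)) => y x.
  by rewrite mulN1r /F [x + (y - x)]addrC subrK.
have e1 : J F = J (fun x h => hk e h * (f x * g (x + h))).
  rewrite -(J_shear 1 iF) -J_swap; last exact: it2_shear.
  by apply: eqJ => x h; rewrite /F mul1r addrK [h + x]addrC.
rewrite -e1 J12// -IZ; last exact: it2_itg1.
apply: eqI => y; rewrite hart_exp_sgn//.
have mk : measurable_fun setT (fun x : R => hk e (y - x)).
  by apply: (measurableT_comp (measurable_hk e0)); exact: measurable_funB.
have ik := itgMb hf mk (fun x : R => abs_hk (y - x) e0).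
rewrite -IZ; last by apply: eq_itg (itgZr (g y) ik) => x; rewrite /F; ring.
rewrite -IZr; first by apply: eqI => x; rewrite /F; ring.
by apply: eq_itg (itgZ 2 ik) => x; ring.
Qed.

(** The multiplier [exp_sgn] is bounded by one, so the bound is uniform in [e]. The parameter [l]
    balances two factors whose sizes scale differently in [A]. *)
Lemma hilbert_bound e l f g : 0 < e -> 0 < l -> nice f -> nice g ->
  `|hilbert e f g| <= pi / 2 *
    (l * \int[mu]_x (f x * f x) + l^-1 * \int[mu]_x (g x * g x)).
Proof.
move=> e0 l0 nf ng; have [cf hf _] := nf; have [cg hg _] := ng.
have iE := itg_exp_sgn e0.
have i1 := itgZ (l / 2) (itg_opp (itg_hart2 nf)).
have i2 := itgZ (l^-1 / 2) (itg_hart2 ng).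
have mh : measurable_fun setT (fun t : R => hart f (- t)).
  by apply: (measurableT_comp (measurable_hart hf)); exact: measurable_funN.
have b : `|\int[mu]_t (exp_sgn e t * hart f (- t) * hart g t)| <=
   \int[mu]_t (l / 2 * (hart f (- t) * hart f (- t)) + l^-1 / 2 * (hart g t * hart g t)).
  apply: le_abs_Idom; first exact: itgD.
    apply: measurable_funM; last exact: measurable_hart.
    by apply: measurable_funM => //; exact: itg_measurable iE.
  move=> t; rewrite -mulrA normrM.
  have E1 : `|exp_sgn e t| <= 1.
    rewrite /exp_sgn normrM (ger0_norm (expR_ge0 _)).
    by apply: mulr_ile1; rewrite ?expR_ge0 ?expN_le1 ?abs_sgn0.
  apply: (@le_trans _ _ (1 * `|hart f (- t) * hart g t|)); first by rewrite ler_wpM2r.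
  rewrite mul1r ler_norml.
  set a := hart f (- t); set c := hart g t.
  have l1 : l * l^-1 = 1 by rewrite mulfV// gt_eqF.
  have li : 0 < l^-1 by rewrite invr_gt0.
  have k1 := mulr_ge0 (ltW li) (sqr_ge0 (l * a - c)).
  have k2 := mulr_ge0 (ltW li) (sqr_ge0 (l * a + c)).
  have x1 : l^-1 * (l * a - c) ^+ 2 = l * (a * a) - 2 * (a * c) + l^-1 * (c * c).
    by field; rewrite gt_eqF.
  have x2 : l^-1 * (l * a + c) ^+ 2 = l * (a * a) + 2 * (a * c) + l^-1 * (c * c).
    by field; rewrite gt_eqF.
  by rewrite x1 in k1; rewrite x2 in k2; apply/andP; split; lra.
rewrite (ID i1 i2) (IZ _ (itg_opp (itg_hart2 nf))) (IZ _ (itg_hart2 ng)) in b.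
rewrite (I_opp (itg_hart2 nf)) !parseval// -hilbert_hart// in b.
rewrite normrM (@ger0_norm _ 2)// in b.
have := b; set X := `|hilbert e f g|; set P := \int[mu]_x _; set Q := \int[mu]_x _.
move: (pi : R) => p {}b.
suff : 2 * X <= 2 * (p / 2 * (l * P + l^-1 * Q)) by rewrite ler_pM2l.
apply: (le_trans b); rewrite le_eqVlt; apply/orP; left; apply/eqP.
by field; rewrite gt_eqF.
Qed.

End hilbert_form.

(** * The weight at alpha = 1 *)

Section critical.
Context (R : realType).
Notation mu := (@lebesgue_measure R).
Variables (A m : R).
Hypothesis hA : 0 < A.
Notation wt := (wt 1 A m).
Let ha : (0 : R) < (1 : R) < (2 : R). Proof. by apply/andP; split; lra. Qed.
Implicit Types (x y h : R) (u v : R -> R).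

Let z x := (x - m) / A.
(** In the variable [z], the conjugate Poisson profile that accompanies the Poisson profile [q(z)]
    of the weight. *)
Definition G1 x := z x * q (z x).

Let An0 : A != 0. Proof. by rewrite gt_eqF. Qed.

Lemma wt_one x : wt x = C_phi 1 / A * q (z x).
Proof. by rewrite wtE (_ : (1 + 1) / 2 = 1) ?powRr1 ?q_ge0//; field. Qed.

(* The factor h cancels one power of the kernel and leaves two Hilbert transforms. *)
Lemma wt_diff_one x h :
  wt x - wt (x + h) = h * A^-1 * (G1 x * wt (x + h) + wt x * G1 (x + h)).
Proof.
rewrite !wt_one /G1 (_ : z (x + h) = z x + h / A); last by rewrite /z; field.
rewrite /q; move: (z x) => t; set b := t + h / A.
have p t' : 1 + t' ^+ 2 != 0 :> R by rewrite gt_eqF// ltr_pwDl// sqr_ge0.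
have -> : h = A * (b - t) by rewrite /b; field.
by field; rewrite An0 !p.
Qed.

Lemma G1_sqr x : G1 x ^+ 2 <= A / C_phi 1 * wt x.
Proof.
have c0 := C_phi_gt0 ha.
rewrite wt_one mulrA (_ : A / C_phi 1 * (C_phi 1 / A) = 1) ?mul1r; last first.
  by field; rewrite An0 gt_eqF.
rewrite /G1 /q; set t := z x; have p : 0 < 1 + t ^+ 2 by rewrite ltr_pwDl// sqr_ge0.
rewrite (_ : (t / (1 + t ^+ 2)) ^+ 2 = t ^+ 2 / (1 + t ^+ 2) * (1 + t ^+ 2)^-1); last first.
  by field; rewrite gt_eqF.
by rewrite ler_piMl ?invr_ge0 ?(ltW p)// ler_pdivrMr// mul1r lerDr.
Qed.

Lemma wt_le x : wt x <= C_phi 1 / A.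
Proof.
by rewrite wt_one ler_piMr ?q_le1// divr_ge0 ?(ltW hA)// ltW// C_phi_gt0.
Qed.

(** By [wt_diff_one] the kernel [h^(-2)] loses one power and the form becomes [1 / A] times two
    Hilbert forms. They are regularised by [hk], bounded by [pi / 2] times the weighted norm each,
    and the regularisation is removed by dominated convergence. *)
Lemma form_antisym_bound_eq1 u v : qC 1 u -> qC 1 v ->
  `|J (fun x h => K 1 h * ((u x * v (x + h) - u (x + h) * v x) * (wt x - wt (x + h))))| <=
  pi / A * \int[mu]_x ((u x ^+ 2 + v x ^+ 2) * wt x).
Proof.
move=> hu hv; have c0 := C_phi_gt0 ha.
set D := \int[mu]_x _.
pose F x h := K 1 h * ((u x * v (x + h) - u (x + h) * v x) * (wt x - wt (x + h))).
have iF : it2 F := (form_antisym m ha hA hu hv).2.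
have bG : bC 1 G1 := (bC_q_powR m 1 ltr01 An0).2.
have bw : bC 1 wt := bC_wt m ha hA 1.
have iu := itg_sqr_wt m ha hA hu; have iv := itg_sqr_wt m ha hA hv.
pose Iu := \int[mu]_x (u x ^+ 2 * wt x); pose Iv := \int[mu]_x (v x ^+ 2 * wt x).
have DE : D = Iu + Iv := I_sqr2_wt m ha hA hu hv.
have nG f : qC 1 f -> nice (fun x => f x * G1 x) by move=> hf; exact: qC_nice (qCM hf bG).
have nW f : qC 1 f -> nice (fun x => f x * wt x) by move=> hf; exact: qC_nice (qCM hf bw).
have sq (f g : R -> R) c : 0 <= c -> itg mu (fun x => f x ^+ 2 * wt x) ->
    (forall x, g x ^+ 2 <= c * wt x) -> measurable_fun setT (fun x => f x * g x) ->
    \int[mu]_x ((f x * g x) * (f x * g x)) <= c * \int[mu]_x (f x ^+ 2 * wt x).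
  move=> c_ge0 iw hg mfg; rewrite -IZ//.
  have b x : f x * g x * (f x * g x) <= c * (f x ^+ 2 * wt x).
    have -> : f x * g x * (f x * g x) = f x ^+ 2 * g x ^+ 2 by ring.
    by rewrite [leRHS]mulrCA ler_wpM2l ?sqr_ge0.
  apply: le_I => //; last exact: itgZ.
  apply: (itg_dom (itgZ c iw)) => [|x]; first exact: measurable_funM.
  by rewrite ger0_norm -?expr2 ?sqr_ge0// expr2.
have w2 x : wt x ^+ 2 <= C_phi 1 / A * wt x.
  by rewrite expr2 ler_wpM2r ?wt_le ?wt_ge0.
have cA0 : 0 < C_phi 1 / A by rewrite divr_gt0.
have Ac0 : 0 < A / C_phi 1 by rewrite divr_gt0.
have mGf f : qC 1 f -> measurable_fun setT (fun x => f x * G1 x).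
  by move=> hf; exact: qC_measurable (qCM hf bG).
have mWf f : qC 1 f -> measurable_fun setT (fun x => f x * wt x).
  by move=> hf; exact: qC_measurable (qCM hf bw).
have li : (C_phi 1 / A)^-1 = A / C_phi 1 by rewrite invf_div.
(* The choice [l = C_phi / A] compensates [G1^2 <= (A / C_phi) wt] on one side and
   [wt^2 <= (C_phi / A) wt] on the other; the mirrored form takes the inverse. *)
have hB e : 0 < e -> `|hilbert e (fun x => u x * G1 x) (fun x => v x * wt x)| <= pi / 2 * D.
  move=> e0; apply: (le_trans (hilbert_bound e0 cA0 (nG u hu) (nW v hv))).
  rewrite ler_wpM2l ?divr_ge0 ?pi_ge0// DE li; apply: lerD.
    rewrite -(ler_pM2l Ac0) mulrA -{1}li mulVf ?gt_eqF// mul1r.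
    exact: sq (ltW Ac0) iu G1_sqr (mGf u hu).
  rewrite -(ler_pM2l cA0) mulrA -li mulfV ?gt_eqF// mul1r.
  exact: sq (ltW cA0) iv w2 (mWf v hv).
have hB' e : 0 < e -> `|hilbert e (fun x => u x * wt x) (fun x => v x * G1 x)| <= pi / 2 * D.
  move=> e0; apply: (le_trans (hilbert_bound e0 Ac0 (nW u hu) (nG v hv))).
  rewrite ler_wpM2l ?divr_ge0 ?pi_ge0// DE -li invrK; apply: lerD.
    rewrite -(ler_pM2l cA0) mulrA mulfV ?gt_eqF// mul1r.
    exact: sq (ltW cA0) iu w2 (mWf u hu).
  rewrite -(ler_pM2l Ac0) mulrA -{1}li mulVf ?gt_eqF// mul1r.
  exact: sq (ltW Ac0) iv G1_sqr (mGf v hv).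
pose e n : R := n.+2%:R^-1.
have e0 n : 0 < e n by rewrite invr_gt0.
(* The factor [r n h] equals [h * hk (e n) h]: it lies in [[0, 1]], tends to one for [h > 0], and
   turns [1 / h] into [hk (e n) h]. *)
pose r n h := h ^+ 2 / (e n ^+ 2 + h ^+ 2).
have r01 n h : 0 <= r n h <= 1.
  have p : 0 < e n ^+ 2 + h ^+ 2 by rewrite ltr_wpDr ?sqr_ge0// exprn_gt0.
  by rewrite divr_ge0 ?sqr_ge0 ?(ltW p)//= ler_pdivrMr// mul1r lerDr sqr_ge0.
have mr n : measurable_fun setT (r n).
  have -> : r n = (fun h => h * hk (e n) h) by apply/funext => h; rewrite /r /hk expr2 mulrA.
  by apply: measurable_funM => //; exact: measurable_hk.
have r1 h : 0 < h -> (fun n => r n h) @ \oo --> (1 : R).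
  move=> h0; rewrite -[X in _ --> X](_ : h ^+ 2 / (0 ^+ 2 + h ^+ 2) = 1); last first.
    by rewrite expr0n add0r divff// gt_eqF// exprn_gt0.
  apply: cvgM; first exact: cvg_cst.
  apply: cvgV; first by rewrite expr0n add0r gt_eqF// exprn_gt0.
  apply: cvgD; last exact: cvg_cst.
  rewrite !expr2 (_ : (fun n => _) = (fun n => e n * e n)); last by apply/funext => n; rewrite expr2.
  by apply: cvgM; exact: cvg_inv2.
have cv : (fun n => J (fun x h => r n h * F x h)) @ \oo --> J F.
  apply: (proj2 (@dct _ _ _ (mu \x mu)%E (fun n z => r n z.2 * F z.1 z.2) _
    (fun z => `|F z.1 z.2|) _ _ _ _)).
  - exact: itg_abs iF.
  - by move=> n; apply: (m2M (m2_fun2 (mr n))); exact: it2_m2.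
  - move=> [x h] /=; have [h0|h0] := ltP 0 h.
      by rewrite -[X in _ --> X]mul1r; apply: cvgMl; exact: r1.
    rewrite /F K_npos// (_ : (fun n => _) = (fun=> 0)) ?mul0r; first exact: cvg_cst.
    by apply/funext => n; rewrite ?mul0r mulr0.
  - move=> n [x h] /=; have /andP[r0 rl] := r01 n h.
    by rewrite normrM (ger0_norm r0) ler_piMl.
have nuG := nG u hu; have nuW := nW u hu; have nvG := nG v hv; have nvW := nW v hv.
have bn n : `|J (fun x h => r n h * F x h)| <= pi / A * D.
  have ih f g : nice f -> nice g -> it2 (fun x h => pos h * (hk (e n) h * (f x * g (x + h) - f (x + h) * g x))).
    move=> [_ hf _] [_ hg _]; have [i1 i2] := it2_hk (e0 n) hf hg.
    by apply: eq_it2 (it2_pos (it2B i1 i2)) => x h; rewrite mulrBr.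
  have -> : J (fun x h => r n h * F x h) = A^-1 * (hilbert (e n) (fun x => u x * G1 x) (fun x => v x * wt x)
      + hilbert (e n) (fun x => u x * wt x) (fun x => v x * G1 x)).
    rewrite -(JD (ih _ _ nuG nvW) (ih _ _ nuW nvG)) -(JZ _ (it2D (ih _ _ nuG nvW) (ih _ _ nuW nvG))).
    apply: eqJ => x h; rewrite /F /r /hk wt_diff_one.
    have [h0|h0] := ltP 0 h; last by rewrite K_npos// /pos (le_gtF h0); ring.
    rewrite K_pos// /pos h0 (_ : h `^ (- (1 + 1)) = h ^- 2); last first.
      by rewrite powRN (_ : 1 + 1 = 2%:R)// powR_mulrn// ltW.
    have p : e n ^+ 2 + h ^+ 2 != 0 by rewrite gt_eqF// ltr_wpDr ?sqr_ge0// exprn_gt0.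
    move: (e n) p => en p; move: (G1 _) (G1 _) (wt _) (wt _) => g1 g2 w1 w2'.
    by field; rewrite An0 p gt_eqF.
  rewrite normrM normfV (gtr0_norm hA).
  have -> : pi / A * D = A^-1 * (pi / 2 * D + pi / 2 * D) by move: (pi : R) => p; field.
  rewrite ler_wpM2l ?invr_ge0 ?(ltW hA)//; apply: (le_trans (ler_normD _ _)).
  by apply: lerD; [exact: hB|exact: hB'].
have c2 : (fun n => `|J (fun x h => r n h * F x h)|) @ \oo --> `|J F| by exact: cvg_norm.
rewrite -(cvg_lim (@Rhausdorff R) c2).
by apply: limr_le; [exact: cvgP c2|apply: nearW => n; exact: bn].
Qed.

End critical.

(** * The commutator for alpha > 1 *)

Section cauchy_schwarz.
Context d (T : measurableType d) (R : realType) (mu : {measure set T -> \bar R}).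
Implicit Types f g : T -> R.

Lemma discriminant_le (F B G : R) : 0 <= F -> 0 <= G ->
  (forall t, 0 <= F - 2 * t * B + t ^+ 2 * G) -> B ^+ 2 <= F * G.
Proof.
move=> F0 G0 h; have [G00|Gn0] := eqVneq G 0; last first.
  have Gp : 0 < G by rewrite lt_neqAle eq_sym Gn0.
  have := mulr_ge0 G0 (h (B / G)).
  rewrite (_ : G * _ = F * G - B ^+ 2) ?subr_ge0//; by field.
have [->|B0] := eqVneq B 0; first by rewrite expr0n mulr_ge0.
(* With [G = 0] the expression is affine in [t] and takes the value [-1] at this point,
   contradicting nonnegativity. *)
have := h ((F + 1) / (2 * B)); rewrite G00 mulr0 addr0.
rewrite (_ : F - _ = -1); last by field.
by lra.
Qed.

Lemma itg_mul_sqr f g : measurable_fun setT f -> measurable_fun setT g ->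
  itg mu (fun x => f x ^+ 2) -> itg mu (fun x => g x ^+ 2) -> itg mu (fun x => f x * g x).
Proof.
move=> mf mg hf hg; apply: (itg_dom (itgD hf hg)); first exact: measurable_funM.
move=> x; have h1 := sqr_ge0 (f x - g x); have h2 := sqr_ge0 (f x + g x).
by rewrite ler_norml; apply/andP; split; rewrite !expr2 in h1 h2 *; nra.
Qed.

Lemma cauchy_schwarz f g : measurable_fun setT f -> measurable_fun setT g ->
  itg mu (fun x => f x ^+ 2) -> itg mu (fun x => g x ^+ 2) ->
  (\int[mu]_x (f x * g x)) ^+ 2 <= \int[mu]_x (f x ^+ 2) * \int[mu]_x (g x ^+ 2).
Proof.
move=> mf mg hf hg; have hfg := itg_mul_sqr mf mg hf hg.
apply: discriminant_le; [by apply: I_ge0 => x; exact: sqr_ge0|by apply: I_ge0 => x; exact: sqr_ge0|].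
move=> t; have i1 := itgZ (2 * t) hfg; have i2 := itgZ (t ^+ 2) hg; have i3 := itgB hf i1.
rewrite -(IZ _ hg) -(IZ _ hfg) -(IB hf i1) -(ID i3 i2).
apply: I_ge0 => x.
have -> : f x ^+ 2 - 2 * t * (f x * g x) + t ^+ 2 * g x ^+ 2 = (f x - t * g x) ^+ 2 by ring.
exact: sqr_ge0.
Qed.

End cauchy_schwarz.

(** * Pointwise formulas for |D|^s with s < 1 *)

Section pointwise.
Context (R : realType).
Notation mu := (@lebesgue_measure R).
Implicit Types (f g : R -> R) (s x h : R).

(** Second differences in [x] correspond to the multiplier [2 (1 - cos (h xi))]; integrating against
    the kernel by [kk_scale] and inverting gives the formula. *)
Lemma absD_second_diff s f x : 0 < s < 1 -> qC 2 f ->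
  absD s f x = (2 * kk s)^-1 *
    \int[mu]_h (K s h * (2 * f x - (f (x + h) + f (x - h)))).
Proof.
move=> hs hf; have [s0 s1] := andP hs.
have hs2 : 0 < s < 2 by apply/andP; split; lra.
have hs' : 0 < s < 2 * 1%:R - 1 by apply/andP; split; lra.
have hs'' : 0 <= s < 2 * 1%:R - 1 by apply/andP; split; lra.
have h0 : (0 : R) <= (0 : R) < 2 * 1%:R - 1 by apply/andP; split; lra.
have nf := qC_nice hf; have [cf iF [M fM]] := nf.
have iH := itg_absH (k := 1) hs'' hf.
have ih : itg mu (hart f).
  by apply: eq_itg (itg_absH (k := 1) h0 hf) => xi; rewrite /absH powRr0 mul1r.
have k0 := kk_gt0 hs2.
rewrite (absD_hartE (k := 1) hs' hf).
pose G (xi h : R) := K s h * (1 - cos (h * xi)) * (hart f xi * cas (xi * x)).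
have mG : m2 G.
  apply: m2M.
    apply: m2M; first exact: (m2_fun2 (measurable_K s)).
    apply: m2B; first exact: measurable_cst.
    apply: (measurableT_comp (continuous_measurable_fun (@continuous_cos R))).
    by apply: measurable_funM.
  by apply: m2_fun1; apply: measurable_funM; [exact: measurable_hart|exact: measurable_casM].
have i1 xi : itg mu (G xi) by apply: itgZr; exact: itg_Kcos.
have I1 xi : \int[mu]_h G xi h = kk s * (absH s f xi * cas (xi * x)).
  by rewrite /G IZr; [rewrite kk_scale// /absH; ring|exact: itg_Kcos].
have iG : it2 G.
  apply: (it2_crit (itgZ (kk s) (itg_abs (itg_hart x iH))) mG i1) => xi.
  rewrite (_ : \int[mu]_h _ = \int[mu]_h (K s h * (1 - cos (h * xi)) * `|hart f xi * cas (xi * x)|)).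
    rewrite IZr; last exact: itg_Kcos.
    rewrite kk_scale// -mulrA ler_wpM2l ?(ltW k0)// /absH -mulrA (normrM (_ `^ _)).
    by rewrite (ger0_norm (powR_ge0 _ _)).
  apply: eqI => h; rewrite normrM (ger0_norm (_ : 0 <= K s h * _))//.
  by apply: mulr_ge0; [exact: K_ge0|have := cos_le1 (h * xi); lra].
have e1 : kk s * hart (absH s f) x = J G.
  rewrite J12// -IZ; last exact: itg_hart.
  by apply: eqI => xi; rewrite I1.
have I2 h : \int[mu]_xi G xi h = pi * (K s h * (2 * f x - (f (x + h) + f (x - h)))).
  pose g y := 2 * f y - (f (y + h) + f (y - h)).
  have [cS iS [N SN]] := nice_two_shift h nf.
  have ng : nice g.
    split.
    - by move=> y; apply: cvgB; [apply: cvgMr; exact: cf|exact: cS].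
    - by apply: itgB => //; exact: itgZ.
    - exists (2 * M + N) => y; apply: (le_trans (ler_normB _ _)); apply: lerD => //.
      by rewrite normrM (@ger0_norm _ 2)// ler_wpM2l.
  have hg xi : hart g xi = 2 * ((1 - cos (h * xi)) * hart f xi).
    have a1 := itg_hart xi iF; have a2 := itg_hart xi iS.
    transitivity (2 * hart f xi - hart (fun x => f (x + h) + f (x - h)) xi).
      rewrite /hart -(IZ 2 a1) -(IB (itgZ 2 a1) a2); apply: eqI => y.
      by rewrite /g; ring.
    by rewrite hart_two_shift//; ring.
  have mc : measurable_fun setT (fun xi : R => 1 - cos (h * xi)).
    apply: measurable_funB => //.
    apply: (measurableT_comp (continuous_measurable_fun (@continuous_cos R))).
    exact: measurable_funM.
  have bc xi : `|1 - cos (h * xi)| <= 2.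
    have := cos_le1 (h * xi); have := cos_geN1 (h * xi) => c1 c2.
    by rewrite ler_norml; apply/andP; split; lra.
  have ihg : itg mu (hart g).
    by apply: eq_itg (itgZ 2 (itgMb ih mc bc)) => xi; rewrite hg; ring.
  have := hart_inversion x ng ihg; rewrite {2}/g => e.
  transitivity (K s h / 2 * hart (hart g) x); last by rewrite e; move: (pi : R) => p; field.
  rewrite /hart -(IZ _ (itg_hart x ihg)); apply: eqI => xi.
  by rewrite -/(hart g xi) hg /G; field.
have iP := it2_itg2 iG.
have e2 : J G = pi * \int[mu]_h (K s h * (2 * f x - (f (x + h) + f (x - h)))).
  have pi0 := pi_neq0 R.
  rewrite J21// -IZ; first by apply: eqI => h; exact: I2.
  apply: eq_itg (itgZ pi^-1 iP) => h; rewrite I2.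
  by move: (pi : R) pi0 => p p0; field.
apply: (mulfI (_ : kk s != 0)); first by rewrite gt_eqF.
rewrite mulrCA e1 e2; have pi0 := pi_neq0 R.
set I := \int[mu]_h _; move: (pi : R) pi0 => p p0.
by field; rewrite p0 gt_eqF.
Qed.

Definition Ks s h := `|h| `^ (- (1 + s)).
(** An integrable kernel: one power of [|h|] gained near zero makes it [|h|^(-s)] there. *)
Definition k0 s h := Ks s h * mh `|h|.

Lemma Ks_ge0 s h : 0 <= Ks s h. Proof. exact: powR_ge0. Qed.

Lemma measurable_Ks s : measurable_fun setT (Ks s).
Proof. exact: measurable_abs_powR. Qed.

Lemma measurable_mh : measurable_fun setT (@mh R).
Proof.
rewrite (_ : @mh R = (fun h => Num.min h 1)); first exact: measurable_minr.
by apply/funext => h; rewrite /mh minElt le_eqVlt; case: ltgtP => // <-.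
Qed.

Lemma measurable_k0 s : measurable_fun setT (k0 s).
Proof.
apply: measurable_funM; first exact: measurable_Ks.
by apply: (measurableT_comp measurable_mh).
Qed.

Lemma mh_abs_ge0 h : 0 <= mh `|h|.
Proof. by rewrite /mh; case: ifP. Qed.

Lemma k0_ge0 s h : 0 <= k0 s h.
Proof. by rewrite mulr_ge0 ?Ks_ge0 ?mh_abs_ge0. Qed.

Lemma itg_k0 s : 0 < s < 1 -> itg mu (k0 s).
Proof.
move=> /andP[s0 s1].
have [h1 _] := @pow_near R (- s) 1 ltac:(lra) ltr01.
have [h2 _] := @pow_far R (- (1 + s)) 1 ltac:(lra) ltr01.
have ip : itg mu (fun h => pos h * k0 s h).
  apply: eq_itg (itgD h1 h2) => h; rewrite /pos /near0 /far0 /k0 /Ks /mh.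
  have [hp|hn] := ltP 0 h; last first.
    by rewrite ltNge (le_trans hn)//= !mul0r addr0.
  rewrite gtr0_norm//=; have [h_le|h_gt] := leP h 1; last by rewrite !mul1r mul0r add0r mulr1.
  rewrite !mul1r mul0r addr0 -{2}[h]powRr1 ?(ltW hp)// -powRD; first by congr (_ `^ _); ring.
  by rewrite (gt_eqF hp) implybT.
apply: (itg_half (measurable_k0 s) ip).
by apply: eq_itg ip => h; rewrite /k0 /Ks normrN.
Qed.

Lemma dl_abs f : qC 1 f -> exists2 C, 0 <= C & forall x h, `|f x - f (x + h)| <= C * mh `|h|.
Proof.
move=> hf; have [C C0 hC] := dl_bound_b (qC_bC hf); exists C => // x h.
have [h0|h0|->] := ltgtP h 0; last by rewrite addr0 subrr [leLHS]normr0 mulr_ge0 ?mh_abs_ge0.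
  have nh : 0 < - h by rewrite oppr_gt0.
  have := hC (x + h) (- h) nh; rewrite /dl addrK => k.
  by rewrite (ltr0_norm h0).
by rewrite (gtr0_norm h0) distrC; exact: hC.
Qed.

(** Because [s < 1], first differences already give absolute convergence over the whole line;
    folding it onto [h > 0] restores the second difference. *)
Lemma absD_diff s f x : 0 < s < 1 -> qC 2 f ->
  itg mu (fun h => Ks s h * (f x - f (x + h))) /\
  absD s f x = (2 * kk s)^-1 * \int[mu]_h (Ks s h * (f x - f (x + h))).
Proof.
move=> hs hf; have [C C0 hC] := dl_abs (qCW hf).
have mf := qC_measurable hf.
have mfs : measurable_fun setT (fun h => f (x + h)).
  by apply: (measurableT_comp mf); exact: measurable_funD.
have iF : itg mu (fun h => Ks s h * (f x - f (x + h))).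
  apply: (itg_dom (itgZ C (itg_k0 hs))).
    by apply: measurable_funM; [exact: measurable_Ks|exact: measurable_funB].
  move=> h; rewrite normrM (ger0_norm (Ks_ge0 s h)) /k0 mulrCA.
  by rewrite ler_wpM2l ?Ks_ge0.
split => //; rewrite absD_second_diff//; congr (_ * _); rewrite (I_half iF).
apply: eqI => h; rewrite /pos /Ks normrN.
have [h0|h0] := ltP 0 h; last by rewrite K_npos// !mul0r.
by rewrite K_pos// gtr0_norm//; ring.
Qed.

End pointwise.

(** * Bounds for the commutator kernel *)

Section kernel.
Context (R : realType).
Notation mu := (@lebesgue_measure R).
Implicit Types (x y h p s : R).

(** With [r = al / be <= 1] and [p <= 2], one has [r^p >= r^2] and [1 - r^2 <= 2 (1 - r)]. *)
Lemma powR_sub_le (al be p : R) : 0 < al <= be -> 0 <= p <= 2 ->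
  0 <= al `^ (- p) - be `^ (- p) <= 2 * al `^ (- p) * ((be - al) / be).
Proof.
move=> /andP[a0 ab] /andP[p0 p2]; have b0 := lt_le_trans a0 ab.
have r0 : 0 <= al / be <= 1.
  by rewrite divr_ge0 ?(ltW a0) ?(ltW b0)//= ler_pdivrMr// mul1r.
have [r00 r01] := andP r0.
have -> : be `^ (- p) = al `^ (- p) * (al / be) `^ p.
  rewrite powRM ?invr_ge0 ?(ltW a0) ?(ltW b0)// mulrA -powRD; last by rewrite (gt_eqF a0) implybT.
  by rewrite addNr powRr0 mul1r -(powR_inv1 (ltW b0)) -powRrM mulN1r.
have X0 : 0 <= al `^ (- p) := powR_ge0 _ _.
have Y1 : (al / be) `^ p <= 1 by exact: powR_le1.
have Y2 : (al / be) ^+ 2 <= (al / be) `^ p.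
  have -> : (al / be) ^+ 2 = (al / be) `^ p * (al / be) `^ (2 - p).
    rewrite -powRD ?(gt_eqF (divr_gt0 a0 b0)) ?implybT//.
    by rewrite (_ : p + (2 - p) = 2%:R) ?powR_mulrn//; ring.
  by rewrite ler_piMr ?powR_ge0// powR_le1//; lra.
apply/andP; split; first by rewrite subr_ge0 ler_piMr.
rewrite (_ : _ - _ = al `^ (- p) * (1 - (al / be) `^ p)); last by ring.
have -> : 2 * al `^ (- p) * ((be - al) / be) = al `^ (- p) * (2 * (1 - al / be)).
  by field; rewrite gt_eqF.
rewrite ler_wpM2l//; rewrite expr2 in Y2; nra.
Qed.

(** This is [ry^(-1-s) (rx / ry)^(1/2)]. The half power makes the square in [y], divided by the
    weight, decay like [rho^(-2)] instead of [rho^(-1)], and it costs only the moment of [wt * rh]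
    in [x], finite for [a > 1]. *)
Definition Ek s (rx ry : R) := rx `^ 2^-1 * ry `^ (- (3 / 2 + s)).

Lemma Ek_ge0 s rx ry : 0 <= Ek s rx ry.
Proof. by rewrite mulr_ge0 ?powR_ge0. Qed.

Lemma Ek_le s rx ry : 0 < rx -> 0 < ry ->
  (ry <= rx -> ry `^ (- (1 + s)) <= Ek s rx ry) /\
  (rx <= ry -> ry `^ (- (1 + s)) * (rx / ry) <= Ek s rx ry).
Proof.
move=> x0 y0; have hh : 0 <= 2^-1 :> R by rewrite invr_ge0.
split => h.
  have -> : ry `^ (- (1 + s)) = ry `^ 2^-1 * ry `^ (- (3 / 2 + s)).
    by rewrite -powRD ?(gt_eqF y0) ?implybT//; congr (_ `^ _); field.
  by rewrite ler_wpM2r ?powR_ge0// le_powR// ltW.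
have -> : rx / ry = rx `^ 2^-1 * (rx `^ 2^-1 * ry `^ (- 1)).
  rewrite mulrA -powRD ?(gt_eqF x0) ?implybT// powR_inv1 ?(ltW y0)//.
  by rewrite (_ : 2^-1 + 2^-1 = 1) ?powRr1 ?(ltW x0)//; field.
rewrite mulrCA ler_wpM2l ?powR_ge0//.
have -> : ry `^ (- (3 / 2 + s)) = ry `^ (- (1 + s)) * (ry `^ 2^-1 * ry `^ (- 1)).
  by rewrite -!powRD ?(gt_eqF y0) ?implybT//; congr (_ `^ _); field.
by rewrite ler_wpM2l ?powR_ge0// ler_wpM2r ?powR_ge0// le_powR// ltW.
Qed.

(** If [ry < rx], each power is at most [9 ry^(-1-s)] and [Ek] dominates it, where 9 bounds
    [3^(1+s)]. Otherwise [powR_sub_le] gives a relative difference of order [rx / ry], again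
    dominated by [Ek]. *)
Lemma far_pow s rx ry t : 0 < s < 1 -> 0 < rx -> 0 < ry -> 0 < t ->
  ry <= 3 * t -> `|t - ry| <= rx ->
  `|t `^ (- (1 + s)) - ry `^ (- (1 + s))| <= 18 * Ek s rx ry.
Proof.
move=> /andP[s0 s1] x0 y0 t0 h3 hx; have [E1 E2] := Ek_le s x0 y0.
have hp : 0 <= 1 + s <= 2 by apply/andP; split; lra.
have T9 : t `^ (- (1 + s)) <= 9 * ry `^ (- (1 + s)).
  apply: (@le_trans _ _ ((ry / 3) `^ (- (1 + s)))).
    apply: le_powR_neg; first by lra.
    by rewrite divr_gt0//= ler_pdivrMr// mulrC.
  rewrite powRM ?invr_ge0 ?(ltW y0)// mulrC ler_wpM2r ?powR_ge0//.
  rewrite -powR_inv1// -powRrM mulN1r opprK.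
  apply: (@le_trans _ _ (3 `^ 2%:R)); last by rewrite powR_mulrn// expr2; lra.
  by rewrite ler_powR//; lra.
have Y0 : 0 <= ry `^ (- (1 + s)) := powR_ge0 _ _.
have T0 : 0 <= t `^ (- (1 + s)) := powR_ge0 _ _.
have Ex0 := Ek_ge0 s rx ry.
set X := t `^ _ in T9 T0 *; set Y := ry `^ _ in T9 Y0 E1 E2 *; set E := Ek s rx ry in E1 E2 Ex0 *.
have [xy|yx] := leP rx ry; last first.
  have := E1 (ltW yx) => YE.
  rewrite ler_norml; apply/andP; split; lra.
have {}E2 := E2 xy.
have [ty|yt] := leP t ry.
  have tr : 0 < t <= ry by rewrite t0.
  have /andP[b0 b1] := powR_sub_le tr hp; rewrite -/X -/Y in b0 b1.
  rewrite ger0_norm//; apply: (le_trans b1).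
  apply: (@le_trans _ _ (2 * (9 * Y) * (rx / ry))); last by lra.
  rewrite ler_pM ?mulr_ge0 ?invr_ge0 ?subr_ge0 ?(ltW y0)//.
    by rewrite ler_wpM2l.
  by rewrite ler_wpM2r ?invr_ge0 ?(ltW y0)// (le_trans (ler_norm _))// distrC.
have tr : 0 < ry <= t by rewrite y0 ltW.
have /andP[b0 b1] := powR_sub_le tr hp; rewrite -/X -/Y in b0 b1.
rewrite -normrN opprB ger0_norm//; apply: (le_trans b1).
apply: (@le_trans _ _ (2 * Y * (rx / ry))); last by lra.
rewrite ler_wpM2l ?mulr_ge0//; apply: ler_pM.
- by rewrite subr_ge0 ltW.
- by rewrite invr_ge0 ltW.
- exact: (le_trans (ler_norm _)).
- by rewrite lef_pV2 ?posrE// ltW.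
Qed.

Section bound.
Variables (A m s : R).
Hypotheses (hA : 1 <= A) (hs : 0 < s < 1).
Notation rh := (rh A m).
Let A0 : 0 < A. Proof. exact: lt_le_trans hA. Qed.

(* For fixed x, (W x - W y) |y - x|^(-1-s) has the tail W x rho(y)^(-1-s) as y tends to infinity;
   subtracting it leaves a kernel that acts boundedly on the weighted space. *)
Definition kW (W : R -> R) x y : R :=
  (W x - W y) * Ks s (y - x) - W x * rh y `^ (- (1 + s)).

(** Near [x] the difference of [W] tames the singularity and the subtracted tail is itself
    [O(W x * Ek)]. Far away [|y - x|] and [rh y] differ by at most [rh x], so [far_pow] controls the
    difference of the two tails. The assumption [A >= 1] makes [|h| / rh x] at most [min (|h|, 1)]
    in the near region. *)
Lemma kW_bound (W : R -> R) x y : (forall x, 0 <= W x) ->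
  (`|y - x| <= rh x / 2 -> `|W x - W y| <= 384 * W y * (`|y - x| / rh x)) ->
  `|kW W x y| <= 384 * (W y * k0 s (y - x) + W x * Ek s (rh x) (rh y)).
Proof.
move=> W0 hW; have x0 := rh_gt0 m A0 x; have y0 := rh_gt0 m A0 y.
have x1 : 1 <= rh x := le_trans hA (rh_geA m A0 x).
set h := y - x in hW *; have yE : y = x + h by rewrite /h addrC subrK.
have hy : rh y <= rh x + `|h| by rewrite yE rhD.
have [E1 E2] := Ek_le s x0 y0; have Ex0 := Ek_ge0 s (rh x) (rh y).
have Wx := W0 x; have Wy := W0 y; have k00 := k0_ge0 s h; have K0 := Ks_ge0 s h.
have Y0 : 0 <= rh y `^ (- (1 + s)) := powR_ge0 _ _.
have p1 : 0 <= W y * k0 s h by rewrite mulr_ge0.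
have p2 : 0 <= W x * Ek s (rh x) (rh y) by rewrite mulr_ge0.
have [hn|hf] := leP `|h| (rh x / 2).
  have b2 : rh y `^ (- (1 + s)) <= 2 * Ek s (rh x) (rh y).
    have [yx|/ltW xy] := leP (rh y) (rh x); first by have := E1 yx; lra.
    have := E2 xy; set Y := _ `^ _ in Y0 *.
    have : 2^-1 <= rh x / rh y by rewrite ler_pdivlMr//; lra.
    nra.
  have b1 : `|(W x - W y) * Ks s h| <= 384 * (W y * k0 s h).
    rewrite normrM (ger0_norm K0); apply: (@le_trans _ _ (384 * W y * (`|h| / rh x) * Ks s h)).
      by rewrite ler_wpM2r// hW.
    have c : `|h| / rh x * Ks s h <= k0 s h.
      rewrite /k0 [leRHS]mulrC ler_wpM2r// ler_pdivrMr// /mh.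
      case: ifPn => h1; first by rewrite ler_peMr.
      by rewrite mul1r; lra.
    by have := ler_wpM2l Wy c; lra.
  have b3 : `|W x * rh y `^ (- (1 + s))| <= 2 * (W x * Ek s (rh x) (rh y)).
    by rewrite ger0_norm ?mulr_ge0// mulrCA ler_wpM2l.
  by apply: (le_trans (ler_normB _ _)); lra.
have h0 : 0 < `|h| by apply: le_lt_trans hf; rewrite divr_ge0 ?ltW.
have F : `|Ks s h - rh y `^ (- (1 + s))| <= 18 * Ek s (rh x) (rh y).
  apply: far_pow => //; first by lra.
  have h1 := rh_gex m A0 x; have h2 := rh_gex m A0 y.
  have h3 : `|h| <= rh x + rh y.
    rewrite (_ : h = (y - m) - (x - m)); last by rewrite /h; ring.
    by apply: (le_trans (ler_normB _ _)); lra.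
  by rewrite ler_norml; apply/andP; split; lra.
(* Here [|h| > rh x / 2 >= 1 / 2], so the truncation in [k0] costs at most a factor 2. *)
have Kk : Ks s h <= 2 * k0 s h.
  rewrite /k0 mulrCA ler_peMr// /mh; case: ifPn => h1; lra.
rewrite (_ : kW W x y = W x * (Ks s h - rh y `^ (- (1 + s))) - W y * Ks s h); last first.
  by rewrite /kW -/h; ring.
apply: (le_trans (ler_normB _ _)).
rewrite !normrM (ger0_norm Wx) (ger0_norm Wy) (ger0_norm K0).
have c1 := ler_wpM2l Wx F; have c2 := ler_wpM2l Wy Kk.
lra.
Qed.

End bound.

End kernel.

(** * Moments and near comparisons of the weight *)

Section weight_powers.
Context (R : realType).
Notation mu := (@lebesgue_measure R).
Variables (a A m : R).
Hypotheses (ha : 0 < a < 2) (hA : 0 < A).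
Notation wt := (wt a A m).
Notation om := (om a A m).
Notation rh := (rh A m).
Implicit Types (x y h p s : R).

Definition Pq p : R := \int[mu]_x (q x `^ p).

Lemma rh_powR x p : rh x `^ (- (2 * p)) = A `^ (- (2 * p)) * q ((x - m) / A) `^ p.
Proof.
have r0 := rh_gt0 m hA x.
rewrite (q_rh m hA) -powR_mulrn ?divr_ge0 ?(ltW hA) ?(ltW r0)// -powRrM.
rewrite powRM ?invr_ge0 ?(ltW hA) ?(ltW r0)// mulrA -powRD ?(gt_eqF hA) ?implybT//.
by rewrite addNr powRr0 mul1r -(powR_inv1 (ltW r0)) -powRrM mulN1r.
Qed.

Lemma I_rh p : 1 / 2 < p -> itg mu (fun x => rh x `^ (- (2 * p))) /\
  \int[mu]_x rh x `^ (- (2 * p)) = A `^ (1 - 2 * p) * Pq p.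
Proof.
move=> hp; have iq := itg_q_powR hp.
have An : A^-1 != 0 by rewrite invr_eq0 gt_eqF.
have h := itg_affine (- m / A) An iq.
have e : (fun x => q (A^-1 * x + - m / A) `^ p) = (fun x => q ((x - m) / A) `^ p).
  by apply/funext => x; congr (q _ `^ _); ring.
have hE := I_affine (- m / A) An iq.
rewrite /= e in h hE.
split; first by apply: eq_itg (itgZ (A `^ (- (2 * p))) h) => x; exact: rh_powR.
rewrite (eqI mu (fun x => rh_powR x p)) (IZ _ h) /Pq hE (gtr0_norm (_ : 0 < A^-1)) ?invr_gt0//.
rewrite (_ : 1 - 2 * p = - (2 * p) + 1); last by ring.
rewrite powRD ?(gt_eqF hA) ?implybT// powRr1 ?(ltW hA)//.
by field; rewrite gt_eqF.
Qed.

Lemma wt_rhE x : wt x = C_phi a * A `^ a * rh x `^ (- (1 + a)).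
Proof.
have c0 := C_phi_gt0 ha; rewrite (wt_rh m ha hA) !mulrA.
rewrite -(mulrA (C_phi a)) -powRD ?(gt_eqF hA) ?implybT// subrr powRr0.
by field; rewrite gt_eqF.
Qed.

Lemma measurable_rh_powR p : measurable_fun setT (fun x => rh x `^ p).
Proof.
rewrite (_ : (fun x => _) = (fun x => A `^ p * q ((x - m) / A) `^ (- p / 2))).
  apply: measurable_funM => //.
  apply: (measurableT_comp (measurable_powR _)).
  apply: (measurableT_comp (continuous_measurable_fun (@continuous_q R))).
  by apply: measurable_funM => //; exact: measurable_funB.
apply/funext => x; have := rh_powR x (- p / 2).
by rewrite (_ : - (2 * (- p / 2)) = p); last by field.
Qed.

Let wnear_wt x y : `|y - x| <= rh x / 2 ->
  `|wt x - wt y| <= 48 * wt x * (`|y - x| / rh x) /\ wt x <= 8 * wt y.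
Proof.
move=> h; have yE : y = x + (y - x) by rewrite addrC subrK.
split; last first.
  have hy : rh y <= 2 * rh x.
    by have := rhD m hA x (y - x); rewrite -yE; have := rh_gt0 m hA x; lra.
  exact: (wt_comp ha hA hy).
have [h0|h0] := leP 0 (y - x).
  rewrite (ger0_norm h0) in h *; rewrite distrC {1}yE.
  by apply: wt_diff_right => //; rewrite h0.
rewrite (ltr0_norm h0) opprB in h *; rewrite (_ : y = x - (x - y)) {1}subKr//.
  by have := @wt_diff_left _ a A m ha hA x (x - y); rewrite subKr; apply; rewrite h andbT; lra.
Qed.

Lemma wnear_wt8 x y : `|y - x| <= rh x / 2 ->
  `|wt x - wt y| <= 384 * wt y * (`|y - x| / rh x).
Proof.
move=> h; have [h1 h2] := wnear_wt h; apply: (le_trans h1).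
rewrite ler_wpM2r ?divr_ge0 ?(ltW (rh_gt0 m hA x))//; lra.
Qed.

(** Multiplying by [om y] bounds the left-hand side by [|wt x - wt y|], so the constant of
    [wnear_wt8] carries over to the root. *)
Lemma wnear_om x y : `|y - x| <= rh x / 2 ->
  `|om x - om y| <= 384 * om y * (`|y - x| / rh x).
Proof.
move=> h; have k := wnear_wt8 h.
have P0 := om_gt0 m ha hA x; have Q0 := om_gt0 m ha hA y.
rewrite -(ler_pM2r Q0); apply: (@le_trans _ _ `|wt x - wt y|).
  rewrite -!(om_sqr m ha hA) subr_sqr normrM ler_wpM2l// ger0_norm; lra.
by apply: (le_trans k); rewrite -(om_sqr m ha hA) le_eqVlt; apply/orP; left; apply/eqP; ring.
Qed.

(** For [a > 1] the exponent [(1 + a) / 2] exceeds one: a single factor [Q] carries the decay, and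
    the remaining power [(a - 1) / 2] is smooth and bounded. *)
Lemma qC_wt k : 1 < a -> qC k wt.
Proof.
move=> a1; have An : A != 0 by rewrite gt_eqF.
have dz (x : R) : is_derive x 1 (fun x : R => (x - m) / A) A^-1.
  by apply: der_eq (derM (derB (derid x) (derC x m)) (derC x A^-1)) _; ring.
pose Q x := q ((x - m) / A); pose G x := (x - m) / A * Q x.
have qdQ : qd Q.
  exists (2 * (A ^+ 2 + m ^+ 2 + 1)) => x; rewrite /Q ger0_norm ?q_ge0//.
  rewrite /q ler_pdivlMr ?ltr_pwDl ?sqr_ge0// mulrC ler_pdivrMr ?ltr_pwDl ?sqr_ge0//.
  set z := (x - m) / A; have -> : x = A * z + m by rewrite /z; field.
  have := sqr_ge0 (A * z - m); have := sqr_ge0 A; have := sqr_ge0 m; have := sqr_ge0 z.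
  have : 0 <= m ^+ 2 * z ^+ 2 by rewrite mulr_ge0 ?sqr_ge0.
  rewrite !expr2; nra.
have dQ (x : R) : is_derive x 1 Q (Q x * (- (2 / A) * G x)).
  by apply: der_eq (der_comp (dz x) (is_derive_q _)) _; rewrite /G /Q; field.
have hQ j : qC j Q.
  elim: j => [|j ih]; first by split => // x; exact: der_cont (dQ x).
  split => //; exists (fun x => Q x * (- (2 / A) * G x)); split => //.
  by apply: qCM => //; apply: bCM; [exact: bC_cst|exact: (bC_q_powR m j ltr01 An).2].
have -> : wt = (fun x => Q x * (C_phi a / A * Q x `^ ((a - 1) / 2))).
  apply/funext => x; rewrite wtE mulrCA; congr (_ * _).
  have Q0 : 0 < Q x := q_gt0 _.
  rewrite -/(Q x) -[in RHS](powRr1 (ltW Q0)) -powRrM mul1r -powRD ?(gt_eqF Q0) ?implybT//.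
  by congr (_ `^ _); field.
apply: qCM => //; apply: bCM; first exact: bC_cst.
have s0 : 0 < (a - 1) / 2 by lra.
exact: (bC_q_powR m k s0 An).1.
Qed.

End weight_powers.

(** * Boundedness of |D|^s applied to u sqrt w *)

Section commutator.
Context (R : realType).
Notation mu := (@lebesgue_measure R).
Implicit Types (x y h : R) (f g u : R -> R).

Lemma measurable_abs_shift f x : measurable_fun setT f ->
  measurable_fun setT (fun h => `|f (x + h)|).
Proof.
move=> mf; apply: measurableT_comp => //; apply: (measurableT_comp mf).
exact: measurable_funD.
Qed.

(** Young's inequality for a convolution with an integrable kernel: Cauchy-Schwarz with [k0] split
    into two square roots, then Fubini. *)
Lemma convolution_bound s f : 0 < s < 1 -> continuous f -> itg mu f -> itg mu (fun x => f x ^+ 2) ->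
  (exists M, forall x, `|f x| <= M) ->
  let F x := \int[mu]_h (`|f (x + h)| * k0 s h) in
  itg mu (fun x => F x ^+ 2) /\
  \int[mu]_x (F x ^+ 2) <= (\int[mu]_h k0 s h) ^+ 2 * \int[mu]_x (f x ^+ 2).
Proof.
move=> hs cf f1 f2 [M fM] F; have mf := continuous_measurable_fun cf.
have ik := itg_k0 hs; set kb := \int[mu]_h k0 s h.
have kb0 : 0 <= kb by apply: I_ge0 => h; exact: k0_ge0.
have mk := measurable_k0 (R := R) s.
have msk : measurable_fun setT (fun h : R => Num.sqrt (k0 s h)).
  by apply: (measurableT_comp (continuous_measurable_fun (@sqrt_continuous R))).
have sk h : Num.sqrt (k0 s h) ^+ 2 = k0 s h by rewrite sqr_sqrtr// k0_ge0.
have mfs x := measurable_abs_shift x mf.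
have i2 x : itg mu (fun h => f (x + h) ^+ 2 * k0 s h).
  have b h : `|f (x + h) ^+ 2| <= M ^+ 2.
    by rewrite normrX; apply: lerXn2r; rewrite ?nnegrE// (le_trans _ (fM 0)).
  have mf2 : measurable_fun setT (fun h => f (x + h) ^+ 2).
    by apply: measurable_funX; apply: (measurableT_comp mf); exact: measurable_funD.
  by apply: eq_itg (itgMb ik mf2 b) => h; rewrite mulrC.
have cs x : F x ^+ 2 <= kb * \int[mu]_h (f (x + h) ^+ 2 * k0 s h).
  have e1 h : (`|f (x + h)| * Num.sqrt (k0 s h)) ^+ 2 = f (x + h) ^+ 2 * k0 s h.
    by rewrite exprMn sk real_normK ?num_real.
  have j1 : itg mu (fun h => (`|f (x + h)| * Num.sqrt (k0 s h)) ^+ 2).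
    by apply: eq_itg (i2 x) => h; exact: e1.
  have j2 : itg mu (fun h => Num.sqrt (k0 s h) ^+ 2).
    by apply: eq_itg ik => h; exact: sk.
  have := @cauchy_schwarz _ _ _ mu (fun h => `|f (x + h)| * Num.sqrt (k0 s h))
    (fun h => Num.sqrt (k0 s h)) (measurable_funM (mfs x) msk) msk j1 j2.
  rewrite (eqI mu e1) (eqI mu sk) mulrC; apply: le_trans.
  rewrite /F le_eqVlt; apply/orP; left; apply/eqP; congr (_ ^+ 2); apply: eqI => h.
  by rewrite -mulrA -expr2 sk.
have iT := it2_tensor f2 ik.
have iS := it2_shear 1 iT.
have eS : J (fun x h => f (x + 1 * h) ^+ 2 * k0 s h) = kb * \int[mu]_x (f x ^+ 2).
  by rewrite (J_shear 1 iT) J_tensor// mulrC.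
have iG := itgZ kb (it2_itg1 iS).
have eG x : \int[mu]_h (f (x + 1 * h) ^+ 2 * k0 s h) = \int[mu]_h (f (x + h) ^+ 2 * k0 s h).
  by apply: eqI => h; rewrite mul1r.
have b x : `|F x ^+ 2| <= kb * \int[mu]_h (f (x + 1 * h) ^+ 2 * k0 s h).
  by rewrite ger0_norm ?sqr_ge0// eG.
have iabs : it2 (fun x h => `|f (x + h)| * k0 s h).
  by apply: eq_it2 (it2_shear 1 (it2_tensor (itg_abs f1) ik)) => x h; rewrite mul1r.
have iF2 : itg mu (fun x => F x ^+ 2).
  apply: (itg_dom iG _ b); apply: measurable_funX.
  exact: itg_measurable (it2_itg1 iabs).
split => //; rewrite expr2 -mulrA -eS J12// -IZ; last exact: it2_itg1.
by apply: le_I => // x; apply: le_trans (b x); exact: ler_norm.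
Qed.

Let commutator_arith1 (p1 p2 p3 p4 p5 k : R) : p4 * p5 <= p4 * (k * (2 * p3)) ->
  3 * (p1 ^+ 2 + p4 * p5 + p4 * p2 ^+ 2) <= 3 * p1 ^+ 2 + p4 * (6 * k * p3 + 3 * p2 ^+ 2).
Proof. lra. Qed.

Let commutator_arith2 (k f z t c e n0 n1 : R) :
  k * (f + z) <= k * (e * n0) -> t <= c * (n0 + n1) -> 0 <= k * e * n1 ->
  6 * k * (f + z) + 3 * t <= (6 * k * e + 3 * c) * (n0 + n1).
Proof. lra. Qed.

Section low_frequency.
Variables (a A m : R) (u : R -> R).
Hypotheses (ha1 : 1 < a < 2) (hA : 1 <= A) (hu : qC 4 u).
Notation wt := (wt a A m).
Notation om := (om a A m).
Notation rh := (rh A m).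
Notation s := (a / 2).
Notation c := (C_phi a).
Notation U := (absD s u).

Let a0 : 0 < a < 2. Proof. by have /andP[? ?] := ha1; apply/andP; split; lra. Qed.
Let A0 : 0 < A. Proof. exact: lt_le_trans hA. Qed.
Let s0 : 0 < s < 1. Proof. by have /andP[? ?] := ha1; apply/andP; split; lra. Qed.
Let s2 : 0 < s < 2. Proof. by have /andP[? ?] := ha1; apply/andP; split; lra. Qed.
Let c0 : 0 < c. Proof. exact: C_phi_gt0. Qed.
Let r0 x : 0 < rh x. Proof. exact: rh_gt0. Qed.
Let w0 x : 0 < wt x. Proof. exact: wt_gt0. Qed.
Let o0 x : 0 < om x. Proof. exact: om_gt0. Qed.
Let iw : itg mu wt. Proof. exact: itg_wt. Qed.
Let hu1 : qC 1 u. Proof. by do 3 apply: qCW. Qed.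
Let hu2 : qC 2 u. Proof. by do 2 apply: qCW. Qed.
Let mu_ : measurable_fun setT u. Proof. exact: qC_measurable hu. Qed.
Let mo : measurable_fun setT om. Proof. exact: measurable_om. Qed.
Let mw : measurable_fun setT wt. Proof. exact: measurable_wt. Qed.
Let mr p : measurable_fun setT (fun x => rh x `^ p). Proof. exact: measurable_rh_powR. Qed.
Let k_gt0 : 0 < kk s. Proof. exact: kk_gt0. Qed.

Let rh_le1 x p : 0 <= p -> `|rh x `^ (- p)| <= 1.
Proof.
move=> p0; rewrite ger0_norm ?powR_ge0//; have r1 := le_trans hA (rh_geA m A0 x).
have pN : - p <= 0 by rewrite oppr_le0.
have := le_powR_neg pN (_ : 0 < 1 <= rh x); rewrite powR1; apply.
by rewrite ltr01.
Qed.

(** [I_low] is the functional [T] of the rank one term; [I_lower], with a further half power of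
    decay coming from [Ek], is the remainder that the weighted norm of [u] does control. *)
Definition I_low : R := \int[mu]_x (u x * rh x `^ (- (1 + s))).
Definition I_lower : R := \int[mu]_x (`|u x| * rh x `^ (- (3 / 2 + s))).
Let N0 := \int[mu]_x (u x ^+ 2 * wt x).
Let N1 := \int[mu]_x (U x ^+ 2 * wt x).
Let kb := \int[mu]_h k0 s h.

Let iN0 : itg mu (fun x => u x ^+ 2 * wt x). Proof. exact: (itg_sqr_wt m a0 A0 hu). Qed.

Let hs1 : 0 < s < 2 * 1%:R - 1. Proof. by have /andP[? ?] := s0; apply/andP; split; lra. Qed.

Let mU : measurable_fun setT U.
Proof. exact: continuous_measurable_fun (continuous_absD (k := 1) hs1 hu2). Qed.

Let iN1 : itg mu (fun x => U x ^+ 2 * wt x).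
Proof.
have [M hM] := absD_bounded (k := 1) hs1 hu2.
have b x : `|U x ^+ 2| <= M ^+ 2.
  by rewrite normrX; apply: lerXn2r; rewrite ?nnegrE// (le_trans _ (hM 0)).
by apply: eq_itg (itgMb iw (measurable_funX 2 mU) b) => x; rewrite mulrC.
Qed.

Let ilow : itg mu (fun x => u x * rh x `^ (- (1 + s))).
Proof.
have p0 : 0 <= 1 + s by have /andP[? ?] := s0; lra.
exact: (itgMb (qC_itg hu) (mr _) (fun x => rh_le1 x p0)).
Qed.

Let ilower : itg mu (fun x => `|u x| * rh x `^ (- (3 / 2 + s))).
Proof.
have p0 : 0 <= 3 / 2 + s by have /andP[? ?] := s0; lra.
exact: (itgMb (itg_abs (qC_itg hu)) (mr _) (fun x => rh_le1 x p0)).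
Qed.

Let uo2 x : (`|u x| * om x) ^+ 2 = u x ^+ 2 * wt x.
Proof. by rewrite exprMn (om_sqr m a0 A0) real_normK ?num_real. Qed.

Let iuo : itg mu (fun x => (`|u x| * om x) ^+ 2).
Proof. by apply: eq_itg iN0 => x; exact: uo2. Qed.

Let muo : measurable_fun setT (fun x => `|u x| * om x).
Proof. by apply: measurable_funM => //; exact: measurableT_comp. Qed.

(** Cauchy-Schwarz against [om]: the dual factor [g] has square proportional to [rh^(-2)], whose
    integral is [Pq 1 / A]. *)
Lemma I_lower_bound : c * A * I_lower ^+ 2 <= Pq 1 * N0.
Proof.
have [a1 a2] := andP ha1.
pose g x := rh x `^ (- (3 / 2 + s)) / om x.
have mg : measurable_fun setT g.
  by apply: measurable_funM => //; apply: (measurableT_comp (@measurable_inv R)).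
have g2 x : g x ^+ 2 = c^-1 * A `^ (- a) * rh x `^ (- (2 * 1)).
  rewrite /g expr_div_n (om_sqr m a0 A0) (wt_rhE m a0 A0).
  rewrite -(powR_mulrn 2 (powR_ge0 _ _)) -powRrM.
  rewrite (_ : - (3 / 2 + s) * 2%:R = - (2 * 1) + - (1 + a)); last by field.
  rewrite powRD ?(gt_eqF (r0 x)) ?implybT// (powRN A).
  have := powR_gt0 a A0; have := powR_gt0 (- (1 + a)) (r0 x).
  move: (rh x `^ (- (1 + a))) (A `^ a) (rh x `^ _) => X Y Z X0 Y0.
  by field; rewrite !gt_eqF.
have h1 : 1 / 2 < 1 :> R by lra.
have [i1 e1] := I_rh m A0 h1.
have ig : itg mu (fun x => g x ^+ 2) by apply: eq_itg (itgZ (c^-1 * A `^ (- a)) i1).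
have := @cauchy_schwarz _ _ _ mu (fun x => `|u x| * om x) g muo mg iuo ig.
rewrite (eqI mu uo2) -/N0 (eqI mu g2) (IZ _ i1) e1.
rewrite (_ : 1 - 2 * 1 = - 1); last by ring.
rewrite powR_inv1 ?(ltW A0)//.
have -> : \int[mu]_x (`|u x| * om x * g x) = I_lower.
  apply: eqI => x; rewrite /g; have := o0 x; move: (om x) (rh x `^ _) => X Y X0.
  by field; rewrite gt_eqF.
move=> h; have cA : 0 <= c * A by rewrite mulr_ge0 ?(ltW c0) ?(ltW A0).
apply: (le_trans (ler_wpM2l cA h)).
have -> : c * A * (N0 * (c^-1 * A `^ (- a) * (A^-1 * Pq 1))) = A `^ (- a) * (Pq 1 * N0).
  by field; rewrite !gt_eqF.
rewrite ler_piMl//.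
  by apply: mulr_ge0; apply: I_ge0 => x; rewrite ?powR_ge0// mulr_ge0 ?sqr_ge0 ?(ltW (w0 x)).
have aN : - a <= 0 by lra.
by have := le_powR_neg aN (_ : 0 < 1 <= A); rewrite powR1; apply; rewrite ltr01.
Qed.

(** Two moments are needed: the first, at [p = s], which is finite because [a > 1], and the half
    moment, at [p = 1 / 4 + s]. *)
Let wt_rh_pow p : 1 / 2 < p -> itg mu (fun x => wt x * rh x `^ (1 + a - 2 * p)) /\
  \int[mu]_x (wt x * rh x `^ (1 + a - 2 * p)) = c * A `^ (1 + a - 2 * p) * Pq p.
Proof.
move=> hp; have [i1 e1] := I_rh m A0 hp.
have e x : wt x * rh x `^ (1 + a - 2 * p) = c * A `^ a * rh x `^ (- (2 * p)).
  rewrite (wt_rhE m a0 A0) -mulrA -powRD ?(gt_eqF (r0 x)) ?implybT//.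
  by congr (_ * _ `^ _); ring.
split; first by apply: eq_itg (itgZ (c * A `^ a) i1).
rewrite (eqI mu e) (IZ _ i1) e1 mulrA -(mulrA c) -powRD ?(gt_eqF A0) ?implybT//.
by congr (_ * _ `^ _ * _); ring.
Qed.

Let iwr : itg mu (fun x => wt x * rh x) /\ \int[mu]_x (wt x * rh x) = c * A * Pq s.
Proof.
have hp : 1 / 2 < s by have /andP[? ?] := ha1; lra.
have e : 1 + a - 2 * s = 1 by field.
have [i1 e1] := wt_rh_pow hp; rewrite e powRr1 ?(ltW A0)// in i1 e1.
have rE x : wt x * rh x = wt x * rh x `^ 1 by rewrite powRr1 ?(ltW (r0 x)).
by split; [apply: eq_itg i1|rewrite (eqI mu rE)].
Qed.

Let P4 := Pq (1 / 4 + s).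

Let iwh : itg mu (fun x => wt x * rh x `^ 2^-1) /\
  \int[mu]_x (wt x * rh x `^ 2^-1) = c * A `^ 2^-1 * P4.
Proof.
have hp : 1 / 2 < 1 / 4 + s by have /andP[? ?] := ha1; lra.
have e : 1 + a - 2 * (1 / 4 + s) = 2^-1 by field.
by have := wt_rh_pow hp; rewrite e.
Qed.

Let Rm y := \int[mu]_x kW A m s wt x y.

Let kW_eq W x y : kW A m s W x y = - (Ks s (x - y) * (W y - W x)) - W x * rh y `^ (- (1 + s)).
Proof. by rewrite /kW /Ks distrC; ring. Qed.

Let k0N h : k0 s (- h) = k0 s h. Proof. by rewrite /k0 /Ks normrN. Qed.

Let ik0 y : itg mu (fun x => k0 s (y - x)) /\ \int[mu]_x k0 s (y - x) = kb.
Proof.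
have ik := itg_k0 s0.
have e x : k0 s (y - x) = k0 s (x + - y) by rewrite -k0N opprB.
split; first by apply: eq_itg (itg_shift (- y) ik).
by rewrite (eqI mu e) (I_shift (- y) ik).
Qed.

Let kn : 2 * kk s != 0. Proof. by rewrite gt_eqF// mulr_gt0. Qed.

(** As [wt] has mass one, the tail subtracted in [kW] integrates to exactly [rh y^(-1-s)], while the
    singular part gives [absD s wt]. Thus [Rm] is the error in replacing [absD s wt] by a multiple
    of that power. *)
Lemma Rm_spec y : Rm y = - (2 * kk s * absD s wt y) - rh y `^ (- (1 + s)) /\
  `|Rm y| <= 384 * (wt y * kb + c * A `^ 2^-1 * P4 * rh y `^ (- (3 / 2 + s))).
Proof.
have [a1 a2] := andP ha1.
have [i1 e1] := absD_diff y s0 (qC_wt m A0 2 a1).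
have i2 : itg mu (fun x => Ks s (x - y) * (wt y - wt x)).
  by apply: eq_itg (itg_shift (- y) i1) => x; rewrite (addrC y) subrK.
have e2 : \int[mu]_x (Ks s (x - y) * (wt y - wt x)) = 2 * kk s * absD s wt y.
  rewrite e1 mulrA (mulfV kn) mul1r -[RHS](I_shift (- y) i1).
  by apply: eqI => x; rewrite (addrC y) subrK.
have i3 := itgZr (rh y `^ (- (1 + s))) iw.
have ikW : itg mu (fun x => kW A m s wt x y).
  by apply: eq_itg (itgB (itgN i2) i3) => x; exact: kW_eq.
split.
  rewrite /Rm (eqI mu (fun x => kW_eq wt x y)) (IB (itgN i2) i3) (IN i2) e2.
  by rewrite (IZr _ iw) (I_wt m a0 A0) mul1r.
have [j1 f1] := ik0 y; have [j2 f2] := iwh.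
have k1 := itgZ (wt y) j1; have k2 := itgZr (rh y `^ (- (3 / 2 + s))) j2.
rewrite -f1 -f2 -(IZ _ j1) -(IZr _ j2) -(ID k1 k2) -(IZ _ (itgD k1 k2)).
apply: (le_abs_Idom (itgZ _ (itgD k1 k2)) (itg_measurable ikW)) => x.
have W0 z : 0 <= wt z := ltW (w0 z).
have := kW_bound hA s0 W0 (@wnear_wt8 _ a A m a0 A0 x y).
by rewrite /Ek [_ * (_ * _ `^ _)]mulrA.
Qed.

Let sq3 (x y z : R) : (x + y + z) ^+ 2 <= 3 * (x ^+ 2 + y ^+ 2 + z ^+ 2).
Proof.
have h1 := sqr_ge0 (x - y); have h2 := sqr_ge0 (y - z); have h3 := sqr_ge0 (x - z).
rewrite !expr2 in h1 h2 h3 *; lra.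
Qed.

Let sq2 (x y : R) : (x + y) ^+ 2 <= 2 * (x ^+ 2 + y ^+ 2).
Proof. by have := sqr_ge0 (x - y); rewrite !expr2; lra. Qed.

Let I_om2 : itg mu (fun x => om x ^+ 2) /\ \int[mu]_x (om x ^+ 2) = 1.
Proof.
have e x : om x ^+ 2 = wt x := om_sqr m a0 A0 x.
by split; [apply: eq_itg iw|rewrite (eqI mu e) (I_wt m a0 A0)].
Qed.

Let N0_ge0 : 0 <= N0.
Proof. by apply: I_ge0 => x; rewrite mulr_ge0 ?sqr_ge0 ?(ltW (w0 x)). Qed.

Let N1_ge0 : 0 <= N1.
Proof. by apply: I_ge0 => x; rewrite mulr_ge0 ?sqr_ge0 ?(ltW (w0 x)). Qed.

Let kb0 : 0 <= kb. Proof. by apply: I_ge0 => h; exact: k0_ge0. Qed.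

Let iuw : itg mu (fun x => `|u x| * wt x).
Proof.
have [M hM] := qd_bounded (qC_qd hu).
apply: eq_itg (itgMb iw (measurableT_comp _ mu_ : measurable_fun setT (fun x => `|u x|)) (r := M) _) => [x|//|x].
  by rewrite mulrC.
by rewrite normr_id.
Qed.

Let uw_le : (\int[mu]_x (`|u x| * wt x)) ^+ 2 <= N0.
Proof.
have [i2 e2] := I_om2.
have := @cauchy_schwarz _ _ _ mu (fun x => `|u x| * om x) om muo mo iuo i2.
rewrite (eqI mu uo2) e2 mulr1; apply: le_trans.
rewrite le_eqVlt; apply/orP; left; apply/eqP; congr (_ ^+ 2); apply: eqI => x.
by rewrite -mulrA -expr2 (om_sqr m a0 A0).
Qed.

Let Uw_le : (\int[mu]_x (U x * wt x)) ^+ 2 <= N1.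
Proof.
have [i2 e2] := I_om2.
have mUo : measurable_fun setT (fun x => U x * om x) by exact: measurable_funM.
have e x : (U x * om x) ^+ 2 = U x ^+ 2 * wt x by rewrite exprMn (om_sqr m a0 A0).
have i1 : itg mu (fun x => (U x * om x) ^+ 2) by apply: eq_itg iN1.
have := @cauchy_schwarz _ _ _ mu (fun x => U x * om x) om mUo mo i1 i2.
rewrite (eqI mu e) e2 mulr1; apply: le_trans.
rewrite le_eqVlt; apply/orP; left; apply/eqP; congr (_ ^+ 2); apply: eqI => x.
by rewrite -mulrA -expr2 (om_sqr m a0 A0).
Qed.

Definition C_low : R :=
  3 * (4 * kk s ^+ 2 + 384 ^+ 2 * (kb ^+ 2 + c * P4 ^+ 2 * Pq 1)).

Let Pq_ge0 (p : R) : 0 <= Pq p. Proof. by apply: I_ge0 => x; exact: powR_ge0. Qed.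

(** By symmetry of the form, [|D|^s] passes from [u] to [wt]; inserting [Rm_spec] and solving yields
    [I_low = - 2 kk (int U wt) - int Rm u]. The first integral is bounded through [N1], the second
    through [N0]; the factor 3 in [C_low] comes from squaring a sum of three terms. *)
Lemma I_low_bound : I_low ^+ 2 <= C_low * (N0 + N1).
Proof.
have [a1 a2] := andP ha1.
have hw4 := qC_wt m A0 4 a1; have hw2 := qC_wt m A0 2 a1; have hw1 := qC_wt m A0 1 a1.
have eUw : \int[mu]_x (U x * wt x) = \int[mu]_y (absD s wt y * u y).
  rewrite (absD_pairing s2 hu hw1) (absD_pairing s2 hw4 hu1); congr (_ * _).
  by apply: eqJ => x h; rewrite [dl u x h * _]mulrC.
have iDw := itg_absDM (k := 1) hs1 hw2 (qC_itg hu).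
have eR y : Rm y * u y = - (2 * kk s) * (absD s wt y * u y) - u y * rh y `^ (- (1 + s)).
  by rewrite (Rm_spec y).1; ring.
have j1 := itgZ (- (2 * kk s)) iDw.
have iR : itg mu (fun y => Rm y * u y) by apply: eq_itg (itgB j1 ilow).
have IR : \int[mu]_y (Rm y * u y) = - (2 * kk s) * \int[mu]_x (U x * wt x) - I_low.
  by rewrite (eqI mu eR) (IB j1 ilow) (IZ _ iDw) eUw.
have X2 := uw_le; have Y2 := Uw_le.
set X := \int[mu]_x (`|u x| * wt x) in X2 *.
have X0 : 0 <= X by apply: I_ge0 => x; rewrite mulr_ge0 ?(ltW (w0 x)).
have S0 : 0 <= I_lower by apply: I_ge0 => x; rewrite mulr_ge0 ?powR_ge0.
pose W := c * A `^ 2^-1 * P4.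
have bR : `|\int[mu]_y (Rm y * u y)| <= 384 * (kb * X + W * I_lower).
  have k1 := itgZ kb iuw; have k2 := itgZ W ilower.
  rewrite -(IZ _ iuw) -(IZ _ ilower) -(ID k1 k2) -(IZ _ (itgD k1 k2)).
  apply: (le_abs_Idom (itgZ _ (itgD k1 k2)) (itg_measurable iR)) => y.
  rewrite normrM; apply: (le_trans (ler_wpM2r (normr_ge0 _) (Rm_spec y).2)).
  by rewrite -/W le_eqVlt; apply/orP; left; apply/eqP; ring.
have eT : I_low = - (2 * kk s) * \int[mu]_x (U x * wt x) - \int[mu]_y (Rm y * u y).
  by rewrite IR; ring.
set Y := \int[mu]_x (U x * wt x) in eT Y2; set Z := \int[mu]_y _ in eT bR.
(* The square of [W] is proportional to [A], precisely the power that [I_lower_bound] absorbs. *)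
have W2 : (W * I_lower) ^+ 2 <= c * P4 ^+ 2 * Pq 1 * N0.
  have e : (W * I_lower) ^+ 2 = c * P4 ^+ 2 * (c * A * I_lower ^+ 2).
    have AA : A `^ 2^-1 * A `^ 2^-1 = A.
      rewrite -powRD ?(gt_eqF A0) ?implybT// (_ : 2^-1 + 2^-1 = 1) ?powRr1 ?(ltW A0)//.
      by field.
    by rewrite -[in RHS]AA /W; ring.
  have cP : 0 <= c * P4 ^+ 2 by rewrite mulr_ge0 ?sqr_ge0 ?(ltW c0).
  by rewrite e -(mulrA (c * P4 ^+ 2)); exact: (ler_wpM2l cP I_lower_bound).
rewrite eT.
apply: (@le_trans _ _ (3 * ((2 * kk s * Y) ^+ 2 + (384 * (kb * X)) ^+ 2 + (384 * (W * I_lower)) ^+ 2))).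
  have sqn := real_normK (num_real (2 * kk s * Y)).
  apply: (@le_trans _ _ ((`|2 * kk s * Y| + 384 * (kb * X) + 384 * (W * I_lower)) ^+ 2)).
    set Q := _ - Z; rewrite -(real_normK (num_real Q)) /Q.
    apply: lerXn2r; [by rewrite nnegrE normr_ge0|rewrite nnegrE|].
      have t1 := le_trans (normr_ge0 _) bR; have t2 := normr_ge0 (2 * kk s * Y).
      lra.
    apply: (le_trans (ler_normB _ _)); rewrite mulNr normrN; lra.
  by have := sq3 `|2 * kk s * Y| (384 * (kb * X)) (384 * (W * I_lower)); rewrite sqn.
set a1' := 4 * kk s ^+ 2; set b1 := 384 ^+ 2 * kb ^+ 2; set d1 := 384 ^+ 2 * (c * P4 ^+ 2 * Pq 1).
have a1p : 0 <= a1' by rewrite mulr_ge0 ?sqr_ge0.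
have b1p : 0 <= b1 by rewrite mulr_ge0 ?sqr_ge0.
have d1p : 0 <= d1.
  by rewrite mulr_ge0 ?sqr_ge0// mulr_ge0 ?Pq_ge0// mulr_ge0 ?sqr_ge0 ?(ltW c0).
have -> : C_low = 3 * (a1' + (b1 + d1)) by rewrite /C_low /a1' /b1 /d1; ring.
have t1 : (2 * kk s * Y) ^+ 2 <= a1' * N1.
  by rewrite (_ : _ ^+ 2 = a1' * Y ^+ 2) ?ler_wpM2l// /a1'; ring.
have t2 : (384 * (kb * X)) ^+ 2 <= b1 * N0.
  by rewrite (_ : _ ^+ 2 = b1 * X ^+ 2) ?ler_wpM2l// /b1; ring.
have t3 : (384 * (W * I_lower)) ^+ 2 <= d1 * N0.
  rewrite exprMn /d1 -(mulrA (384 ^+ 2)); have sq := sqr_ge0 (384 : R).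
  exact: (ler_wpM2l sq W2).
have p1 := mulr_ge0 a1p N0_ge0; have p2 := mulr_ge0 b1p N1_ge0; have p3 := mulr_ge0 d1p N1_ge0.
move: (_ ^+ 2) (_ ^+ 2) (_ ^+ 2) t1 t2 t3 => q1 q2 q3 t1 t2 t3.
lra.
Qed.

Let us x := u x * om x.
Let huo : qC 2 us. Proof. exact: qCM hu2 (bC_om m a0 A0 2). Qed.

Let Vm x := \int[mu]_h (u (x + h) * kW A m s om x (x + h)).
Let F1 x := \int[mu]_h (`|us (x + h)| * k0 s h).

(** With [us = u om], the difference of [us] minus [om x] times the difference of [u] is
    [u (x + h) (om x - om (x + h))]. Subtracting the tail in [kW] isolates the rank one term
    [om x * I_low] and leaves [Vm]. *)
Lemma Vm_spec x :
  absD s us x = om x * U x + (2 * kk s)^-1 * (Vm x + om x * I_low) /\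
  `|Vm x| <= 384 * (F1 x + om x * rh x `^ 2^-1 * I_lower).
Proof.
have [i1 e1] := absD_diff x s0 huo; have [i2 e2] := absD_diff x s0 hu2.
have i2' := itgZ (om x) i2; have i3 := itgB i1 i2'.
have il (f : R -> R) : itg mu f -> itg mu (fun h => f (x + h)) /\ \int[mu]_h f (x + h) = \int[mu]_h f h.
  move=> hf; split; first by apply: eq_itg (itg_shift x hf) => h; rewrite addrC.
  by rewrite -(I_shift x hf); apply: eqI => h; rewrite addrC.
have [j1 f1] := il _ ilow; have [j2 f2] := il _ ilower.
have i4 := itgB i3 (itgZ (om x) j1).
have eV h : u (x + h) * kW A m s om x (x + h) =
    Ks s h * (us x - us (x + h)) - om x * (Ks s h * (u x - u (x + h)))
    - om x * (u (x + h) * rh (x + h) `^ (- (1 + s))).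
  by rewrite /kW (_ : x + h - x = h) /us; ring.
have iV : itg mu (fun h => u (x + h) * kW A m s om x (x + h)) by apply: eq_itg i4.
split.
  have -> : Vm x = 2 * kk s * absD s us x - om x * (2 * kk s * U x) - om x * I_low.
    rewrite /Vm (eqI mu eV) (IB i3 (itgZ (om x) j1)) (IB i1 i2') (IZ _ i2) (IZ _ j1) f1.
    congr (_ - om x * _ - _).
      by rewrite e1 mulrA (mulfV kn) mul1r.
    by rewrite e2 mulrA (mulfV kn) mul1r.
  move: (absD s us x) (U x) => X Y.
  by field; rewrite gt_eqF.
have ius : itg mu us := qC_itg huo.
have iF : itg mu (fun h => `|us (x + h)| * k0 s h).
  have [M hM] := qd_bounded (qC_qd huo).
  have mus := measurable_abs_shift x (qC_measurable huo).
  have b h : `| `|us (x + h)| | <= M by rewrite normr_id; exact: hM.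
  by apply: eq_itg (itgMb (itg_k0 s0) mus b) => h; rewrite mulrC.
have k2 := itgZ (om x * rh x `^ 2^-1) j2.
rewrite /F1 /I_lower -f2 -(IZ _ j2) -(ID iF k2) -(IZ _ (itgD iF k2)).
apply: (le_abs_Idom (itgZ _ (itgD iF k2)) (itg_measurable iV)) => h.
have W0 z : 0 <= om z := ltW (o0 z).
have := kW_bound hA s0 W0 (@wnear_om _ a A m a0 A0 x (x + h)).
rewrite (_ : x + h - x = h); last by ring.
rewrite normrM => kb'; apply: (le_trans (ler_wpM2l (normr_ge0 _) kb')).
rewrite /us /Ek normrM (ger0_norm (W0 _)) le_eqVlt; apply/orP; left; apply/eqP; ring.
Qed.

Definition C_M : R := 3 + (2 * kk s)^-1 ^+ 2 *
  (6 * 384 ^+ 2 * (kb ^+ 2 + Pq s * Pq 1) + 3 * C_low).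

Lemma absD_us_bound :
  \int[mu]_x (absD s us x * absD s us x) <=
  C_M * \int[mu]_x ((u x ^+ 2 + U x ^+ 2) * wt x).
Proof.
set ka := (2 * kk s)^-1.
have [M hM] := qd_bounded (qC_qd huo).
have us2 x : us x ^+ 2 = u x ^+ 2 * wt x by rewrite /us exprMn (om_sqr m a0 A0).
have ius2 : itg mu (fun x => us x ^+ 2) by apply: eq_itg iN0.
have [iF bF] := convolution_bound s0 (qC_continuous huo) (qC_itg huo) ius2 (ex_intro _ M hM).
rewrite (eqI mu us2) -/N0 -/kb in bF; have [iwrh ewrh] := iwr.
set T2 := I_low ^+ 2; set S2 := I_lower ^+ 2; have T2b := I_low_bound; rewrite -/T2 in T2b.
have Sb := I_lower_bound; rewrite -/S2 in Sb.
have V2 x : Vm x ^+ 2 <= 384 ^+ 2 * (2 * (F1 x ^+ 2 + S2 * (wt x * rh x))).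
  have [_ b] := Vm_spec x; rewrite -(real_normK (num_real (Vm x))).
  apply: (@le_trans _ _ ((384 * (F1 x + om x * rh x `^ 2^-1 * I_lower)) ^+ 2)).
    apply: lerXn2r b; rewrite nnegrE; first exact: normr_ge0.
    exact: le_trans (normr_ge0 _) (Vm_spec x).2.
  rewrite exprMn; apply: (ler_wpM2l (sqr_ge0 _)).
  have rr : (rh x `^ 2^-1) ^+ 2 = rh x.
    rewrite -(powR_mulrn 2 (powR_ge0 _ _)) -powRrM (_ : 2^-1 * 2%:R = 1) ?powRr1 ?(ltW (r0 x))//.
    by field.
  have -> : S2 * (wt x * rh x) = (om x * rh x `^ 2^-1 * I_lower) ^+ 2.
    by rewrite !exprMn rr (om_sqr m a0 A0) /S2; ring.
  exact: sq2.
rewrite /C_M -/ka; move: (384 ^+ 2) (sqr_ge0 (384 : R)) V2 => k384 c384 V2.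
have pt x : absD s us x * absD s us x <=
    3 * (U x ^+ 2 * wt x) + ka ^+ 2 * (6 * k384 * (F1 x ^+ 2 + S2 * (wt x * rh x)) + 3 * (T2 * wt x)).
  have [e _] := Vm_spec x; rewrite -/ka in e.
  have -> : T2 * wt x = (om x * I_low) ^+ 2 by rewrite exprMn (om_sqr m a0 A0) mulrC.
  have -> : U x ^+ 2 * wt x = (om x * U x) ^+ 2 by rewrite exprMn (om_sqr m a0 A0) mulrC.
  have := sq3 (om x * U x) (ka * Vm x) (ka * (om x * I_low)).
  rewrite -addrA -mulrDr -e [X in X <= _]expr2 !(exprMn 2 ka) => h; apply: (le_trans h).
  have := ler_wpM2l (sqr_ge0 ka) (V2 x).
  exact: commutator_arith1.
have j1 := itgZ 3 iN1.
have j2 := itgD iF (itgZ S2 iwrh).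
have j3 := itgD (itgZ (6 * k384) j2) (itgZ 3 (itgZ T2 iw)).
have j4 := itgD j1 (itgZ (ka ^+ 2) j3).
apply: (le_trans (le_I (itg_absD2 (k := 1) hs1 huo) j4 pt)).
rewrite (ID j1 (itgZ (ka ^+ 2) j3)) (IZ _ iN1) (IZ _ j3).
rewrite (ID (itgZ (6 * k384) j2) (itgZ 3 (itgZ T2 iw))) (IZ _ j2) (IZ _ (itgZ T2 iw)) (IZ _ iw).
rewrite (ID iF (itgZ S2 iwrh)) (IZ _ iwrh) (I_wt m a0 A0) ewrh mulr1 -/N1.
have -> : \int[mu]_x ((u x ^+ 2 + U x ^+ 2) * wt x) = N0 + N1.
  by rewrite -(ID iN0 iN1); apply: eqI => x; rewrite mulrDl.
set f2 := \int[mu]_x _ in bF *.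
(* The factor [A] produced by the moment of [wt * rh] is again the one in [I_lower_bound]. *)
have b1 : S2 * (c * A * Pq s) <= Pq s * Pq 1 * N0.
  rewrite (_ : S2 * _ = Pq s * (c * A * S2)); last by ring.
  by rewrite -(mulrA (Pq s)); apply: (ler_wpM2l (Pq_ge0 s) Sb).
have ka2 := sqr_ge0 ka.
have K1 := ler_wpM2l c384 (lerD bF b1).
have q1 : 0 <= k384 * (kb ^+ 2 + Pq s * Pq 1) * N1.
  by rewrite !mulr_ge0 ?addr_ge0 ?sqr_ge0 ?mulr_ge0 ?Pq_ge0.
rewrite -mulrDl in K1; have K2 := commutator_arith2 K1 T2b q1.
have K3 := ler_wpM2l ka2 K2.
rewrite [leRHS]mulrDl; apply: lerD; last by rewrite -(mulrA (ka ^+ 2)).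
by rewrite mulrDr lerDr mulr_ge0.
Qed.

End low_frequency.

End commutator.

Lemma C_M_ge0 (R : realType) (a : R) : 0 < a < 2 -> 0 <= C_M a.
Proof.
move=> /C_phi_gt0/ltW c0; rewrite /C_M /C_low.
have P0 p : 0 <= Pq p :> R by apply: I_ge0 => x; exact: powR_ge0.
move: (384 ^+ 2) (sqr_ge0 (384 : R)) => k k0.
have m3 (x : R) : 0 <= x -> 0 <= 3 * x by move=> x0; exact: mulr_ge0.
have m6 (x : R) : 0 <= x -> 0 <= 6 * x by move=> x0; exact: mulr_ge0.
apply: addr_ge0 => //; apply: mulr_ge0; first exact: sqr_ge0.
apply: addr_ge0.
  apply: mulr_ge0; first exact: m6.
  by apply: addr_ge0; [exact: sqr_ge0|exact: mulr_ge0].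
do 2 apply: (m3); apply: addr_ge0; first by apply: mulr_ge0 => //; exact: sqr_ge0.
apply: mulr_ge0 => //; apply: addr_ge0; first exact: sqr_ge0.
by apply: mulr_ge0 => //; apply: mulr_ge0 => //; exact: sqr_ge0.
Qed.

(** * The bilinear bound for alpha > 1 *)

Section supercritical.
Context (R : realType).
Notation mu := (@lebesgue_measure R).
Variables (a A m : R) (u v : R -> R).
Hypotheses (ha1 : 1 < a < 2) (hA : 1 <= A) (hu : qC 4 u) (hv : qC 1 v).
Notation wt := (wt a A m).
Notation om := (om a A m).
Notation s := (a / 2).
Notation U := (absD s u).
Implicit Types (x y h : R).

Let ha : 0 < a < 2. Proof. by have /andP[? ?] := ha1; apply/andP; split; lra. Qed.
Let A0 : 0 < A. Proof. exact: lt_le_trans hA. Qed.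
Let hu1 : qC 1 u. Proof. by do 3 apply: qCW. Qed.
Let hu2 : qC 2 u. Proof. by do 2 apply: qCW. Qed.
Let hs1 : 0 < s < 2 * 1%:R - 1. Proof. by have /andP[? ?] := ha1; apply/andP; split; lra. Qed.

Let final_arith (t k c z n0 nv n1 : R) : 0 <= t * (k * c * nv) -> 0 <= t * z * n1 -> 0 <= t * z * nv ->
  t * (k * c * (n0 + n1) + 6 * z * n0) + 2 * z * t * nv + z * t * (n0 + nv) <=
  (k * c + 7 * z) * t * (n0 + nv + n1).
Proof. lra. Qed.

Let C0 : R := 48 ^+ 2.
Let C00 : 0 <= C0. Proof. exact: sqr_ge0. Qed.
Let Z0 : R := C0 * CE a 2.
Let Z00 : 0 <= Z0. Proof. by rewrite mulr_ge0// CE_ge0//; case/andP: ha. Qed.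
Let Y : R := A `^ (- a).
Let th : R := A `^ (- s).
Let N0 := \int[mu]_x (u x ^+ 2 * wt x).
Let Nv := \int[mu]_x (v x ^+ 2 * wt x).
Let N1 := \int[mu]_x (U x ^+ 2 * wt x).

Let Yth : Y = th * th.
Proof. by rewrite /Y /th -powRD ?(gt_eqF A0) ?implybT//; congr (_ `^ _); field. Qed.

Let th0 : 0 < th. Proof. exact: powR_gt0. Qed.

Let th1 : th <= 1.
Proof.
have sN : - s <= 0 by have /andP[? ?] := ha1; lra.
by have := le_powR_neg sN (_ : 0 < 1 <= A); rewrite powR1; apply; rewrite ltr01.
Qed.

Let us x := u x * om x.
Let huo : qC 2 us. Proof. exact: qCM hu2 (bC_om m ha A0 2). Qed.

Let Ediff x h := (u x - u (x + h)) ^+ 2 * (wt x + wt (x + h)).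

Let wt_u2 : \int[mu]_x ((u x ^+ 2 + u x ^+ 2) * wt x) = 2 * N0.
Proof. by rewrite (I_sqr2_wt m ha A0 hu hu) -/N0; ring. Qed.

(* The energy weighted by w is, up to second order differences, the form on (u, u w), that is
   the energy of u sqrt w. *)
Lemma weighted_energy_bound : it2 (fun x h => K a h * Ediff x h) /\
  J (fun x h => K a h * Ediff x h) <=
    4 * kk a * \int[mu]_x (absD s us x * absD s us x) + 6 * (Z0 * Y) * N0.
Proof.
have huw : qC 1 (fun y => u y * wt y) := qCM hu1 (bC_wt m ha A0 1).
have i1 := it2_dl2 ha hu1 huw.
have hf : qC 1 (fun x => u x * u x) := qCM hu1 (qC_bC hu1).
have i3 : it2 (fun x h => K a h * (dl (fun y => u y * u y) x h * dl wt x h)).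
  apply: Bd_it2 => //; last exact: Bd_dl_qb hf (bC_wt m ha A0 1).
  by apply: m2M; apply: m2_dl; [exact: qC_measurable hf|exact: measurable_wt].
have e x h : K a h * Ediff x h = 2 * (K a h * (dl u x h * dl (fun y => u y * wt y) x h))
   - K a h * (dl (fun y => u y * u y) x h * dl wt x h).
  by rewrite /Ediff /dl; ring.
have i4 := it2B (it2Z 2 i1) i3; split; first exact: eq_it2 e i4.
rewrite (eqJ e) (JB (it2Z 2 i1) i3) (JZ _ i1) (J_second_diff m ha A0 hu1 hu1).
have b1 := form_sym_bound m ha A0 hu1.
have [_ b2] := it2_second_diff m ha A0 hu1 hu1.
have [_ ] := absD_half_pairing ha huo huo.
rewrite wt_u2 in b2; rewrite -/N0 -/Y in b1 b2.
rewrite -/C0 in b1 b2; rewrite -/us in b1.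
set X1 := J _ in b1 *; set X2 := J _ in b1 *; set X3 := J _ in b2 *.
move=> e2; have -> : 4 * kk a * \int[mu]_x (absD s us x * absD s us x) = 2 * X2.
  by rewrite e2 -/X2; field; rewrite gt_eqF// kk_gt0.
have h1 := le_trans (ler_norm _) b1.
have h2 := le_trans (ler_norm _) (eq_ind_r (fun z => z <= _) b2 (normrN X3)).
have -> : 6 * (Z0 * Y) * N0 = 2 * (2 * C0 * CE a 2 * Y * N0) + C0 * CE a 2 * Y * (2 * N0).
  by rewrite /Z0; ring.
by lra.
Qed.

(** The integrand splits into [T1] and a product of first differences that [J_second_diff] handles.
    In [T1] the difference of [wt] factors as [(P - Q) * (P + Q)], so Young's inequality separates
    the energy of [u], with coefficient [th], from a second order term in [v], with coefficient
    [1 / th]. The latter gains [A^(-a) = th^2], so both end up of size [th]. *)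
Lemma form_antisym_bound_gt1 :
  `|J (fun x h => K a h * ((u x * v (x + h) - u (x + h) * v x) * (wt x - wt (x + h))))| <=
  (4 * kk a * C_M a + 7 * Z0) * th *
    \int[mu]_x ((u x ^+ 2 + v x ^+ 2 + U x ^+ 2) * wt x).
Proof.
have mu_ := qC_measurable hu1; have mv := qC_measurable hv.
have mw := measurable_wt m ha A0; have mo := measurable_om m ha A0.
have [iE bE] := weighted_energy_bound.
have iv := itg_sqr_wt m ha A0 hv.
have a2 : a < 2%:R by case/andP: ha.
pose TV x h := (v x ^+ 2 + v (x + h) ^+ 2) * S1 a A m x h.
have S0 x h : 0 <= S1 a A m x h := sqr_ge0 _.
have mS := m2_S1 m ha A0.
have mTV : m2 TV.
  apply: m2M => //; apply: m2D; first exact: (m2_fun1 (measurable_funX 2 mv)).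
  exact: (m2_shift (measurable_funX 2 mv)).
have TV0 x h : 0 <= TV x h by rewrite mulr_ge0// addr_ge0// sqr_ge0.
have [iV bV] : it2 (fun x h => K a h * TV x h) /\
    J (fun x h => `|K a h * TV x h|) <= 2 * C0 * CE a 2 * A `^ (- a) * Nv.
  apply: (AM_bound ha A0 C00 a2 mS (NFb_S1 m ha A0) S0 mv iv mTV) => x h h0.
  by rewrite ger0_norm.
have hf : qC 1 (fun x => u x * v x) := qCM hu1 (qC_bC hv).
have i3 : it2 (fun x h => K a h * (dl (fun y => u y * v y) x h * dl wt x h)).
  apply: Bd_it2 => //; last exact: Bd_dl_qb hf (bC_wt m ha A0 1).
  by apply: m2M; apply: m2_dl; [exact: qC_measurable hf|exact: measurable_wt].
have [_ b3] := it2_second_diff m ha A0 hu1 hv.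
rewrite -(J_second_diff m ha A0 hu1 hv) (I_sqr2_wt m ha A0 hu1 hv) -/N0 -/Nv -/Y -/C0 in b3.
pose T1 x h := (u x - u (x + h)) * (v x + v (x + h)) * (wt x - wt (x + h)).
have [_ iF] := form_antisym m ha A0 hu1 hv.
have e x h : K a h * ((u x * v (x + h) - u (x + h) * v x) * (wt x - wt (x + h))) =
   K a h * T1 x h - K a h * (dl (fun y => u y * v y) x h * dl wt x h).
  by rewrite /T1 /dl; ring.
have i1 : it2 (fun x h => K a h * T1 x h).
  by apply: eq_it2 (it2D iF i3) => x h; rewrite e subrK.
have iM := it2D (it2Z th iE) (it2Z th^-1 iV).
have b1 : `|J (fun x h => K a h * T1 x h)| <=
   J (fun x h => th * (K a h * Ediff x h) + th^-1 * (K a h * TV x h)).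
  apply: (le_abs_J iM (it2_m2 i1)) => x h.
  rewrite normrM (ger0_norm (K_ge0 a h)) mulrCA (mulrCA th^-1) -mulrDr ler_wpM2l ?K_ge0//.
  have ti : 0 < th^-1 by rewrite invr_gt0.
  rewrite /T1 /Ediff /TV /S1 -!(om_sqr m ha A0).
  set P := om x; set Q := om (x + h).
  rewrite (_ : _ * _ = ((u x - u (x + h)) * (P + Q)) * ((v x + v (x + h)) * (P - Q))); last by ring.
  apply: (@le_trans _ _ (2^-1 * (th * ((u x - u (x + h)) * (P + Q)) ^+ 2
      + th^-1 * ((v x + v (x + h)) * (P - Q)) ^+ 2))).
    move: (_ * (P + Q)) (_ * (P - Q)) => X1 X2.
    have k1 := mulr_ge0 (ltW ti) (sqr_ge0 (th * X1 - X2)).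
    have k2 := mulr_ge0 (ltW ti) (sqr_ge0 (th * X1 + X2)).
    have x1 : th^-1 * (th * X1 - X2) ^+ 2 = th * X1 ^+ 2 - 2 * (X1 * X2) + th^-1 * X2 ^+ 2.
      by field; rewrite gt_eqF.
    have x2 : th^-1 * (th * X1 + X2) ^+ 2 = th * X1 ^+ 2 + 2 * (X1 * X2) + th^-1 * X2 ^+ 2.
      by field; rewrite gt_eqF.
    by rewrite x1 in k1; rewrite x2 in k2; rewrite ler_norml; apply/andP; split; lra.
  rewrite mulrDr; apply: lerD.
    rewrite mulrCA ler_wpM2l ?(ltW th0)// exprMn mulrCA ler_wpM2l ?sqr_ge0//.
    have := sqr_ge0 (P - Q); rewrite !expr2; lra.
  rewrite mulrCA ler_wpM2l ?(ltW ti)// exprMn mulrA ler_wpM2r ?sqr_ge0//.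
  have := sqr_ge0 (v x - v (x + h)); rewrite !expr2; lra.
rewrite (JD (it2Z th iE) (it2Z th^-1 iV)) (JZ _ iE) (JZ _ iV) in b1.
have {}bV : J (fun x h => K a h * TV x h) <= 2 * Z0 * Y * Nv.
  rewrite (_ : 2 * Z0 * Y * Nv = 2 * C0 * CE a 2 * A `^ (- a) * Nv); last by rewrite /Z0 /Y; ring.
  by apply: le_trans bV; apply: (le_J iV (it2_abs iV)) => x h; exact: ler_norm.
have W0 x : 0 <= wt x := wt_ge0 m ha A0 x.
have N00 : 0 <= N0 by apply: I_ge0 => x; rewrite mulr_ge0 ?sqr_ge0.
have Nv0 : 0 <= Nv by apply: I_ge0 => x; rewrite mulr_ge0 ?sqr_ge0.
have N10 : 0 <= N1 by apply: I_ge0 => x; rewrite mulr_ge0 ?sqr_ge0.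
have iu := itg_sqr_wt m ha A0 hu.
have iU : itg mu (fun x => U x ^+ 2 * wt x).
  have [M hM] := absD_bounded (k := 1) hs1 hu2.
  have mU := continuous_measurable_fun (continuous_absD (k := 1) hs1 hu2).
  have b x : `|U x ^+ 2| <= M ^+ 2.
    by rewrite normrX; apply: lerXn2r; rewrite ?nnegrE// (le_trans _ (hM 0)).
  by apply: eq_itg (itgMb (itg_wt m ha A0) (measurable_funX 2 mU) b) => x; rewrite mulrC.
have -> : \int[mu]_x ((u x ^+ 2 + v x ^+ 2 + U x ^+ 2) * wt x) = N0 + Nv + N1.
  rewrite -(ID iu iv) -(ID (itgD iu iv) iU); apply: eqI => x; by rewrite !mulrDl.
have bM : \int[mu]_x (absD s us x * absD s us x) <= C_M a * (N0 + N1).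
  have := absD_us_bound m ha1 hA hu; rewrite (_ : \int[mu]_x (_ * wt x) = N0 + N1)//.
  by rewrite -(ID iu iU); apply: eqI => x; rewrite mulrDl.
rewrite (eqJ e) (JB i1 i3); apply: (le_trans (ler_normB _ _)).
have kk0 := kk_gt0 ha; have CM0 := C_M_ge0 ha.
have Yt : Y <= th by rewrite Yth ler_piMr ?(ltW th0).
have Y1 : Y <= 1 := le_trans Yt th1.
have E1 : J (fun x h => K a h * Ediff x h) <= 4 * kk a * C_M a * (N0 + N1) + 6 * Z0 * N0.
  apply: (le_trans bE); apply: lerD.
    by rewrite -[leRHS]mulrA ler_wpM2l// mulr_ge0// ltW.
  by rewrite ler_wpM2r// ler_wpM2l// ler_piMr.
have E2 : th^-1 * J (fun x h => K a h * TV x h) <= 2 * Z0 * th * Nv.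
  rewrite -ler_pdivlMl ?invr_gt0// invrK.
  rewrite (_ : th * (2 * Z0 * th * Nv) = 2 * Z0 * Y * Nv)//; rewrite Yth; ring.
have E3 : C0 * CE a 2 * Y * (N0 + Nv) <= Z0 * th * (N0 + Nv).
  by rewrite ler_wpM2r ?addr_ge0// ler_wpM2l.
have E4 := ler_wpM2l (ltW th0) E1.
apply: (le_trans (lerD (le_trans b1 (lerD E4 E2)) (le_trans b3 E3))).
have q1 : 0 <= th * (4 * kk a * C_M a * Nv).
  by rewrite mulr_ge0 ?(ltW th0)// mulr_ge0// mulr_ge0// mulr_ge0// ltW.
have q2 := mulr_ge0 (mulr_ge0 (ltW th0) Z00) N10.
have q3 := mulr_ge0 (mulr_ge0 (ltW th0) Z00) Nv0.
exact: final_arith.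
Qed.

End supercritical.

(** * The estimates for Schwartz functions *)

Section estimates_on_the_line.
Context (R : realType).
Notation mu := (@lebesgue_measure R).
Implicit Types (u v : R -> R) (A m : R).

(** The seminorms with weights [1] and [x^2] together bound [(1 + x^2)] times each derivative. *)
Lemma schwartz_qC u k n : schwartz u -> qC k (derive1n n u).
Proof.
move=> [du bu].
have qdn n' : qd (derive1n n' u).
  have [M hM] := bu 0%N n'; have [N hN] := bu 2%N n'.
  exists (M + N) => x; have p : 0 < 1 + x ^+ 2 by rewrite ltr_pwDl// sqr_ge0.
  rewrite /q ler_pdivlMr// mulrC mulrDl mul1r; apply: lerD.
    by have := hM x; rewrite expr0 mul1r.
  by have := hN x; rewrite normrM ger0_norm ?sqr_ge0.
have dn n' (x : R) : is_derive x 1 (derive1n n' u) (derive1n n'.+1 u x).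
  by have h := du n' x; rewrite derive1nS derive1E; exact: DeriveDef.
elim: k n => [|k ih] n.
  by split => // x; exact: der_cont (dn n x).
by split => //; exists (derive1n n.+1 u).
Qed.

Section interior.
Variables (a A m : R).
Hypotheses (ha : 0 < a < 2) (hA : 1 <= A).
Let A0 : 0 < A. Proof. exact: lt_le_trans hA. Qed.
Notation wt := (wt a A m).
Notation om := (om a A m).
Notation phm := (phm a A m).
Notation Y := (A `^ (- a)).
Notation kap := (2 * kk a)^-1.

Let kap0 : 0 < kap. Proof. by rewrite invr_gt0 mulr_gt0// kk_gt0. Qed.

Section pair.
Variables u v : R -> R.
Hypotheses (hu : schwartz u) (hv : schwartz v).
Let qu k : qC k u := schwartz_qC k 0 hu.
Let qv k : qC k v := schwartz_qC k 0 hv.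
Notation us := (fun x => u x * om x).
Notation vs := (fun x => v x * om x).

Lemma sym_bound :
  `|\int[mu]_x (absD a u x * u x * wt x) - \int[mu]_x (absD (a / 2) us x ^+ 2)| <=
  kap * (2 * 48 ^+ 2 * CE a 2) * Y * \int[mu]_x (u x ^+ 2 * wt x).
Proof.
have huw : qC 1 (fun x => u x * wt x) := qCM (qu 1) (bC_wt m ha A0 1).
have huo : qC 2 us := qCM (qu 2) (bC_om m ha A0 2).
have e1 : \int[mu]_x (absD a u x * u x * wt x) =
    kap * J (fun x h => K a h * (dl u x h * dl (fun x => u x * wt x) x h)).
  by rewrite -(absD_pairing ha (qu 4) huw); apply: eqI => x; rewrite mulrA.
have e2 : \int[mu]_x (absD (a / 2) us x ^+ 2) =
    kap * J (fun x h => K a h * (dl us x h * dl us x h)).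
  by rewrite -(absD_half_pairing ha huo huo).2; apply: eqI => x; rewrite expr2.
rewrite e1 e2 -mulrBr normrM (gtr0_norm kap0) -!mulrA ler_wpM2l ?(ltW kap0)//.
by have := form_sym_bound m ha A0 (qu 1); rewrite -!mulrA.
Qed.

Lemma flow_bound :
  `|\int[mu]_x ((absD a u x * derive1 v x + absD a v x * derive1 u x) * phm x)
    + (a - 1) * \int[mu]_x (absD (a / 2) us x * absD (a / 2) vs x)| <=
  kap * (9 * 48 ^+ 2 * CE a 2) * Y * \int[mu]_x ((u x ^+ 2 + v x ^+ 2) * wt x).
Proof.
have huo : qC 2 us := qCM (qu 2) (bC_om m ha A0 2).
have hvo : qC 2 vs := qCM (qv 2) (bC_om m ha A0 2).
have du1 : qC 1 (derive1 u) := schwartz_qC 1 1 hu.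
have dv1 : qC 1 (derive1 v) := schwartz_qC 1 1 hv.
have dd (f : R -> R) : schwartz f -> forall x : R, is_derive x 1 f (derive1 f x).
  by move=> [df _] x; rewrite derive1E; exact: DeriveDef (df 0%N x) (erefl _).
have bphi : bC 1 phm.
  split; first by exists 1 => x; exact: abs_phm.
  exists (fun x => - wt x); split; first exact: is_derive_phm.
  have [c [M hM]] := bC_wt m ha A0 0.
  by split; [move=> x; apply: cvgN; exact: c|exists M => x; rewrite normrN].
have hup : qC 1 (fun x => derive1 u x * phm x) := qCM du1 bphi.
have hvp : qC 1 (fun x => derive1 v x * phm x) := qCM dv1 bphi.
have i1 := it2_dl2 ha (qu 1) hvp; have i2 := it2_dl2 ha (qv 1) hup.
have a0 := ha.
have ha' : 0 < a < 2 * 2%:R - 1 by have /andP[? ?] := a0; apply/andP; split; lra.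
have k1 : itg mu (fun x => absD a u x * (derive1 v x * phm x)).
  exact: (itg_absDM (k := 2) ha' (qu 4) (qC_itg hvp)).
have k2 : itg mu (fun x => absD a v x * (derive1 u x * phm x)).
  exact: (itg_absDM (k := 2) ha' (qv 4) (qC_itg hup)).
have [Mw hMw] := bC_bounded (bC_wt m ha A0 0).
have e1 : \int[mu]_x ((absD a u x * derive1 v x + absD a v x * derive1 u x) * phm x) =
   kap * J (fun x h => K a h * (dl u x h * dl v x h * (wt x + wt (x + h) - (1 + a) * mean_slope phm x h))).
  rewrite -(flow_identity ha (dd u hu) (qC_qd (qu 0)) du1 (dd v hv) (qC_qd (qv 0)) dv1
    (is_derive_phm A m ha) (bC_continuous (bC_wt m ha A0 0)) (@abs_phm _ a A m ha) hMw).
  rewrite (_ : J _ = J (fun x h => K a h * (dl u x h * dl (fun y => derive1 v y * phm y) x h) +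
     K a h * (dl v x h * dl (fun y => derive1 u y * phm y) x h))); last first.
    by apply: eqJ => x h; rewrite mulrDr.
  transitivity (\int[mu]_x (absD a u x * (derive1 v x * phm x)) + \int[mu]_x (absD a v x * (derive1 u x * phm x))).
    by rewrite -(ID k1 k2); apply: eqI => x; rewrite mulrDl -!mulrA.
  rewrite (absD_pairing ha (qu 4) hvp) (absD_pairing ha (qv 4) hup) -mulrDr.
  by congr (_ * _); rewrite (JD i1 i2).
rewrite e1 (absD_half_pairing ha huo hvo).2 mulrCA -mulrDr normrM (gtr0_norm kap0).
rewrite -!mulrA ler_wpM2l ?(ltW kap0)//.
by have := form_flow_bound m ha A0 (qu 1) (qv 1); rewrite -!mulrA.
Qed.

Lemma antisym_eq :
  \int[mu]_x ((absD a u x * v x - absD a v x * u x) * wt x) =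
  kap * J (fun x h => K a h * ((u x * v (x + h) - u (x + h) * v x) * (wt x - wt (x + h)))).
Proof.
have huw : qC 1 (fun x => u x * wt x) := qCM (qu 1) (bC_wt m ha A0 1).
have hvw : qC 1 (fun x => v x * wt x) := qCM (qv 1) (bC_wt m ha A0 1).
have a0 := ha.
have ha' : 0 < a < 2 * 2%:R - 1 by have /andP[? ?] := a0; apply/andP; split; lra.
have k1 : itg mu (fun x => absD a u x * (v x * wt x)).
  exact: (itg_absDM (k := 2) ha' (qu 4) (qC_itg hvw)).
have k2 : itg mu (fun x => absD a v x * (u x * wt x)).
  exact: (itg_absDM (k := 2) ha' (qv 4) (qC_itg huw)).
rewrite -(form_antisym m ha A0 (qu 1) (qv 1)).1 mulrBr.
transitivity (\int[mu]_x (absD a u x * (v x * wt x)) - \int[mu]_x (absD a v x * (u x * wt x))).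
  by rewrite -(IB k1 k2); apply: eqI => x; rewrite mulrBl -!mulrA.
by rewrite (absD_pairing ha (qu 4) hvw) (absD_pairing ha (qv 4) huw).
Qed.

End pair.

End interior.

Definition C_anti (a : R) : R :=
  if a < 1 then 2 * 48 ^+ 2 * CE a 1
  else if a == 1 then pi else 4 * kk a * C_M a + 7 * (48 ^+ 2 * CE a 2).

Lemma C_anti_ge0 (a : R) : 0 < a < 2 -> 0 <= C_anti a.
Proof.
move=> ha; have [a0 a2] := andP ha; have c48 := sqr_ge0 (48 : R); rewrite /C_anti.
case: ifP => a1; first by rewrite mulr_ge0 ?CE_ge0// mulr_ge0.
case: ifP => _; first exact: pi_ge0.
have CM0 := C_M_ge0 ha; have k0 := ltW (kk_gt0 ha).
apply: addr_ge0; first by do 2 apply: mulr_ge0 => //.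
by apply: mulr_ge0 => //; apply: mulr_ge0 => //; exact: CE_ge0.
Qed.

(** For [a > 1] the passage to [B_A] only loses: [A^(-a) <= A^(-a/2)] since [A >= 1], and the
    additional square is nonnegative. This is how the flow estimate, which gains the full power,
    fits the stated bound. *)
Lemma B_A_le (a C A : R) (w u v : R -> R) : 0 < a < 2 -> 1 <= A -> 0 <= C ->
  qC 4 u -> qC 4 v -> (forall x, 0 <= w x) -> (exists M, forall x, w x <= M) ->
  measurable_fun setT w ->
  C * A `^ (- a) * \int[mu]_x ((u x ^+ 2 + v x ^+ 2) * w x) <= B_A a C A w u v.
Proof.
move=> ha hA C0 hu hv w0 [M hM] mw; have [a0 a2] := andP ha.
rewrite /B_A; case: ifPn => a1; first by rewrite powRN.
have hu2 : qC 2 u by do 2 apply: qCW.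
have hs1 : 0 < a / 2 < 2 * 1%:R - 1 by apply/andP; split; lra.
have wM x : `|w x| <= M by rewrite ger0_norm.
have sq k' f : qC k' f -> itg mu (fun x => f x ^+ 2 * w x).
  move=> hf; have [N hN] := qd_bounded (qC_qd hf).
  have i1 : itg mu (fun x => f x ^+ 2).
    by apply: eq_itg (itgMb (qC_itg hf) (qC_measurable hf) hN) => x; rewrite expr2.
  exact: (itgMb i1 mw wM).
have i1 := sq _ _ hu; have i2 := sq _ _ hv.
have i3 : itg mu (fun x => absD (a / 2) u x ^+ 2 * w x).
  have i3' : itg mu (fun x => absD (a / 2) u x ^+ 2).
    by apply: eq_itg (itg_absD2 (k := 1) hs1 hu2) => x; rewrite expr2.
  exact: (itgMb i3' mw wM).
have j1 : itg mu (fun x => (u x ^+ 2 + v x ^+ 2) * w x).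
  by apply: eq_itg (itgD i1 i2) => x; rewrite mulrDl.
have j2 : itg mu (fun x => (u x ^+ 2 + v x ^+ 2 + absD (a / 2) u x ^+ 2) * w x).
  by apply: eq_itg (itgD j1 i3) => x; rewrite mulrDl.
apply: ler_pM.
- by rewrite mulr_ge0 ?powR_ge0.
- by apply: I_ge0 => x; rewrite mulr_ge0 ?addr_ge0 ?sqr_ge0.
- rewrite -(powRN A) ler_wpM2l// ler_powR//; lra.
- by apply: le_I => // x; rewrite ler_wpM2r// lerDl sqr_ge0.
Qed.

Lemma antisym_bound (a A m C : R) u v : 0 < a < 2 -> 1 <= A -> schwartz u -> schwartz v ->
  (2 * kk a)^-1 * C_anti a <= C ->
  `|\int[mu]_x ((absD a u x * v x - absD a v x * u x) * wt a A m x)| <=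
  B_A a C A (wt a A m) u v.
Proof.
move=> ha hA hu hv hC; have A0 : 0 < A by exact: lt_le_trans hA.
have qu k : qC k u := schwartz_qC k 0 hu.
have qv k : qC k v := schwartz_qC k 0 hv.
have kap0 : 0 <= (2 * kk a)^-1 by rewrite invr_ge0 mulr_ge0// ltW// kk_gt0.
have W0 x : 0 <= wt a A m x := wt_ge0 m ha A0 x.
rewrite (antisym_eq m ha hA hu hv) normrM (ger0_norm kap0) /B_A.
move: hC; rewrite /C_anti; case: ifPn => [a1|].
  rewrite (ltW a1) => hC; rewrite -(powRN A).
  apply: (le_trans (ler_wpM2l kap0 (form_antisym_bound_lt1 m ha A0 (qu 1) (qv 1) a1))).
  rewrite !mulrA ler_wpM2r//; first by apply: I_ge0 => x; rewrite mulr_ge0 ?addr_ge0 ?sqr_ge0.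
  by rewrite !mulrA in hC; rewrite ler_wpM2r ?powR_ge0.
rewrite -leNgt => a1; case: ifPn => [/eqP e|a_ne].
  subst a; rewrite lexx => hC; rewrite powRr1 ?(ltW A0)//.
  apply: (le_trans (ler_wpM2l kap0 (form_antisym_bound_eq1 m A0 (qu 1) (qv 1)))).
  rewrite !mulrA ler_wpM2r//; first by apply: I_ge0 => x; rewrite mulr_ge0 ?addr_ge0 ?sqr_ge0.
  by rewrite ler_wpM2r ?invr_ge0 ?(ltW A0).
have a1' : 1 < a by rewrite lt_neqAle eq_sym a_ne.
have ha1 : 1 < a < 2 by rewrite a1' (andP ha).2.
move=> hC; rewrite (lt_geF a1') -(powRN A).
apply: (le_trans (ler_wpM2l kap0 (form_antisym_bound_gt1 m ha1 hA (qu 4) (qv 1)))).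
rewrite !mulrA ler_wpM2r//; first by apply: I_ge0 => x; rewrite mulr_ge0 ?addr_ge0 ?sqr_ge0.
by rewrite !mulrA in hC; rewrite ler_wpM2r ?powR_ge0.
Qed.

End estimates_on_the_line.

(** * The diagonal flow estimate and the constant cut-off *)

Section localized_flows.
Context (R : realType).
Notation mu := (@lebesgue_measure R).
Implicit Types (u v : R -> R) (A m : R).

Lemma derive_schwartz u : schwartz u -> forall x : R, is_derive x 1 u (derive1 u x).
Proof.
by move=> [df _] x; rewrite derive1E; exact: DeriveDef (df 0%N x) (erefl _).
Qed.

(** The case [v = u] of [flow_bound]: the flow integral and the right-hand side both double, and
    dividing by 2 puts the factor [(a - 1) / 2] in front of the energy. *)
Lemma flow_sym_bound (a A m : R) u : 0 < a < 2 -> 1 <= A -> schwartz u ->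
  `|\int[mu]_x (absD a u x * derive1 u x * phm a A m x)
    + (a - 1) / 2 * \int[mu]_x (absD (a / 2) (fun x => u x * om a A m x) x ^+ 2)| <=
  (2 * kk a)^-1 * (9 * 48 ^+ 2 * CE a 2) * A `^ (- a) * \int[mu]_x (u x ^+ 2 * wt a A m x).
Proof.
move=> ha hA hu; have A0 : 0 < A by exact: lt_le_trans hA.
have qu : qC 4 u := schwartz_qC 4 0 hu.
have du1 : qC 1 (derive1 u) := schwartz_qC 1 1 hu.
have ha' : 0 < a < 2 * 2%:R - 1 by have /andP[? ?] := ha; apply/andP; split; lra.
have i1 : itg mu (fun x => absD a u x * derive1 u x * phm a A m x).
  apply: (itgMb (itg_absDM (k := 2) ha' qu (qC_itg du1)) _ (@abs_phm _ a A m ha)).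
  by apply: continuous_measurable_fun => x; exact: (der_cont (is_derive_phm A m ha x)).
have := flow_bound m ha hA hu hu.
rewrite (I_sqr2_wt m ha A0 qu qu).
rewrite (_ : \int[mu]_x _ = 2 * \int[mu]_x (absD a u x * derive1 u x * phm a A m x)); last first.
  rewrite -(IZ _ i1); apply: eqI => x.
  by rewrite [RHS]mulrA mulr_natl mulr2n.
rewrite (_ : \int[mu]_x (absD _ _ x * _) =
    \int[mu]_x (absD (a / 2) (fun x => u x * om a A m x) x ^+ 2)); last first.
  by apply: eqI => x; rewrite expr2.
set X := \int[mu]_x _; set Y := \int[mu]_x _; set D := \int[mu]_x _.
set k := _ * A `^ (- a).
have -> : 2 * X + (a - 1) * Y = 2 * (X + (a - 1) / 2 * Y) by field.
have -> : k * (D + D) = 2 * (k * D) by ring.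
by rewrite normrM (@ger0_norm _ 2)// ler_pM2l.
Qed.

(** The flow identity with [phi = 1] and [w = 0]: all mean slopes vanish and so does the right-hand
    side. This settles the last index, where the cut-off is constant. *)
Lemma flow_one (a : R) u v : 0 < a < 2 -> schwartz u -> schwartz v ->
  \int[mu]_x ((absD a u x * derive1 v x + absD a v x * derive1 u x) * 1) = 0.
Proof.
move=> ha hu hv.
have qu k : qC k u := schwartz_qC k 0 hu.
have qv k : qC k v := schwartz_qC k 0 hv.
have du1 : qC 1 (derive1 u) := schwartz_qC 1 1 hu.
have dv1 : qC 1 (derive1 v) := schwartz_qC 1 1 hv.
have b1 : bC 1 (fun=> 1 : R) := bC_cst 1 1.
have hup : qC 1 (fun x => derive1 u x * 1) := qCM du1 b1.
have hvp : qC 1 (fun x => derive1 v x * 1) := qCM dv1 b1.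
have ha' : 0 < a < 2 * 2%:R - 1 by have /andP[? ?] := ha; apply/andP; split; lra.
have k1 : itg mu (fun x => absD a u x * (derive1 v x * 1)).
  exact: (itg_absDM (k := 2) ha' (qu 4) (qC_itg hvp)).
have k2 : itg mu (fun x => absD a v x * (derive1 u x * 1)).
  exact: (itg_absDM (k := 2) ha' (qv 4) (qC_itg hup)).
transitivity (\int[mu]_x (absD a u x * (derive1 v x * 1)) + \int[mu]_x (absD a v x * (derive1 u x * 1))).
  by rewrite -(ID k1 k2); apply: eqI => x; rewrite mulrDl -!mulrA.
rewrite (absD_pairing ha (qu 4) hvp) (absD_pairing ha (qv 4) hup) -mulrDr.
have i1 := it2_dl2 ha (qu 1) hvp; have i2 := it2_dl2 ha (qv 1) hup.
have d1 (x : R) : is_derive x 1 (fun=> 1 : R) (- 0) by rewrite oppr0; exact: derC.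
have c0 : continuous (fun _ : R => 0 : R) by move=> x; exact: cvg_cst.
have n1 (x : R) : `|1 : R| <= 1 by rewrite normr1.
have n0 (x : R) : `|0 : R| <= 0 by rewrite normr0.
have := @flow_identity R a u v _ _ (fun=> 1) (fun=> 0) ha (derive_schwartz hu) (qC_qd (qu 0)) du1
  (derive_schwartz hv) (qC_qd (qv 0)) dv1 d1 c0 1 0 n1 n0.
rewrite (_ : J _ = J (fun x h => K a h * (dl u x h * dl (fun y => derive1 v y * 1) x h)) +
    J (fun x h => K a h * (dl v x h * dl (fun y => derive1 u y * 1) x h))); last first.
  by rewrite -(JD i1 i2); apply: eqJ => x h; rewrite mulrDr.
move=> ->; rewrite (_ : J _ = 0) ?mulr0//.
rewrite (@eqJ R (fun _ _ => 0)); last first.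
  by move=> x h; rewrite /mean_slope subrr mul0r mulr0 addr0 subr0 !mulr0.
by rewrite /J; exact: I0.
Qed.

Lemma absD_half_zero (a : R) : 0 < a < 2 ->
  \int[mu]_x (absD (a / 2) (fun=> 0) x * absD (a / 2) (fun=> 0) x) = 0.
Proof.
move=> ha; have q0 : qC 2 (fun=> 0 : R).
  have h k : qC k (fun=> 0 : R).
    have d0 : qd (fun=> 0 : R) by exists 0 => x; rewrite normr0 mul0r.
    elim: k => [|k ih]; first by split => // x; exact: cvg_cst.
    by split => //; exists (fun=> 0); split => // x; exact: derC.
  exact: h.
rewrite (absD_half_pairing ha q0 q0).2 (@eqJ R (fun _ _ => 0)); last first.
  by move=> x h; rewrite /dl subrr !mulr0.
by rewrite /J I0 mulr0.
Qed.

Lemma abs_dphiA_interior (a : R) N (rho : nat -> R) A j : 0 < a < 2 -> 0 < A -> (j < N)%N ->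
  phiA a N rho A j = phm a A (midpoint rho j) /\
  abs_dphiA a N rho A j = wt a A (midpoint rho j).
Proof.
move=> ha A0 jN.
have e : phiA a N rho A j = phm a A (midpoint rho j) by apply/funext => x; rewrite /phiA jN.
split => //; apply/funext => x; rewrite /abs_dphiA e derive1E.
have := is_derive_phm A (midpoint rho j) ha x => h.
by rewrite (@derive_val _ _ _ _ _ _ _ h) normrN ger0_norm// wt_ge0.
Qed.

Lemma abs_dphiA_last (a : R) N (rho : nat -> R) A j : (N <= j)%N ->
  phiA a N rho A j = (fun=> 1) /\ abs_dphiA a N rho A j = (fun=> 0).
Proof.
move=> Nj.
have e : phiA a N rho A j = (fun=> 1) by apply/funext => x; rewrite /phiA ltnNge Nj.
by split => //; apply/funext => x; rewrite /abs_dphiA e derive1_cst normr0.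
Qed.

End localized_flows.

Theorem lemma3p1 (R : realType) (alpha : R) (N : nat)
    (halpha : 0 < alpha < 2) :
  (exists C : R, 0 < C /\
    forall (rho : nat -> R) (u : R -> R) (A : R) (j : nat),
      increasing_points N rho -> schwartz u -> 1 < A -> (1 <= j <= N)%N ->
      let f := phiA alpha N rho A j in
      let w := abs_dphiA alpha N rho A j in
      let us := sqrt_weighted w u in
      `| \int[lebesgue_measure]_x (absD alpha u x * u x * w x)
         - \int[lebesgue_measure]_x (absD (alpha / 2) us x ^+ 2) |
        <= C / A `^ alpha * \int[lebesgue_measure]_x (u x ^+ 2 * w x)
      /\
      `| \int[lebesgue_measure]_x (absD alpha u x * derive1 u x * f x)
         + (alpha - 1) / 2 *
           \int[lebesgue_measure]_x (absD (alpha / 2) us x ^+ 2) |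
        <= C / A `^ alpha * \int[lebesgue_measure]_x (u x ^+ 2 * w x))
  /\
  (exists C : R, 0 < C /\
    forall (rho : nat -> R) (u v : R -> R) (A : R) (j : nat),
      increasing_points N rho -> schwartz u -> schwartz v -> 1 < A ->
      (1 <= j <= N)%N ->
      let f := phiA alpha N rho A j in
      let w := abs_dphiA alpha N rho A j in
      let us := sqrt_weighted w u in
      let vs := sqrt_weighted w v in
      `| \int[lebesgue_measure]_x
           ((absD alpha u x * v x - absD alpha v x * u x) * w x) |
        <= B_A alpha C A w u v
      /\
      `| \int[lebesgue_measure]_x
           ((absD alpha u x * derive1 v x + absD alpha v x * derive1 u x) * f x)
         + (alpha - 1) *
           \int[lebesgue_measure]_x
             (absD (alpha / 2) us x * absD (alpha / 2) vs x) |
        <= B_A alpha C A w u v).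
Proof.
have k0 : 0 < (2 * kk alpha)^-1 by rewrite invr_gt0 mulr_gt0// kk_gt0.
have CE0 : 0 <= CE alpha 2 by rewrite CE_ge0//; case/andP: halpha.
have c48 := sqr_ge0 (48 : R).
pose c1 := (2 * kk alpha)^-1 * (9 * 48 ^+ 2 * CE alpha 2).
have c10 : 0 <= c1.
  by apply: mulr_ge0; [exact: ltW|apply: mulr_ge0 => //; exact: mulr_ge0].
have c21 : (2 * kk alpha)^-1 * (2 * 48 ^+ 2 * CE alpha 2) <= c1.
  apply: (ler_wpM2l (ltW k0)); apply: (ler_wpM2r CE0); apply: (ler_wpM2r c48).
  by rewrite ler_nat.
pose c2 := (2 * kk alpha)^-1 * C_anti alpha.
have c20 : 0 <= c2 by apply: mulr_ge0; [exact: ltW|exact: C_anti_ge0].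
have c1p : 0 < 1 + c1 by rewrite ltr_pwDl.
have c12p : 0 < 1 + c1 + c2 by rewrite ltr_pwDl.
have up (X Y : R) : 0 <= X -> 0 <= Y -> forall c, c <= c1 -> c * X * Y <= (1 + c1) * X * Y.
  move=> X0 Y0 c cc; apply: (ler_wpM2r Y0); apply: (ler_wpM2r X0).
  by apply: (le_trans cc); rewrite lerDr.
split.
  (* [c1] is known to be nonnegative only; the summand 1 makes the constant positive. *)
  exists (1 + c1); split => // rho u A j _ hu /ltW hA /andP[_ jN] f w us.
  have A0 : 0 < A := lt_le_trans ltr01 hA.
  (* At [j = N] the weight is zero and the cut-off is one: the weighted integrals are zero, and only
     the flow term needs an argument. *)
  have [jN'|Nj] := ltnP j N; last first.
    have [fE wE] := abs_dphiA_last alpha rho A Nj.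
    have usE : us = (fun=> 0) by apply/funext => x; rewrite /us /sqrt_weighted /w wE sqrtr0 mulr0.
    have I1 : \int[lebesgue_measure]_x (absD alpha u x * u x * w x) = 0.
      by rewrite -[RHS](I0 lebesgue_measure); apply: eqI => x; rewrite /w wE mulr0.
    have I2 : \int[lebesgue_measure]_x (u x ^+ 2 * w x) = 0.
      by rewrite -[RHS](I0 lebesgue_measure); apply: eqI => x; rewrite /w wE mulr0.
    have I3 : \int[lebesgue_measure]_x (absD (alpha / 2) us x ^+ 2) = 0.
      by rewrite -(absD_half_zero halpha) usE; apply: eqI => x; rewrite expr2.
    have qu : qC 4 u := schwartz_qC 4 0 hu.
    have du1 : qC 1 (derive1 u) := schwartz_qC 1 1 hu.
    have ha' : 0 < alpha < 2 * 2%:R - 1.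
      by have /andP[? ?] := halpha; apply/andP; split; lra.
    have iu := itg_absDM (k := 2) ha' qu (qC_itg du1).
    have I4 : \int[lebesgue_measure]_x (absD alpha u x * derive1 u x * f x) = 0.
      have := flow_one halpha hu hu.
      rewrite (_ : \int[lebesgue_measure]_x _ =
        2 * \int[lebesgue_measure]_x (absD alpha u x * derive1 u x)); last first.
        rewrite -(IZ _ iu); apply: eqI => x.
        by rewrite mulr1 mulr_natl mulr2n.
      move=> /eqP; rewrite mulf_eq0 pnatr_eq0/= => /eqP <-.
      by apply: eqI => x; rewrite /f fE mulr1.
    by rewrite I1 I2 I3 I4 !mulr0 subr0 addr0 normr0.
  have [fE wE] := abs_dphiA_interior rho halpha A0 jN'.
  have usE : us = (fun x => u x * om alpha A (midpoint rho j) x).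
    by apply/funext => x; rewrite /us /sqrt_weighted /w wE.
  rewrite usE /f /w fE wE -(powRN A).
  have D0 : 0 <= \int[lebesgue_measure]_x (u x ^+ 2 * wt alpha A (midpoint rho j) x).
    by apply: I_ge0 => x; rewrite mulr_ge0 ?sqr_ge0// wt_ge0.
  have Y0 := powR_ge0 A (- alpha).
  split.
    apply: (le_trans (sym_bound (midpoint rho j) halpha hA hu)).
    exact: (up _ _ Y0 D0 _ c21).
  apply: (le_trans (flow_sym_bound (midpoint rho j) halpha hA hu)).
  exact: (up _ _ Y0 D0 _ (lexx _)).
(* One constant for both estimates: [c1] covers the flow term and [c2] the commutator. *)
exists (1 + c1 + c2); split => // rho u v A j _ hu hv /ltW hA /andP[_ jN] f w us vs.
have A0 : 0 < A := lt_le_trans ltr01 hA.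
have qu : qC 4 u := schwartz_qC 4 0 hu.
have qv : qC 4 v := schwartz_qC 4 0 hv.
have [jN'|Nj] := ltnP j N; last first.
  have [fE wE] := abs_dphiA_last alpha rho A Nj.
  have us0 : us = (fun=> 0) by apply/funext => x; rewrite /us /sqrt_weighted /w wE sqrtr0 mulr0.
  have vs0 : vs = (fun=> 0) by apply/funext => x; rewrite /vs /sqrt_weighted /w wE sqrtr0 mulr0.
  have I1 : \int[lebesgue_measure]_x ((absD alpha u x * v x - absD alpha v x * u x) * w x) = 0.
    by rewrite -[RHS](I0 lebesgue_measure); apply: eqI => x; rewrite /w wE mulr0.
  have I2 : \int[lebesgue_measure]_x (absD (alpha / 2) us x * absD (alpha / 2) vs x) = 0.
    by rewrite us0 vs0; exact: absD_half_zero.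
  have B0 : 0 <= B_A alpha (1 + c1 + c2) A w u v.
    rewrite /B_A; case: ifP => _; rewrite mulr_ge0 ?divr_ge0 ?powR_ge0 ?(ltW c12p)//.
      by apply: I_ge0 => x; rewrite /w wE mulr0.
    by apply: I_ge0 => x; rewrite /w wE mulr0.
  by rewrite I1 I2 /f fE (flow_one halpha hu hv) mulr0 addr0 normr0.
have [fE wE] := abs_dphiA_interior rho halpha A0 jN'.
have usE : us = (fun x => u x * om alpha A (midpoint rho j) x).
  by apply/funext => x; rewrite /us /sqrt_weighted /w wE.
have vsE : vs = (fun x => v x * om alpha A (midpoint rho j) x).
  by apply/funext => x; rewrite /vs /sqrt_weighted /w wE.
rewrite usE vsE /f /w fE wE; split.
  by apply: antisym_bound => //; rewrite -/c2 lerDr ltW.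
have W0 x : 0 <= wt alpha A (midpoint rho j) x := wt_ge0 _ halpha A0 x.
have WM : exists M, forall x, wt alpha A (midpoint rho j) x <= M.
  have [M hM] := bC_bounded (bC_wt (midpoint rho j) halpha A0 0).
  by exists M => x; exact: le_trans (ler_norm _) (hM x).
apply: le_trans (B_A_le halpha hA (ltW c12p) qu qv W0 WM (measurable_wt _ halpha A0)).
apply: (le_trans (flow_bound (midpoint rho j) halpha hA hu hv)); rewrite -/c1.
have D0 : 0 <= \int[lebesgue_measure]_x ((u x ^+ 2 + v x ^+ 2) * wt alpha A (midpoint rho j) x).
  by apply: I_ge0 => x; rewrite mulr_ge0 ?addr_ge0 ?sqr_ge0.
apply: (ler_wpM2r D0); apply: (ler_wpM2r (powR_ge0 _ _)).
by rewrite addrAC lerDr addr_ge0.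
Qed.
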